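(* Let $\epsilon>0$ and set $$t=\epsilon L,\qquad m_j=[L^2(1+\mu_j/L)]\quad (j=1,2),\qquad \varepsilon=\epsilon/L .$$ Then, for $(x_j,\mu_j)\in\mathbb Z\times\mathbb R$, $j=1,2$, $$\lim_{L\to\infty}K(x_1,m_1;x_2,m_2)=\mathcal K^{\epsilon}(x_1,\mu_1,x_2,\mu_2),$$ where $$\mathcal K^{\epsilon}(x_1,\mu_1,x_2,\mu_2)=-\frac{\chi_{\mu_1<\mu_2}}{2\pi i}\oint_{\Gamma_0}e^{\epsilon(\mu_2-\mu_1)(w+1/w)}w^{x_1-x_2-1}\,dw+\frac1{(2\pi i)^2}\oint_{\Gamma_0}\int_{\Sigma\cup\Sigma^{-1}}\frac{e^{\epsilon\mu_2(z+\frac1z)+\frac{\epsilon^2}{2}(z+\frac1z)^2}\,w^{x_1}}{e^{\epsilon\mu_1(w+\frac1w)+\frac{\epsilon^2}{2}(w+\frac1w)^2}\,z^{x_2}}\,\frac{dz\,dw}{z(w-z)} .$$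
   Context: Notation. $[x]$ is the integer part (floor) of $x$; $\chi_{a<b}=1$ if $a<b$ and $0$ otherwise. The symbols $\varepsilon$ and $\epsilon$ denote different parameters. The kernel $K$ (depending on $t$ and $\varepsilon>0$) is $$K(x_1,m_1;x_2,m_2)=-\frac{\chi_{m_1<m_2}}{2\pi i}\oint_{\gamma_0}(1-\varepsilon w)^{[m_1/2]-[m_2/2]}(1-\varepsilon/w)^{[(m_1+1)/2]-[(m_2+1)/2]}w^{[x_1]-[x_2]}\frac{dw}{w}$$ $$+\frac1{(2\pi i)^2}\oint_{\gamma_0}dw\oint_{\gamma_{\varepsilon,\varepsilon^{-1}}}dz\,\frac{e^{t(w+\frac1w)}(1-\varepsilon w)^{[m_1/2]}(1-\varepsilon/w)^{[(m_1+1)/2]}w^{[x_1]}}{e^{t(z+\frac1z)}(1-\varepsilon z)^{[m_2/2]}(1-\varepsilon/z)^{[(m_2+1)/2]}z^{[x_2]}}\,\frac1{z(w-z)} .$$ Here $\gamma_0$ is a contour encircling $0$ but not $\varepsilon,\varepsilon^{-1}$; $\gamma_{\varepsilon,\varepsilon^{-1}}$ encircles $\varepsilon$ and $\varepsilon^{-1}$ (but not $0$); both are counter-clockwise and they do not intersect. This is the correlation kernel at time $t$ of a determinantal process of interlacing particles on the grid of points $(x,m)$, $m=1,2,\dots$, $x\in\mathbb Z+\frac{m+1}2$; in the theorem the particles on even sections $m$ are shifted to the left by $1/2$, so that positions are integers on every section. Contours in $\mathcal K^\epsilon$. $\Gamma_0$ is a contour encircling the origin with counter-clockwise orientation. $\Sigma$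 is a contour connecting $-i\infty$ to $i\infty$ that does not intersect $\Gamma_0$, stays in the right half-plane and lies to the right of $\Gamma_0$ (outside it); it is traversed from $+i\infty$ to $-i\infty$. $\Sigma^{-1}$ is the image of $\Sigma$ under $z\mapsto1/z$, with the induced orientation (a counter-clockwise loop through $0$), lying inside $\Gamma_0$.
   Formalization: The scaling is corrected to m_j = [2L²(1+μ_j/L)]; as printed, [L²(1+μ_j/L)] gives K → 0 at x_1 = x_2 = 0, μ_1 = μ_2 = 0, while the limit kernel is about 1/2 for small ϵ. Σ is taken to approach ±i∞ in direction (Re z/Im z → 0), so that the integral converges. *)

(* Defs.v *)
From Stdlib Require Import Reals ZArith List.
From Coquelicot Require Import Coquelicot.
Open Scope R_scope.
Open Scope C_scope.

Definition Cexp (z : C) : C :=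
  (exp (Re z) * cos (Im z), exp (Re z) * sin (Im z))%R.

Definition Cpowz (z : C) (n : Z) : C :=
  match n with
  | Z0 => 1
  | Zpos p => Cpow z (Pos.to_nat p)
  | Zneg p => / Cpow z (Pos.to_nat p)
  end.

Definition two_pi_i : C := 2 * PI * Ci.

(** Piecewise C^1 curves.  On each piece the curve coincides with a globally C^1
    one, so that it has one-sided derivatives at the break points. *)
Inductive piecewise_C1 (c : R -> C) : R -> R -> Prop :=
| pw_C1_piece (a b : R) (g dg : R -> C) :
    (a < b)%R ->
    (forall s : R, is_derive (V := C_R_NormedModule) g s (dg s)) ->
    (forall s : R, continuous dg s) ->
    (forall s : R, (a <= s <= b)%R -> c s = g s) ->
    piecewise_C1 c a b
| pw_C1_concat (a b d : R) :
    piecewise_C1 c a b -> piecewise_C1 c b d -> piecewise_C1 c a d.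

(** The values at the break points are irrelevant for the integrals below. *)
Definition velocity (c : R -> C) (s : R) : C :=
  (Derive (fun r => Re (c r)) s, Derive (fun r => Im (c r)) s).

(** Closed contours are parametrized by [0,1] and need not be simple;
    "encircles" is expressed by winding numbers. *)
Definition closed_contour (c : R -> C) : Prop :=
  piecewise_C1 c 0 1 /\ c 0%R = c 1%R.

Definition contour_int (c : R -> C) (f : C -> C) : C :=
  RInt (V := C_R_CompleteNormedModule) (fun s => f (c s) * velocity c s) 0 1.

Definition avoids (c : R -> C) (p : C) : Prop :=
  forall s : R, (0 <= s <= 1)%R -> c s <> p.

Definition winding (c : R -> C) (p : C) : C :=
  / two_pi_i * contour_int c (fun z => / (z - p)).

(** A contour with several components is a list of closed contours. *)
Definition cycle_int (cs : list (R -> C)) (f : C -> C) : C :=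
  fold_right Cplus 0 (map (fun c => contour_int c f) cs).

Definition cycle_avoids (cs : list (R -> C)) (p : C) : Prop :=
  forall c, In c cs -> avoids c p.

Definition cycle_winding (cs : list (R -> C)) (p : C) : C :=
  / two_pi_i * cycle_int cs (fun z => / (z - p)).

(** Counter-clockwise, once. *)
Definition encircles (cs : list (R -> C)) (p : C) : Prop :=
  cycle_avoids cs p /\ cycle_winding cs p = 1.

Definition outside (cs : list (R -> C)) (p : C) : Prop :=
  cycle_avoids cs p /\ cycle_winding cs p = 0.

(** The contours gamma_0 (= [g0]) and gamma_{eps,1/eps} (= [gs]: one loop around
    both points, or one loop around each).  The last clause says that they do not
    intersect and that gamma_{eps,1/eps} is not encircled by gamma_0; for disjoint
    Jordan curves the latter follows from the other clauses. *)
Definition kernel_contours (eps : R) (g0 : R -> C) (gs : list (R -> C)) : Prop :=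
  closed_contour g0 /\
  encircles (g0 :: nil) 0 /\
  outside (g0 :: nil) eps /\
  outside (g0 :: nil) (/ eps) /\
  (forall c, In c gs -> closed_contour c) /\
  encircles gs eps /\
  encircles gs (/ eps) /\
  outside gs 0 /\
  (forall c s, In c gs -> (0 <= s <= 1)%R -> outside (g0 :: nil) (c s)).

(** [Z.div] rounds down, so [(m / 2)%Z] is the integer part of m/2. *)
Definition kernel_weight (t eps x : R) (m : Z) (w : C) : C :=
  Cexp (t * (w + / w)) * Cpowz (1 - eps * w) (m / 2)
  * Cpowz (1 - eps / w) ((m + 1) / 2) * Cpowz w (Zfloor x).

Definition K (t eps : R) (g0 : R -> C) (gs : list (R -> C))
    (x1 : R) (m1 : Z) (x2 : R) (m2 : Z) : C :=
  - ((if Z_lt_dec m1 m2 then 1 else 0) / two_pi_i)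
    * contour_int g0 (fun w =>
        Cpowz (1 - eps * w) (m1 / 2 - m2 / 2)
        * Cpowz (1 - eps / w) ((m1 + 1) / 2 - (m2 + 1) / 2)
        * Cpowz w (Zfloor x1 - Zfloor x2) / w)
  + / (two_pi_i * two_pi_i)
    * contour_int g0 (fun w => cycle_int gs (fun z =>
        kernel_weight t eps x1 m1 w / kernel_weight t eps x2 m2 z
        * / (z * (w - z)))).

(** Improper integral along a curve parametrized by the whole line. *)
Definition line_int (c : R -> C) (f : C -> C) : C :=
  RInt_gen (V := C_R_CompleteNormedModule) (fun s => f (c s) * velocity c s)
    (Rbar_locally m_infty) (Rbar_locally p_infty).

(** "From +i infinity to -i infinity" is asymptotic in direction: the argument of
    [S s] tends to pi/2, resp. -pi/2.  Without this exp(eps^2 z^2 / 2) need not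
    decay along [S]. *)
Definition limit_contours (G0 S : R -> C) : Prop :=
  closed_contour G0 /\
  encircles (G0 :: nil) 0 /\
  (forall a b : R, (a < b)%R -> piecewise_C1 S a b) /\
  (forall s : R, (0 < Re (S s))%R) /\
  filterlim (fun s => Im (S s)) (Rbar_locally m_infty) (Rbar_locally p_infty) /\
  filterlim (fun s => (Re (S s) / Im (S s))%R) (Rbar_locally m_infty) (locally 0%R) /\
  filterlim (fun s => Im (S s)) (Rbar_locally p_infty) (Rbar_locally m_infty) /\
  filterlim (fun s => (Re (S s) / Im (S s))%R) (Rbar_locally p_infty) (locally 0%R) /\
  (forall s : R, outside (G0 :: nil) (S s)) /\
  (forall s : R, encircles (G0 :: nil) (/ S s)).

Definition limit_weight (eps mu : R) (w : C) : C :=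
  Cexp (eps * mu * (w + / w) + eps ^ 2 / 2 * (w + / w) ^ 2).

Definition limit_K (eps : R) (G0 S : R -> C) (x1 : Z) (mu1 : R) (x2 : Z) (mu2 : R)
    : C :=
  let integrand w z :=
    limit_weight eps mu2 z * Cpowz w x1 / (limit_weight eps mu1 w * Cpowz z x2)
    * / (z * (w - z)) in
  - ((if Rlt_dec mu1 mu2 then 1 else 0) / two_pi_i)
    * contour_int G0 (fun w =>
        Cexp (eps * (mu2 - mu1) * (w + / w)) * Cpowz w (x1 - x2 - 1))
  + / (two_pi_i * two_pi_i)
    * contour_int G0 (fun w =>
        line_int S (integrand w) + line_int (fun s => / S s) (integrand w)).

(** The factor 2 is forced: the factors of the kernel carry the exponents m/2 and
    (m+1)/2, so only m = 2 L^2 + 2 L mu + O(1) makes exp (t (w + 1/w)) cancel and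
    leaves exp (- eps mu (w + 1/w)) in the limit.  With m = [L^2 (1 + mu / L)], K
    tends to 0 for x1 = x2, mu1 = mu2, unlike the limit kernel. *)
Definition section_index (L mu : R) : Z := Zfloor (2 * (L ^ 2 * (1 + mu / L)))%R.

(* Main.v *)
Require Import Defs.
From Stdlib Require Import Reals ZArith List Lra Lia.
From Coquelicot Require Import Coquelicot.
Open Scope R_scope.

(** In both kernels the double integral has the form: W(w) F(z) / (w - z) integrated over w and z,
where W is one of the weights and F is the inverse of another one.  With u = eps w / L, the weight
is a product of a factor in w and a factor in 1/w, each of the form e^(L^2 u) (1 - u)^n with
n = L^2 + mu L + O(1), since halving the section index 2 L^2 + 2 mu L + O(1) gives such exponents.
Because (1 - u) e^(u + u^2/2) = 1 + O(u^3), its n-th power is 1 + O(1/L), and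
e^(- eps mu w - eps^2 w^2 / 2) remains in the limit ([one_minus_exp_order3], [factor_asym]).  So the
integrands converge uniformly on compact subsets of the punctured plane.

The contours must be made independent of L first, although one pole of F, at e = eps/L, tends to 0 and
the other one, 1/e, tends to infinity.  The substitution of (1/w, 1/z) for (w, z) exchanges the poles
and the two exponents of each weight.  Hence the part of the z-contour about e can be treated like the
part about 1/e: both become integrals over w in the unit square and z in a square of the right
half-plane whose left side lies on a fixed line Re z = sg ([K_reduced]).  On the way the w-contour crosses
the loop about e; the residue completes the single integral to one over the unit square if
m1 < m2, and vanishes otherwise, as then the quotient of the weights has no pole at e.  As the
square grows, its left side alone survives; cutting the line at height T costs O(1/T) uniformly in L,
because (1 - e z)^n dominates every power of z there ([inv_wt_tail], [double_int_square_line]).  On the cut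
line uniform convergence applies ([double_int_line_conv]).

For the limit kernel, e^(eps^2 z^2 / 2) is a Gaussian along the directions in which S goes to infinity, so S
and 1/S can be exchanged, up to O(1/T), for the cut line and its inverse, and the latter is again turned into
the former by inversion ([limit_reduced]).  The theorem follows by choosing T first and then L.

Contours are merely piecewise C^1, and to lie inside or outside is a matter of winding numbers.  Cauchy's theorem
is needed for chains having equal winding numbers about a finite set A of points, and for functions that are, away
from A, uniform limits of rational functions with poles in A ([cauchy_eq], [cauchy_diff]).  For rational
functions it follows from partial fractions, as all terms but the simple poles have primitives; and the
weights and their inverses are such limits since e^v is the limit of (1 + v/n)^n.  Exchanging two integrals
([swap]) and the constancy of winding numbers off a chain ([flat_index]) rest on one remark: a function whose increments
are quadratically small is constant ([flat_const]). *)

(** * Calculus of complex functions of a real variable *)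

Lemma Rmax_le a b c : Rmax a b <= c -> a <= c /\ b <= c.
Proof. intros H. split; (eapply Rle_trans; [|exact H]); [apply Rmax_l | apply Rmax_r]. Qed.

(** Complex-valued functions of a real variable are handled through their real and imaginary parts, for
which the real theory of derivatives and integrals is available. *)
Definition ccont (g : R -> C) (s : R) : Prop :=
  continuous (fun r => Re (g r)) s /\ continuous (fun r => Im (g r)) s.

Definition cder (g : R -> C) (s : R) (d : C) : Prop :=
  is_derive (fun r => Re (g r)) s (Re d) /\ is_derive (fun r => Im (g r)) s (Im d).

Definition cis_int (f : R -> C) (a b : R) (l : C) : Prop :=
  is_RInt (fun r => Re (f r)) a b (Re l) /\ is_RInt (fun r => Im (f r)) a b (Im l).

Definition cint (f : R -> C) (a b : R) : C :=
  (RInt (fun r => Re (f r)) a b, RInt (fun r => Im (f r)) a b).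

Lemma C_ext (z w : C) : Re z = Re w -> Im z = Im w -> z = w.
Proof. destruct z, w; simpl; congruence. Qed.

Lemma re_minus (a b : C) : Re (a - b)%C = Re a - Re b.
Proof. unfold Cminus. rewrite re_plus, re_opp. ring. Qed.
Lemma im_minus (a b : C) : Im (a - b)%C = Im a - Im b.
Proof. unfold Cminus. rewrite im_plus, im_opp. ring. Qed.

Lemma im_le_Cmod (c : C) : Rabs (Im c) <= Cmod c.
Proof. generalize (Rmax_Cmod c). unfold Im. intro H.
  eapply Rle_trans; [| exact H]. apply Rmax_r. Qed.

Lemma Cmod_le_sum (c : C) : Cmod c <= Rabs (Re c) + Rabs (Im c).
Proof.
  destruct c as [x y]. unfold Re, Im, Cmod; simpl fst; simpl snd.
  apply Rsqr_incr_0_var.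
  - rewrite Rsqr_sqrt by nra. unfold Rsqr.
    generalize (Rabs_pos x) (Rabs_pos y) (pow2_abs x) (pow2_abs y). intros. nra.
  - generalize (Rabs_pos x) (Rabs_pos y). lra.
Qed.

Lemma Cmod_minus_sym (a b : C) : Cmod (a - b) = Cmod (b - a).
Proof. rewrite <- Cmod_opp. f_equal. ring. Qed.

Lemma Cmod_triangle_minus (a b : C) : Cmod (a - b) <= Cmod a + Cmod b.
Proof. unfold Cminus. eapply Rle_trans. apply Cmod_triangle. rewrite Cmod_opp. lra. Qed.

Lemma Cmod_triangle_rev (a b : C) : Cmod a - Cmod b <= Cmod (a - b).
Proof.
  assert (Cmod a <= Cmod (a - b) + Cmod b).
  { replace a with ((a - b) + b)%C at 1 by ring. apply Cmod_triangle. }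
  lra.
Qed.

Lemma Cmod_dist_triangle (a b c : C) : Cmod (a - c) <= Cmod (a - b) + Cmod (b - c).
Proof. replace (a - c)%C with ((a - b) + (b - c))%C by ring. apply Cmod_triangle. Qed.

Lemma Cmod_neq_gt (z w : C) : z <> w -> 0 < Cmod (z - w).
Proof. intros H. apply Cmod_gt_0. intro E. apply H. apply Ceq_minus. exact E. Qed.

Lemma continuous_R_ed (f : R -> R) (s : R) :
  continuous f s <->
  forall e, 0 < e -> exists d, 0 < d /\ forall r, Rabs (r - s) < d -> Rabs (f r - f s) < e.
Proof.
  split.
  - intros H e He.
    assert (H1 := proj1 (filterlim_locally f (f s)) H (mkposreal e He)).
    destruct H1 as [d Hd]. exists d. split. apply cond_pos.
    intros r Hr. apply (Hd r). exact Hr.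
  - intros H. apply (proj2 (filterlim_locally f (f s))). intros e.
    destruct (H e (cond_pos e)) as [d [Hd H1]].
    exists (mkposreal d Hd). intros r Hr. apply H1. exact Hr.
Qed.

Lemma ccont_ed (g : R -> C) (s : R) :
  ccont g s <->
  forall e, 0 < e -> exists d, 0 < d /\ forall r, Rabs (r - s) < d -> Cmod (g r - g s) < e.
Proof.
  split.
  - intros [H1 H2] e He.
    destruct (proj1 (continuous_R_ed _ _) H1 (e/2)) as [d1 [Hd1 K1]]; [lra|].
    destruct (proj1 (continuous_R_ed _ _) H2 (e/2)) as [d2 [Hd2 K2]]; [lra|].
    exists (Rmin d1 d2). split. apply Rmin_glb_lt; lra.
    intros r Hr.
    assert (Rabs (r - s) < d1) by (eapply Rlt_le_trans; [exact Hr| apply Rmin_l]).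
    assert (Rabs (r - s) < d2) by (eapply Rlt_le_trans; [exact Hr| apply Rmin_r]).
    eapply Rle_lt_trans. apply Cmod_le_sum. rewrite re_minus, im_minus.
    specialize (K1 r H). specialize (K2 r H0). lra.
  - intros H. split; apply continuous_R_ed; intros e He; destruct (H e He) as [d [Hd K]];
    exists d; split; trivial; intros r Hr; specialize (K r Hr).
    + rewrite <- re_minus. eapply Rle_lt_trans. apply re_le_Cmod. exact K.
    + rewrite <- im_minus. eapply Rle_lt_trans. apply im_le_Cmod. exact K.
Qed.

Lemma ccont_of_continuous (g : R -> C) (s : R) : continuous g s -> ccont g s.
Proof.
  intros H. split.
  - apply (continuous_comp g (fun z : C => Re z)). exact H. destruct (g s). apply continuous_fst.
  - apply (continuous_comp g (fun z : C => Im z)). exact H. destruct (g s). apply continuous_snd.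
Qed.

Lemma norm_C_R (x : C) : norm (x : C_R_NormedModule) = Cmod x.
Proof.
  change (sqrt (Rabs (fst x) ^ 2 + Rabs (snd x) ^ 2) = sqrt (fst x ^ 2 + snd x ^ 2)).
  rewrite !pow2_abs. reflexivity.
Qed.

Lemma cder_of_is_derive (g : R -> C) (s : R) (d : C) :
  is_derive (V := C_R_NormedModule) g s d -> cder g s d.
Proof.
  intros H. split.
  - eapply filterdiff_ext_lin.
    apply (filterdiff_comp' g (fun z : C_R_NormedModule => Re z) s _ (fun z : C_R_NormedModule => Re z) H).
    apply filterdiff_linear. split.
    + intros x y. reflexivity.
    + intros k x. reflexivity.
    + exists (sqrt 2). split. apply sqrt_lt_R0. lra.
      intros x. eapply Rle_trans. apply (re_le_Cmod x).
      rewrite norm_C_R. generalize (Cmod_ge_0 x); intros.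
      assert (1 <= sqrt 2) by (rewrite <- sqrt_1 at 1; apply sqrt_le_1; lra). nra.
    + intros y. simpl. reflexivity.
  - eapply filterdiff_ext_lin.
    apply (filterdiff_comp' g (fun z : C_R_NormedModule => Im z) s _ (fun z : C_R_NormedModule => Im z) H).
    apply filterdiff_linear. split.
    + intros x y. reflexivity.
    + intros k x. reflexivity.
    + exists (sqrt 2). split. apply sqrt_lt_R0. lra.
      intros x. eapply Rle_trans. apply (im_le_Cmod x).
      rewrite norm_C_R. generalize (Cmod_ge_0 x); intros.
      assert (1 <= sqrt 2) by (rewrite <- sqrt_1 at 1; apply sqrt_le_1; lra). nra.
    + intros y. simpl. reflexivity.
Qed.

Lemma cis_int_is_RInt (f : R -> C) a b l :
  cis_int f a b l <-> is_RInt (V := C_R_NormedModule) f a b l.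
Proof.
  split.
  - intros [H1 H2]. destruct l as [u v].
    apply (is_RInt_fct_extend_pair (U := R_NormedModule) (V := R_NormedModule)); assumption.
  - intros H. split.
    + apply (is_RInt_fct_extend_fst (U := R_NormedModule) (V := R_NormedModule)) in H. exact H.
    + apply (is_RInt_fct_extend_snd (U := R_NormedModule) (V := R_NormedModule)) in H. exact H.
Qed.

Lemma cis_int_RInt (f : R -> C) a b l :
  cis_int f a b l -> RInt (V := C_R_CompleteNormedModule) f a b = l.
Proof.
  intros H. apply is_RInt_unique. apply cis_int_is_RInt. exact H.
Qed.

Lemma cis_int_cint (f : R -> C) a b l : cis_int f a b l -> cint f a b = l.
Proof.
  intros [H1 H2]. unfold cint. apply C_ext; simpl; apply is_RInt_unique; assumption.
Qed.

Lemma cis_int_ext (f g : R -> C) a b l : a <= b ->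
  (forall s, a < s < b -> f s = g s) -> cis_int f a b l -> cis_int g a b l.
Proof.
  intros Hab H [H1 H2].
  split; [eapply is_RInt_ext; [|exact H1] | eapply is_RInt_ext; [|exact H2]];
  rewrite Rmin_left, Rmax_right by lra; intros x Hx; simpl; rewrite (H x Hx); reflexivity.
Qed.

Lemma cis_int_plus f g a b l m :
  cis_int f a b l -> cis_int g a b m -> cis_int (fun s => f s + g s)%C a b (l + m)%C.
Proof.
  intros [H1 H2] [H3 H4]. split.
  - eapply is_RInt_ext. 2:{ exact (is_RInt_plus _ _ _ _ _ _ H1 H3). }
    intros. reflexivity.
  - eapply is_RInt_ext. 2:{ exact (is_RInt_plus _ _ _ _ _ _ H2 H4). }
    intros. reflexivity.
Qed.

Lemma cis_int_scal k f a b l :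
  cis_int f a b l -> cis_int (fun s => k * f s)%C a b (k * l)%C.
Proof.
  intros [H1 H2]. split.
  - eapply is_RInt_ext.
    2:{ exact (is_RInt_minus _ _ _ _ _ _ (is_RInt_scal _ _ _ (Re k) _ H1) (is_RInt_scal _ _ _ (Im k) _ H2)). }
    intros. reflexivity.
  - eapply is_RInt_ext.
    2:{ exact (is_RInt_plus _ _ _ _ _ _ (is_RInt_scal _ _ _ (Re k) _ H2) (is_RInt_scal _ _ _ (Im k) _ H1)). }
    intros. reflexivity.
Qed.

Lemma cis_int_bound f a b l M :
  a <= b -> (forall s, a <= s <= b -> Cmod (f s) <= M) -> cis_int f a b l ->
  Cmod l <= M * (b - a).
Proof.
  intros Hab HM H. apply cis_int_is_RInt in H.
  rewrite <- norm_C_R.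
  replace (M * (b - a)) with (scal (b - a) M) by (unfold scal; simpl; unfold mult; simpl; ring).
  eapply (norm_RInt_le (V := C_R_NormedModule) f (fun _ => M)); [exact Hab | | exact H | apply (is_RInt_const (V := R_NormedModule))].
  intros x Hx. rewrite norm_C_R. apply HM. exact Hx.
Qed.

Lemma cis_int_bound_fun (f : R -> C) (g : R -> R) a b l M :
  a <= b -> (forall s, a <= s <= b -> Cmod (f s) <= g s) -> cis_int f a b l ->
  is_RInt g a b M -> Cmod l <= M.
Proof.
  intros Hab HM H HG. apply cis_int_is_RInt in H.
  rewrite <- norm_C_R.
  eapply (norm_RInt_le (V := C_R_NormedModule) f g); [exact Hab | | exact H | exact HG].
  intros x Hx. rewrite norm_C_R. apply HM. exact Hx.
Qed.

Lemma cis_int_Chasles f a b d l m :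
  cis_int f a b l -> cis_int f b d m -> cis_int f a d (l + m)%C.
Proof.
  intros [H1 H2] [H3 H4]. split; [rewrite re_plus | rewrite im_plus]; eapply (is_RInt_Chasles (V := R_NormedModule)); eassumption.
Qed.

Lemma cis_int_exists f a b : a <= b -> (forall s, a <= s <= b -> ccont f s) ->
  cis_int f a b (cint f a b).
Proof.
  intros Hab H. split; simpl; apply (RInt_correct (V := R_CompleteNormedModule));
  apply (ex_RInt_continuous (V := R_CompleteNormedModule));
  rewrite Rmin_left, Rmax_right by lra; intros z Hz; apply (H z Hz).
Qed.

Lemma cis_int_FTC (F f : R -> C) a b : a <= b ->
  (forall s, a <= s <= b -> cder F s (f s)) -> (forall s, a <= s <= b -> ccont f s) ->
  cis_int f a b (F b - F a)%C.
Proof.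
  intros Hab HD HC. split.
  - rewrite re_minus. apply (is_RInt_derive (V := R_CompleteNormedModule) (fun r => Re (F r)) (fun r => Re (f r)));
    rewrite Rmin_left, Rmax_right by lra; intros x Hx; [apply (HD x Hx) | apply (HC x Hx)].
  - rewrite im_minus. apply (is_RInt_derive (V := R_CompleteNormedModule) (fun r => Im (F r)) (fun r => Im (f r)));
    rewrite Rmin_left, Rmax_right by lra; intros x Hx; [apply (HD x Hx) | apply (HC x Hx)].
Qed.

Lemma cder_ccont g s d : cder g s d -> ccont g s.
Proof.
  intros [H1 H2]. split; apply (ex_derive_continuous (V := R_NormedModule)); eexists; eassumption.
Qed.

Lemma ccont_const (k : C) s : ccont (fun _ => k) s.
Proof. split; apply continuous_const. Qed.

Lemma continuous_Rmult (f g : R -> R) s : continuous f s -> continuous g s -> continuous (fun r => f r * g r) s.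
Proof. intros. apply (continuous_mult (K := R_AbsRing) f g s); assumption. Qed.

Lemma ccont_mult f g s : ccont f s -> ccont g s -> ccont (fun r => f r * g r)%C s.
Proof.
  intros [H1 H2] [H3 H4]. split.
  - apply (continuous_minus (V := R_NormedModule) (fun r => Re (f r) * Re (g r)) (fun r => Im (f r) * Im (g r)));
    apply continuous_Rmult; assumption.
  - apply (continuous_plus (V := R_NormedModule) (fun r => Re (f r) * Im (g r)) (fun r => Im (f r) * Re (g r)));
    apply continuous_Rmult; assumption.
Qed.

Lemma ccont_opp f s : ccont f s -> ccont (fun r => - f r)%C s.
Proof.
  intros [H1 H2]. split.
  - apply (continuous_opp (V := R_NormedModule) _ _ H1).
  - apply (continuous_opp (V := R_NormedModule) _ _ H2).
Qed.

Lemma nz_square (z : C) : z <> 0%C -> Re z ^ 2 + Im z ^ 2 <> 0.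
Proof.
  intros H E. apply H. destruct z as [x y]. simpl in E.
  assert (x = 0) by nra. assert (y = 0) by nra. subst. reflexivity.
Qed.

Lemma ccont_inv f s : ccont f s -> f s <> 0%C -> ccont (fun r => / f r)%C s.
Proof.
  intros [H1 H2] Hn. apply nz_square in Hn.
  assert (Hd : continuous (fun r => / (Re (f r) ^ 2 + Im (f r) ^ 2)) s).
  { apply (continuous_comp (fun r => Re (f r) ^ 2 + Im (f r) ^ 2) Rinv).
    - apply (continuous_plus (V := R_NormedModule)).
      + apply (continuous_ext (fun r => Re (f r) * Re (f r))). intros; simpl; ring. apply continuous_Rmult; assumption.
      + apply (continuous_ext (fun r => Im (f r) * Im (f r))). intros; simpl; ring. apply continuous_Rmult; assumption.
    - apply continuous_Rinv. exact Hn. }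
  split.
  - apply (continuous_Rmult (fun r => Re (f r)) (fun r => / (Re (f r) ^ 2 + Im (f r) ^ 2))); assumption.
  - apply (continuous_Rmult (fun r => - Im (f r)) (fun r => / (Re (f r) ^ 2 + Im (f r) ^ 2))); [|assumption].
    apply (continuous_opp (V := R_NormedModule) _ _ H2).
Qed.

Lemma cder_const (k : C) s : cder (fun _ => k) s 0.
Proof. split; apply (is_derive_const (V := R_NormedModule)). Qed.

Lemma cder_plus f g s a b : cder f s a -> cder g s b -> cder (fun r => f r + g r)%C s (a + b)%C.
Proof.
  intros [H1 H2] [H3 H4]. split.
  - apply (is_derive_plus (V := R_NormedModule) _ _ _ _ _ H1 H3).
  - apply (is_derive_plus (V := R_NormedModule) _ _ _ _ _ H2 H4).
Qed.

Lemma cder_eq g s a b : cder g s a -> a = b -> cder g s b.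
Proof. intros H <-. exact H. Qed.

Lemma is_derive_eq (f : R -> R) s a b : is_derive f s a -> a = b -> is_derive f s b.
Proof. intros H <-. exact H. Qed.

Lemma is_derive_prod (u v : R -> R) s a b :
  is_derive u s a -> is_derive v s b -> is_derive (fun r => u r * v r) s (a * v s + u s * b).
Proof.
  intros H1 H2. apply is_derive_Reals in H1. apply is_derive_Reals in H2.
  apply is_derive_Reals. exact (derivable_pt_lim_mult u v s a b H1 H2).
Qed.

Lemma cder_mult f g s a b : cder f s a -> cder g s b ->
  cder (fun r => f r * g r)%C s (a * g s + f s * b)%C.
Proof.
  intros [H1 H2] [H3 H4]. split.
  - eapply is_derive_eq.
    exact (is_derive_minus _ _ _ _ _ (is_derive_prod _ _ _ _ _ H1 H3) (is_derive_prod _ _ _ _ _ H2 H4)).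
    rewrite re_plus, !re_mult.
    change (Re a * Re (g s) + Re (f s) * Re b - (Im a * Im (g s) + Im (f s) * Im b) =
     Re a * Re (g s) - Im a * Im (g s) + (Re (f s) * Re b - Im (f s) * Im b)). ring.
  - eapply is_derive_eq.
    exact (is_derive_plus _ _ _ _ _ (is_derive_prod _ _ _ _ _ H1 H4) (is_derive_prod _ _ _ _ _ H2 H3)).
    rewrite im_plus, !im_mult.
    change (Re a * Im (g s) + Re (f s) * Im b + (Im a * Re (g s) + Im (f s) * Re b) =
      Re a * Im (g s) + Im a * Re (g s) + (Re (f s) * Im b + Im (f s) * Re b)). ring.
Qed.

Lemma is_derive_quot_square (u v w : R -> R) s a b c : u s ^ 2 + v s ^ 2 <> 0 ->
  is_derive u s a -> is_derive v s b -> is_derive w s c ->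
  is_derive (fun r => w r / (u r ^ 2 + v r ^ 2)) s
    ((c * (u s ^ 2 + v s ^ 2) - w s * (2 * u s * a + 2 * v s * b)) / (u s ^ 2 + v s ^ 2) ^ 2).
Proof.
  intros Hn H1 H2 H3. pose proof (is_derive_plus _ _ _ _ _ (is_derive_prod _ _ _ _ _ H1 H1) (is_derive_prod _ _ _ _ _ H2 H2)) as H4.
  apply (is_derive_ext _ (fun r => u r ^ 2 + v r ^ 2)) in H4.
  2:{ intros t. change (u t * u t + v t * v t = u t ^ 2 + v t ^ 2). ring. }
  apply is_derive_Reals in H3. apply is_derive_Reals in H4.
  apply is_derive_Reals.
  replace ((c * (u s ^ 2 + v s ^ 2) - w s * (2 * u s * a + 2 * v s * b)) / (u s ^ 2 + v s ^ 2) ^ 2) with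
    ((c * (u s ^ 2 + v s ^ 2) - plus (a * u s + u s * a) (b * v s + v s * b) * w s) / Rsqr (u s ^ 2 + v s ^ 2)).
  exact (derivable_pt_lim_div w _ s _ _ H3 H4 Hn).
  change (plus (a * u s + u s * a) (b * v s + v s * b)) with ((a * u s + u s * a) + (b * v s + v s * b)). unfold Rsqr. field. repeat split; intro E; apply Hn; nra.
Qed.

Lemma cder_inv f s a : cder f s a -> f s <> 0%C ->
  cder (fun r => / f r)%C s (- a / (f s * f s))%C.
Proof.
  intros [H1 H2] Hn. apply nz_square in Hn.
  split.
  - eapply is_derive_eq. exact (is_derive_quot_square _ _ _ _ _ _ _ Hn H1 H2 H1).
    clear H1 H2. destruct a as [a1 a2], (f s) as [x y]. simpl in *. field.
    repeat split; intro E; apply Hn; nra.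
  - eapply is_derive_eq. exact (is_derive_quot_square _ _ _ _ _ _ _ Hn H1 H2 (is_derive_opp _ _ _ H2)).
    change (opp (Im a)) with (- Im a).
    clear H1 H2. destruct a as [a1 a2], (f s) as [x y]. simpl in *. change (opp y) with (- y). field.
    repeat split; intro E; apply Hn; nra.
Qed.

Lemma cder_pow f s a n : cder f s a ->
  cder (fun r => f r ^ S n)%C s (INR (S n) * f s ^ n * a)%C.
Proof.
  intros H. induction n.
  - eapply cder_eq. apply cder_mult. exact H. apply cder_const. simpl. ring.
  - eapply cder_eq. apply cder_mult. exact H. apply IHn.
    rewrite (S_INR (S n)), RtoC_plus, !Cpow_S. generalize (RtoC (INR (S n))); intro k. change (a * (f s * f s ^ n) + f s * (k * f s ^ n * a) = (k + 1) * (f s * f s ^ n) * a)%C. ring.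
Qed.

Lemma cder_exp f s a : cder f s a -> cder (fun r => Cexp (f r)) s (Cexp (f s) * a)%C.
Proof.
  intros [H1 H2].
  assert (E : is_derive (fun r => exp (Re (f r))) s (Re a * exp (Re (f s))))
    by exact (is_derive_comp exp _ _ _ _ (is_derive_exp _) H1).
  split.
  - eapply is_derive_eq.
    exact (is_derive_prod _ _ _ _ _ E (is_derive_comp cos _ _ _ _ (is_derive_cos _) H2)).
    change (Re a * exp (Re (f s)) * cos (Im (f s)) + exp (Re (f s)) * (Im a * - sin (Im (f s))) =
      exp (Re (f s)) * cos (Im (f s)) * Re a - exp (Re (f s)) * sin (Im (f s)) * Im a). ring.
  - eapply is_derive_eq.
    exact (is_derive_prod _ _ _ _ _ E (is_derive_comp sin _ _ _ _ (is_derive_sin _) H2)).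
    change (Re a * exp (Re (f s)) * sin (Im (f s)) + exp (Re (f s)) * (Im a * cos (Im (f s))) =
      exp (Re (f s)) * cos (Im (f s)) * Im a + exp (Re (f s)) * sin (Im (f s)) * Re a). ring.
Qed.

Lemma cder_velocity g s d : cder g s d -> velocity g s = d.
Proof.
  intros [H1 H2]. unfold velocity. apply C_ext; simpl; apply is_derive_unique; assumption.
Qed.

Lemma cder_ext_loc f g s d : (exists e, 0 < e /\ forall r, Rabs (r - s) < e -> f r = g r) ->
  cder f s d -> cder g s d.
Proof.
  intros [e [He H]] [H1 H2]. split; (eapply is_derive_ext_loc; [|eassumption]);
  exists (mkposreal e He); intros y Hy; simpl; rewrite (H y Hy); reflexivity.
Qed.

(** A differentiable curve is Lipschitz at each point, which turns a quadratic modulus in the plane into a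
quadratic modulus in the parameter. *)
Lemma cder_lip g s d : cder g s d ->
  exists e, 0 < e /\ forall r, Rabs (r - s) < e -> Cmod (g r - g s) <= (Cmod d + 1) * 2 * Rabs (r - s).
Proof.
  assert (Real : forall f s d, is_derive (f : R -> R) s d -> exists e, 0 < e /\ forall r, Rabs (r - s) < e -> Rabs (f r - f s) <= (Rabs d + 1) * Rabs (r - s)).
  { clear. intros f s d H. apply is_derive_Reals in H. destruct (H 1) as [e He]; [lra|].
    exists e. split. apply cond_pos. intros r Hr.
    destruct (Req_dec r s) as [->|Hn].
    { replace (f s - f s) with 0 by ring. rewrite !Rabs_R0. replace (s - s) with 0 by ring. rewrite Rabs_R0. lra. }
    specialize (He (r - s) ltac:(lra) Hr). replace (s + (r - s)) with r in He by ring.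
    replace (f r - f s) with (((f r - f s) / (r - s)) * (r - s)) by (field; lra).
    rewrite Rabs_mult. apply Rmult_le_compat_r. apply Rabs_pos.
    replace ((f r - f s) / (r - s)) with (d + ((f r - f s) / (r - s) - d)) by ring.
    eapply Rle_trans. apply Rabs_triang. lra. }
  intros [H1 H2].
  destruct (Real _ _ _ H1) as [e1 [He1 K1]]. destruct (Real _ _ _ H2) as [e2 [He2 K2]].
  exists (Rmin e1 e2). split. apply Rmin_glb_lt; lra. intros r Hr.
  eapply Rle_trans. apply Cmod_le_sum. rewrite re_minus, im_minus.
  specialize (K1 r (Rlt_le_trans _ _ _ Hr (Rmin_l _ _))).
  specialize (K2 r (Rlt_le_trans _ _ _ Hr (Rmin_r _ _))).
  generalize (re_le_Cmod d) (im_le_Cmod d) (Rabs_pos (r - s)). intros. nra.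
Qed.

(** * Chains of smooth pieces *)

(** A curve [pg] with its derivative [pd], to be used between the parameters [pa] and [pb] only. *)
Record piece := mkpiece { pg : R -> C; pd : R -> C; pa : R; pb : R }.

Definition good_piece (p : piece) : Prop :=
  pa p < pb p /\ forall s, pa p <= s <= pb p -> cder (pg p) s (pd p s) /\ ccont (pd p) s.

Definition chain := list piece.
Definition good (l : chain) : Prop := forall p, In p l -> good_piece p.

Definition psupp (p : piece) (z : C) : Prop := exists s, pa p <= s <= pb p /\ z = pg p s.
Definition supp (l : chain) (z : C) : Prop := exists p, In p l /\ psupp p z.

Definition pint (p : piece) (f : C -> C) : C := cint (fun s => f (pg p s) * pd p s)%C (pa p) (pb p).
Definition chint (l : chain) (f : C -> C) : C :=
  fold_right (fun p acc => pint p f + acc)%C 0%C l.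

(** The boundary of the chain, paired with a function G on points. *)
Definition boundary (l : chain) (G : C -> C) : C :=
  fold_right (fun p acc => G (pg p (pb p)) - G (pg p (pa p)) + acc)%C 0%C l.
Definition closed_chain (l : chain) : Prop := forall G, boundary l G = 0%C.

(** Continuity relative to the set X: an integrand need only be continuous along the contour, without
any condition off it. *)
Definition cont_on (X : C -> Prop) (f : C -> C) : Prop :=
  forall z, X z -> forall e, 0 < e -> exists d, 0 < d /\
    forall z', X z' -> Cmod (z' - z) < d -> Cmod (f z' - f z) < e.

Lemma cont_on_sub (X Y : C -> Prop) f : (forall z, Y z -> X z) -> cont_on X f -> cont_on Y f.
Proof.
  intros H Hf z Hz e He. destruct (Hf z (H z Hz) e He) as [d [Hd K]].
  exists d. split; trivial. intros. apply K; auto.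
Qed.

Lemma cont_on_ext (X : C -> Prop) f g : (forall z, X z -> f z = g z) -> cont_on X f -> cont_on X g.
Proof.
  intros H Hf z Hz e He. destruct (Hf z Hz e He) as [d [Hd K]].
  exists d. split; trivial. intros z' Hz' Hd'. rewrite <- !H by assumption. apply K; auto.
Qed.

(** Continuity on the image of a curve gives continuity along the curve; stopping the
parameter outside [a,b] makes it two-sided at the end points. *)
Definition clamp (a b s : R) : R := Rmax a (Rmin b s).

Lemma clamp_in a b s : a <= b -> a <= clamp a b s <= b.
Proof.
  intros H. unfold clamp. split. apply Rmax_l. apply Rmax_lub; [lra | apply Rmin_l].
Qed.

Lemma clamp_id a b s : a <= s <= b -> clamp a b s = s.
Proof. intros H. unfold clamp. rewrite Rmin_right, Rmax_right; lra. Qed.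

Lemma clamp_lip a b s r : Rabs (clamp a b s - clamp a b r) <= Rabs (s - r).
Proof.
  unfold clamp, Rmax, Rmin.
  destruct (Rle_dec b s), (Rle_dec b r); repeat destruct Rle_dec; unfold Rabs; repeat destruct Rcase_abs; lra.
Qed.

Lemma ccont_clamp (g : R -> C) a b s : a <= b ->
  (forall r, a <= r <= b -> ccont g r) -> ccont (fun r => g (clamp a b r)) s.
Proof.
  intros Hab H. apply ccont_ed. intros e He.
  destruct (proj1 (ccont_ed _ _) (H _ (clamp_in a b s Hab)) e He) as [d [Hd K]].
  exists d. split; trivial. intros r Hr. apply K.
  eapply Rle_lt_trans. apply clamp_lip. exact Hr.
Qed.

Lemma ccont_comp_on (X : C -> Prop) (f : C -> C) (g : R -> C) s :
  cont_on X f -> (forall r, X (g r)) -> ccont g s -> ccont (fun r => f (g r)) s.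
Proof.
  intros Hf HX Hg. apply ccont_ed. intros e He.
  destruct (Hf (g s) (HX s) e He) as [d [Hd K]].
  destruct (proj1 (ccont_ed _ _) Hg d Hd) as [d' [Hd' K']].
  exists d'. split; trivial. intros r Hr. apply K; auto.
Qed.

Lemma good_piece_ccont p s : good_piece p -> pa p <= s <= pb p -> ccont (pg p) s.
Proof. intros [_ H] Hs. eapply cder_ccont. apply (H s Hs). Qed.

Lemma piece_int_sub p f a b : good_piece p -> cont_on (psupp p) f ->
  pa p <= a -> a <= b -> b <= pb p ->
  cis_int (fun s => f (pg p s) * pd p s)%C a b (cint (fun s => f (pg p s) * pd p s)%C a b).
Proof.
  intros Hp Hf H1 H2 H3.
  assert (Hlt : pa p < pb p) by apply Hp.
  set (h := fun s => (f (pg p (clamp (pa p) (pb p) s)) * pd p (clamp (pa p) (pb p) s))%C).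
  assert (Hh : cis_int h a b (cint h a b)).
  { apply cis_int_exists; trivial. intros s _. unfold h. apply ccont_mult.
    - apply (ccont_comp_on (psupp p) f (fun r => pg p (clamp (pa p) (pb p) r))); trivial.
      + intros r. exists (clamp (pa p) (pb p) r). split; trivial. apply clamp_in. lra.
      + apply ccont_clamp. lra. intros r Hr. apply good_piece_ccont; assumption.
    - apply ccont_clamp. lra. intros r Hr. apply (proj2 Hp r Hr). }
  assert (E : cis_int (fun s => f (pg p s) * pd p s)%C a b (cint h a b)).
  { eapply cis_int_ext; [exact H2 | | exact Hh].
    intros s Hs. unfold h. rewrite clamp_id by lra. reflexivity. }
  rewrite (cis_int_cint _ _ _ _ E). exact E.
Qed.

Lemma pint_correct p f : good_piece p -> cont_on (psupp p) f ->
  cis_int (fun s => f (pg p s) * pd p s)%C (pa p) (pb p) (pint p f).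
Proof.
  intros Hp Hf. unfold pint. assert (Hlt : pa p < pb p) by apply Hp.
  apply piece_int_sub; trivial; lra.
Qed.

Lemma pint_ext p f g : pa p <= pb p -> (forall z, psupp p z -> f z = g z) -> pint p f = pint p g.
Proof.
  intros Hp H. unfold pint, cint. f_equal; apply RInt_ext; rewrite Rmin_left, Rmax_right by lra;
  intros x Hx; rewrite H; trivial; exists x; split; trivial; lra.
Qed.

Lemma chint_ext l f g : good l -> (forall z, supp l z -> f z = g z) -> chint l f = chint l g.
Proof.
  induction l as [|p l IH]; simpl; intros Hl H; trivial.
  rewrite (pint_ext p f g), IH; trivial.
  - intros q Hq. apply Hl. right; trivial.
  - intros z [q [Hq Hz]]. apply H. exists q. split; [right|]; trivial.
  - assert (good_piece p) as [? _] by (apply Hl; left; trivial). lra.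
  - intros z Hz. apply H. exists p. split; [left|]; trivial.
Qed.

Lemma cont_on_cons_hd p l f : cont_on (supp (p :: l)) f -> cont_on (psupp p) f.
Proof. apply cont_on_sub. intros z Hz. exists p. split; [left|]; trivial. Qed.

Lemma cont_on_cons_tl p l f : cont_on (supp (p :: l)) f -> cont_on (supp l) f.
Proof. apply cont_on_sub. intros z [q [Hq Hz]]. exists q. split; [right|]; trivial. Qed.

Lemma good_hd p l : good (p :: l) -> good_piece p.
Proof. intros H. apply H. left; trivial. Qed.
Lemma good_tl p l : good (p :: l) -> good l.
Proof. intros H q Hq. apply H. right; trivial. Qed.

Lemma chint_plus l f g : good l -> cont_on (supp l) f -> cont_on (supp l) g ->
  chint l (fun z => f z + g z)%C = (chint l f + chint l g)%C.
Proof.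
  induction l as [|p l IH]; simpl; intros Hl Hf Hg. ring.
  rewrite IH; eauto using good_tl, cont_on_cons_tl.
  assert (E : pint p (fun z => f z + g z)%C = (pint p f + pint p g)%C).
  { apply cis_int_cint. eapply cis_int_ext.
    3: apply (cis_int_plus _ _ _ _ _ _ (pint_correct p f (good_hd _ _ Hl) (cont_on_cons_hd _ _ _ Hf)) (pint_correct p g (good_hd _ _ Hl) (cont_on_cons_hd _ _ _ Hg))).
    - destruct (good_hd _ _ Hl); lra.
    - intros; simpl. ring. }
  rewrite E. ring.
Qed.

Lemma chint_scal l k f : good l -> cont_on (supp l) f ->
  chint l (fun z => k * f z)%C = (k * chint l f)%C.
Proof.
  induction l as [|p l IH]; simpl; intros Hl Hf. ring.
  rewrite IH; eauto using good_tl, cont_on_cons_tl.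
  assert (E : pint p (fun z => k * f z)%C = (k * pint p f)%C).
  { apply cis_int_cint. eapply cis_int_ext.
    3: apply (cis_int_scal k _ _ _ _ (pint_correct p f (good_hd _ _ Hl) (cont_on_cons_hd _ _ _ Hf))).
    - destruct (good_hd _ _ Hl); lra.
    - intros; simpl. ring. }
  rewrite E. ring.
Qed.

Lemma chint_app l l' f : chint (l ++ l') f = (chint l f + chint l' f)%C.
Proof. induction l as [|p l IH]; simpl. ring. rewrite IH. ring. Qed.

Lemma boundary_app l l' G : boundary (l ++ l') G = (boundary l G + boundary l' G)%C.
Proof. induction l as [|p l IH]; simpl. ring. rewrite IH. ring. Qed.

Lemma closed_app l l' : closed_chain l -> closed_chain l' -> closed_chain (l ++ l').
Proof. intros H H' G. rewrite boundary_app, H, H'. ring. Qed.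

Lemma good_app l l' : good l -> good l' -> good (l ++ l').
Proof. intros H H' p Hp. apply in_app_or in Hp. destruct Hp; auto. Qed.

Lemma supp_app l l' z : supp (l ++ l') z <-> supp l z \/ supp l' z.
Proof.
  split.
  - intros [p [Hp Hz]]. apply in_app_or in Hp. destruct Hp; [left|right]; exists p; auto.
  - intros [[p [Hp Hz]]|[p [Hp Hz]]]; exists p; split; trivial; apply in_or_app; auto.
Qed.

Lemma ccont_bounded (g : R -> C) a b : a <= b -> (forall s, a <= s <= b -> ccont g s) ->
  exists M, 0 < M /\ forall s, a <= s <= b -> Cmod (g s) <= M.
Proof.
  intros Hab H.
  set (h := fun s => Cmod (g (clamp a b s))).
  destruct (continuity_ab_maj h a b Hab) as [x [Hx _]].
  { intros c Hc. apply continuity_pt_filterlim. apply continuous_R_ed. intros e He.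
    destruct (proj1 (ccont_ed _ _) (ccont_clamp g a b c Hab H) e He) as [d [Hd K]].
    exists d. split; trivial. intros r Hr. specialize (K r Hr). unfold h.
    generalize (Cmod_triangle_rev (g (clamp a b r)) (g (clamp a b c))) (Cmod_triangle_rev (g (clamp a b c)) (g (clamp a b r))).
    rewrite (Cmod_minus_sym (g (clamp a b c)) (g (clamp a b r))). intros. apply Rabs_def1; lra. }
  exists (h x + 1). split. unfold h. generalize (Cmod_ge_0 (g (clamp a b x))). lra.
  intros s Hs. specialize (Hx s Hs). unfold h in Hx at 1. rewrite clamp_id in Hx by lra. lra.
Qed.

Lemma ccont_attains_min (g : R -> C) (p : C) a b : a <= b -> (forall s, a <= s <= b -> ccont g s) ->
  exists s0, a <= s0 <= b /\ forall s, a <= s <= b -> Cmod (g s0 - p) <= Cmod (g s - p).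
Proof.
  intros Hab H.
  set (h := fun s => Cmod (g (clamp a b s) - p)).
  destruct (continuity_ab_min h a b Hab) as [x [Hx Hx']].
  { intros c Hc. apply continuity_pt_filterlim. apply continuous_R_ed. intros e He.
    destruct (proj1 (ccont_ed _ _) (ccont_clamp g a b c Hab H) e He) as [d [Hd K]].
    exists d. split; trivial. intros r Hr. specialize (K r Hr). unfold h.
    generalize (Cmod_triangle_rev (g (clamp a b r) - p) (g (clamp a b c) - p)) (Cmod_triangle_rev (g (clamp a b c) - p) (g (clamp a b r) - p)).
    replace (g (clamp a b r) - p - (g (clamp a b c) - p))%C with (g (clamp a b r) - g (clamp a b c))%C by ring.
    replace (g (clamp a b c) - p - (g (clamp a b r) - p))%C with (g (clamp a b c) - g (clamp a b r))%C by ring.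
    rewrite (Cmod_minus_sym (g (clamp a b c)) (g (clamp a b r))). intros. apply Rabs_def1; lra. }
  exists x. split; trivial. intros s Hs. specialize (Hx s Hs). unfold h in Hx.
  rewrite !clamp_id in Hx by lra. exact Hx.
Qed.

(** The bound B is assumed nonnegative so as to include the empty chain. *)
Lemma chint_bound l : good l -> exists M, 0 < M /\ forall f B, 0 <= B -> cont_on (supp l) f ->
  (forall z, supp l z -> Cmod (f z) <= B) -> Cmod (chint l f) <= M * B.
Proof.
  induction l as [|p l IH]; intros Hl.
  - exists 1. split. lra. intros f B HB0 _ HB. simpl. rewrite Cmod_0. lra.
  - destruct (IH (good_tl _ _ Hl)) as [M [HM K]].
    destruct (good_hd _ _ Hl) as [Hlt Hp].
    destruct (ccont_bounded (pd p) (pa p) (pb p)) as [D [HD KD]]. lra. intros s Hs. apply (Hp s Hs).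
    exists (M + D * (pb p - pa p)). split. nra.
    intros f B HB0 Hf HB. simpl. eapply Rle_trans. apply Cmod_triangle.
    assert (E1 : Cmod (pint p f) <= B * D * (pb p - pa p)).
    { eapply cis_int_bound; [| | apply pint_correct; eauto using good_hd, cont_on_cons_hd]. lra.
      intros s Hs. cbv beta. rewrite Cmod_mult. apply Rmult_le_compat; try apply Cmod_ge_0.
      - apply HB. exists p. split. left; trivial. exists s. auto.
      - apply KD. exact Hs. }
    assert (E2 : Cmod (chint l f) <= M * B).
    { apply K; trivial. eauto using cont_on_cons_tl. intros z [q [Hq Hz]]. apply HB. exists q. split; trivial. right; trivial. }
    nra.
Qed.

Lemma supp_bounded l : good l -> exists B, 0 < B /\ forall z, supp l z -> Cmod z <= B.
Proof.
  induction l as [|p l IH]; intros Hl.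
  - exists 1. split. lra. intros z [q [[] _]].
  - destruct (IH (good_tl _ _ Hl)) as [M [HM K]].
    assert (Hp := good_hd _ _ Hl).
    destruct (ccont_bounded (pg p) (pa p) (pb p)) as [D [HD KD]]. destruct Hp; lra. intros s Hs. apply good_piece_ccont; trivial.
    exists (M + D). split. lra.
    intros z [q [[Hq|Hq] Hz]].
    + subst q. destruct Hz as [s [Hs ->]]. specialize (KD s Hs). lra.
    + assert (Cmod z <= M) by (apply K; exists q; auto). lra.
Qed.

(** The support is compact, so a point off it has a positive distance to it. *)
Lemma supp_closed l q : good l -> ~ supp l q -> exists d, 0 < d /\ forall z, supp l z -> d <= Cmod (z - q).
Proof.
  induction l as [|p l IH]; intros Hl Hq.
  - exists 1. split. lra. intros z [r [[] _]].
  - destruct (IH (good_tl _ _ Hl)) as [M [HM K]]. intros [r [Hr Hz]]. apply Hq. exists r; split; trivial. right; trivial.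
    assert (Hp := good_hd _ _ Hl).
    destruct (ccont_attains_min (pg p) q (pa p) (pb p)) as [s0 [Hs0 KD]]. destruct Hp; lra. intros s Hs. apply good_piece_ccont; trivial.
    assert (0 < Cmod (pg p s0 - q)).
    { apply Cmod_neq_gt. intros E. apply Hq. exists p. split. left; trivial. exists s0. split; auto. }
    exists (Rmin M (Cmod (pg p s0 - q))). split. apply Rmin_glb_lt; lra.
    intros z [r [[Hr|Hr] Hz]].
    + subst r. destruct Hz as [s [Hs ->]]. eapply Rle_trans. apply Rmin_r. apply KD. exact Hs.
    + eapply Rle_trans. apply Rmin_l. apply K. exists r; auto.
Qed.

(** F is complex differentiable at z with derivative f z, expressed by the
chain rule along differentiable curves. *)
Definition cprim (F f : C -> C) (z : C) : Prop :=
  forall (c : R -> C) s d, c s = z -> cder c s d -> cder (fun r => F (c r)) s (f z * d)%C.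

Lemma chint_FTC l F f : good l -> (forall z, supp l z -> cprim F f z) -> cont_on (supp l) f ->
  chint l f = boundary l F.
Proof.
  induction l as [|p l IH]; simpl; intros Hl HF Hf; trivial.
  rewrite IH; eauto using good_tl, cont_on_cons_tl.
  2:{ intros z [q [Hq Hz]]. apply HF. exists q. split; trivial. right; trivial. }
  f_equal.
  assert (Hp := good_hd _ _ Hl). destruct Hp as [Hlt Hp].
  (* the integrand is continuous relative to [pa,pb] only, hence the clamped parameter *)
  transitivity (cint (fun s => f (pg p (clamp (pa p) (pb p) s)) * pd p (clamp (pa p) (pb p) s))%C (pa p) (pb p)).
  - unfold pint, cint. f_equal; apply RInt_ext; rewrite Rmin_left, Rmax_right by lra;
    intros x Hx; rewrite clamp_id by lra; reflexivity.
  - apply cis_int_cint. apply (cis_int_FTC (fun s => F (pg p s))). lra.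
    + intros s Hs. rewrite clamp_id by lra. apply HF. exists p. split; [left; trivial | exists s; auto].
      reflexivity. apply (Hp s Hs).
    + intros s Hs. apply ccont_mult.
      * apply (ccont_comp_on (psupp p) f (fun r => pg p (clamp (pa p) (pb p) r))); eauto using cont_on_cons_hd.
        -- intros r. exists (clamp (pa p) (pb p) r). split; trivial. apply clamp_in. lra.
        -- apply ccont_clamp. lra. intros r Hr. eapply cder_ccont. apply (Hp r Hr).
      * apply ccont_clamp. lra. intros r Hr. apply (Hp r Hr).
Qed.

Lemma closed_FTC l F f : good l -> closed_chain l -> (forall z, supp l z -> cprim F f z) ->
  cont_on (supp l) f -> chint l f = 0%C.
Proof. intros. rewrite (chint_FTC l F f); auto. Qed.

Definition inv_piece (p : piece) : piece :=
  mkpiece (fun s => / pg p s)%C (fun s => - pd p s / (pg p s * pg p s))%C (pa p) (pb p).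
(** The image of a chain under z -> 1/z; the velocity of 1/g is - g'/g^2. *)
Definition inv_chain (l : chain) : chain := map inv_piece l.

Lemma Cinv_0 : (/ 0 = 0)%C.
Proof. apply C_ext; simpl; unfold Rdiv; ring. Qed.

Lemma Cinv_inv (z : C) : (/ / z = z)%C.
Proof.
  destruct (Ceq_dec z 0%C) as [->|H]. rewrite !Cinv_0. reflexivity.
  field. trivial.
Qed.

Lemma Cinv_neq_0 (z : C) : z <> 0%C -> (/ z <> 0)%C.
Proof. intros H E. apply H. rewrite <- (Cinv_inv z), E. apply Cinv_0. Qed.

Lemma good_inv l : good l -> ~ supp l 0%C -> good (inv_chain l).
Proof.
  intros Hl H0 p' Hp'. apply in_map_iff in Hp'. destruct Hp' as [p [<- Hp]].
  destruct (Hl p Hp) as [Hlt K]. split. exact Hlt. simpl. intros s Hs.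
  assert (Hn : pg p s <> 0%C). { intros E. apply H0. exists p. split; trivial. exists s. split; auto. }
  destruct (K s Hs) as [K1 K2]. split.
  - apply cder_inv; trivial.
  - unfold Cdiv. apply ccont_mult. apply ccont_opp. trivial. apply ccont_inv.
    apply ccont_mult; eapply cder_ccont; eassumption. apply Cmult_neq_0; trivial.
Qed.

Lemma supp_inv l z : supp (inv_chain l) z <-> supp l (/ z)%C.
Proof.
  split.
  - intros [p' [Hp' [s [Hs E]]]]. apply in_map_iff in Hp'. destruct Hp' as [p [<- Hp]].
    simpl in *. exists p. split; trivial. exists s. split; trivial. rewrite E. apply Cinv_inv.
  - intros [p [Hp [s [Hs E]]]]. exists (inv_piece p). split. apply in_map. trivial.
    exists s. split; trivial. simpl. rewrite <- E. symmetry. apply Cinv_inv.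
Qed.

Lemma closed_inv l : closed_chain l -> closed_chain (inv_chain l).
Proof.
  intros H G. rewrite <- (H (fun z => G (/ z)%C)). clear H. induction l as [|p l IH]; simpl; trivial.
  rewrite IH. reflexivity.
Qed.

Lemma chint_inv l f : chint (inv_chain l) f = chint l (fun u => f (/ u) * - / (u * u))%C.
Proof.
  induction l as [|p l IH]; simpl; trivial. rewrite IH. f_equal.
  assert (E : forall x, (f (pg (inv_piece p) x) * pd (inv_piece p) x =
      (f (/ pg p x) * - / (pg p x * pg p x)) * pd p x)%C) by (intros x; simpl; unfold Cdiv; ring).
  unfold pint, cint. f_equal; apply RInt_ext; intros x _; rewrite E; reflexivity.
Qed.

Definition seg (p q : C) : piece := mkpiece (fun s => p + s * (q - p))%C (fun _ => q - p)%C 0 1.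

Lemma seg_cder p q s : cder (fun s : R => p + s * (q - p))%C s (q - p)%C.
Proof.
  eapply cder_eq. apply cder_plus. apply cder_const. apply cder_mult.
  2: apply cder_const.
  instantiate (1 := 1%C). split; simpl. apply (is_derive_id (K := R_AbsRing)). apply (is_derive_const (V := R_NormedModule)).
  simpl. ring.
Qed.

Lemma good_seg p q : good_piece (seg p q).
Proof.
  split. simpl; lra. intros s _. split. apply seg_cder. apply ccont_const.
Qed.

Lemma seg_start p q : pg (seg p q) (pa (seg p q)) = p.
Proof. simpl. ring. Qed.
Lemma seg_end p q : pg (seg p q) (pb (seg p q)) = q.
Proof. simpl. ring. Qed.

Lemma pint_seg_bound p q f B : cont_on (psupp (seg p q)) f ->
  (forall z, psupp (seg p q) z -> Cmod (f z) <= B) -> Cmod (pint (seg p q) f) <= B * Cmod (q - p).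
Proof.
  intros Hf HB.
  replace (B * Cmod (q - p)) with (B * Cmod (q - p) * (1 - 0)) by ring.
  eapply cis_int_bound; [| | apply (pint_correct (seg p q) f (good_seg p q) Hf)]. simpl; lra.
  intros s Hs. cbv beta. rewrite Cmod_mult. apply Rmult_le_compat_r. apply Cmod_ge_0.
  apply HB. exists s. auto.
Qed.

(** * Continuity on sets, complex primitives and the exponential *)

Lemma cont_on_const X k : cont_on X (fun _ => k).
Proof.
  intros z _ e He. exists 1. split. lra. intros. replace (k - k)%C with (RtoC 0) by ring. rewrite Cmod_0. exact He.
Qed.

Lemma cont_on_id X : cont_on X (fun z => z).
Proof. intros z _ e He. exists e. split; auto. Qed.

Lemma cont_on_plus X f g : cont_on X f -> cont_on X g -> cont_on X (fun z => f z + g z)%C.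
Proof.
  intros Hf Hg z Hz e He.
  destruct (Hf z Hz (e/2)) as [d1 [Hd1 K1]]; [lra|]. destruct (Hg z Hz (e/2)) as [d2 [Hd2 K2]]; [lra|].
  exists (Rmin d1 d2). split. apply Rmin_glb_lt; lra. intros z' Hz' Hd.
  specialize (K1 z' Hz' (Rlt_le_trans _ _ _ Hd (Rmin_l _ _))).
  specialize (K2 z' Hz' (Rlt_le_trans _ _ _ Hd (Rmin_r _ _))).
  replace (f z' + g z' - (f z + g z))%C with ((f z' - f z) + (g z' - g z))%C by ring.
  eapply Rle_lt_trans. apply Cmod_triangle. lra.
Qed.

Lemma cont_on_mult X f g : cont_on X f -> cont_on X g -> cont_on X (fun z => f z * g z)%C.
Proof.
  intros Hf Hg z Hz e He.
  set (A := Cmod (f z) + Cmod (g z) + 1).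
  assert (HA : 1 <= A) by (unfold A; generalize (Cmod_ge_0 (f z)) (Cmod_ge_0 (g z)); lra).
  set (e' := Rmin 1 (e / (2 * A))).
  assert (He' : 0 < e'). { apply Rmin_glb_lt. lra. apply Rdiv_lt_0_compat; lra. }
  destruct (Hf z Hz e' He') as [d1 [Hd1 K1]]. destruct (Hg z Hz e' He') as [d2 [Hd2 K2]].
  exists (Rmin d1 d2). split. apply Rmin_glb_lt; lra. intros z' Hz' Hd.
  specialize (K1 z' Hz' (Rlt_le_trans _ _ _ Hd (Rmin_l _ _))).
  specialize (K2 z' Hz' (Rlt_le_trans _ _ _ Hd (Rmin_r _ _))).
  replace (f z' * g z' - f z * g z)%C with ((f z' - f z) * (g z' - g z) + ((f z' - f z) * g z + f z * (g z' - g z)))%C by ring.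
  assert (E1 : e' <= 1) by apply Rmin_l.
  assert (E2 : e' * A <= e / 2).
  { replace (e / 2) with (e / (2 * A) * A) by (field; lra). apply Rmult_le_compat_r. lra. apply Rmin_r. }
  eapply Rle_lt_trans. apply Cmod_triangle.
  eapply Rle_lt_trans. apply Rplus_le_compat_l. apply Cmod_triangle. rewrite !Cmod_mult.
  generalize (Cmod_ge_0 (f z)) (Cmod_ge_0 (g z)) (Cmod_ge_0 (f z' - f z)) (Cmod_ge_0 (g z' - g z)). intros.
  assert (Cmod (f z' - f z) * Cmod (g z' - g z) <= e' * 1) by (apply Rmult_le_compat; lra).
  assert (Cmod (f z' - f z) * Cmod (g z) <= e' * Cmod (g z)) by (apply Rmult_le_compat_r; lra).
  assert (Cmod (f z) * Cmod (g z' - g z) <= e' * Cmod (f z)) by (rewrite Rmult_comm; apply Rmult_le_compat_r; lra).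
  unfold A in E2. lra.
Qed.

Lemma cont_on_opp X f : cont_on X f -> cont_on X (fun z => - f z)%C.
Proof.
  intros H. apply (cont_on_ext X (fun z => (-1) * f z)%C). intros; ring.
  apply cont_on_mult; trivial. apply cont_on_const.
Qed.

Lemma cont_on_minus X f g : cont_on X f -> cont_on X g -> cont_on X (fun z => f z - g z)%C.
Proof. intros. unfold Cminus. apply cont_on_plus; trivial. apply cont_on_opp; trivial. Qed.

Lemma Cinv_diff (a b : C) : a <> 0%C -> b <> 0%C -> (/ a - / b = (b - a) / (a * b))%C.
Proof. intros. field. auto. Qed.

Lemma cont_on_inv X f : cont_on X f -> (forall z, X z -> f z <> 0%C) -> cont_on X (fun z => / f z)%C.
Proof.
  intros Hf Hn z Hz e He.
  set (m := Cmod (f z)). assert (Hm : 0 < m) by (apply Cmod_gt_0; auto).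
  destruct (Hf z Hz (Rmin (m/2) (e * m * m / 2))) as [d [Hd K]].
  { apply Rmin_glb_lt. lra. assert (0 < e * m * m) by (repeat apply Rmult_lt_0_compat; lra). lra. }
  exists d. split; trivial. intros z' Hz' Hd'. specialize (K z' Hz' Hd').
  rewrite Cinv_diff by auto. rewrite Cmod_div by (apply Cmult_neq_0; auto).
  rewrite Cmod_mult. fold m.
  destruct (Rmin_Rgt_l _ _ _ K) as [K1 K2].
  assert (Hm' : m / 2 < Cmod (f z')).
  { generalize (Cmod_triangle_rev (f z) (f z')). rewrite Cmod_minus_sym. fold m. lra. }
  apply Rlt_div_l. nra. rewrite Cmod_minus_sym. assert (0 < e * m) by nra. nra.
Qed.

Ltac cont := repeat first
  [ apply cont_on_const | apply cont_on_id | assumption | apply cont_on_plus | apply cont_on_minus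
  | apply cont_on_mult | apply cont_on_opp ].

Lemma cprim_ext F f g z : f z = g z -> cprim F f z -> cprim F g z.
Proof. intros E H c s d H1 H2. rewrite <- E. apply H; trivial. Qed.
Lemma cprim_const k z : cprim (fun _ => k) (fun _ => 0%C) z.
Proof. intros c s d _ _. eapply cder_eq. apply cder_const. ring. Qed.
Lemma cprim_id z : cprim (fun z => z) (fun _ => 1%C) z.
Proof. intros c s d _ H. eapply cder_eq. exact H. ring. Qed.
Lemma cprim_plus F f G g z : cprim F f z -> cprim G g z -> cprim (fun z => F z + G z)%C (fun z => f z + g z)%C z.
Proof. intros H1 H2 c s d Hc Hd. eapply cder_eq. apply cder_plus. apply (H1 c s d); trivial. apply (H2 c s d); trivial. ring. Qed.
Lemma cprim_mult F f G g z : cprim F f z -> cprim G g z -> cprim (fun z => F z * G z)%C (fun z => f z * G z + F z * g z)%C z.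
Proof. intros H1 H2 c s d Hc Hd. eapply cder_eq. apply cder_mult. apply (H1 c s d); trivial. apply (H2 c s d); trivial. cbv beta. rewrite ?Hc. ring. Qed.
Lemma cprim_scal k F f z : cprim F f z -> cprim (fun z => k * F z)%C (fun z => k * f z)%C z.
Proof. intros H. eapply cprim_ext. 2: apply cprim_mult; [apply cprim_const | exact H]. simpl. ring. Qed.
Lemma cprim_exp F f z : cprim F f z -> cprim (fun z => Cexp (F z)) (fun z => Cexp (F z) * f z)%C z.
Proof. intros H c s d Hc Hd. eapply cder_eq. apply cder_exp. apply (H c s d); trivial. cbv beta. rewrite ?Hc. ring. Qed.
Lemma cprim_pow F f n z : cprim F f z -> cprim (fun z => F z ^ S n)%C (fun z => INR (S n) * F z ^ n * f z)%C z.
Proof. intros H c s d Hc Hd. eapply cder_eq. apply cder_pow. apply (H c s d); trivial. cbv beta. rewrite ?Hc. ring. Qed.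
Lemma cprim_inv F f z : cprim F f z -> F z <> 0%C -> cprim (fun z => / F z)%C (fun z => - f z / (F z * F z))%C z.
Proof.
  intros H Hn c s d Hc Hd. subst z. eapply cder_eq. apply (cder_inv (fun r => F (c r)) s (f (c s) * d)%C).
  apply (H c s d); trivial. exact Hn. simpl. field. trivial.
Qed.
Lemma cprim_ext2 F f G g z : (forall w, F w = G w) -> f z = g z -> cprim F f z -> cprim G g z.
Proof.
  intros E1 E2 H c s d H1 H2. rewrite <- E2.
  eapply cder_ext_loc; [|apply H; eassumption]. exists 1. split. lra. intros; apply E1.
Qed.

Lemma good_1 p : good_piece p -> good (p :: nil).
Proof. intros H q [<-|[]]. exact H. Qed.

Lemma supp_1 p z : supp (p :: nil) z <-> psupp p z.
Proof. split. intros [q [[<-|[]] H]]; trivial. intros H. exists p. split; [left|]; trivial. Qed.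

Lemma seg_mvt G g u v B : (forall z, psupp (seg u v) z -> cprim G g z) -> cont_on (psupp (seg u v)) g ->
  (forall z, psupp (seg u v) z -> Cmod (g z) <= B) -> Cmod (G v - G u) <= B * Cmod (v - u).
Proof.
  intros H Hg HB.
  assert (E : chint (seg u v :: nil) g = boundary (seg u v :: nil) G).
  { apply chint_FTC. apply good_1, good_seg. intros z Hz. apply H. apply supp_1; trivial.
    eapply cont_on_sub. 2: exact Hg. intros z Hz. apply supp_1; trivial. }
  unfold boundary, chint, fold_right in E. rewrite seg_start, seg_end in E.
  replace (G v - G u)%C with (G v - G u + 0)%C by ring. rewrite <- E.
  replace (pint (seg u v) g + 0)%C with (pint (seg u v) g) by ring.
  apply pint_seg_bound; trivial.
Qed.

Lemma seg0_Cmod v z : psupp (seg 0 v) z -> Cmod z <= Cmod v.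
Proof.
  intros [s [Hs ->]]. simpl in *. replace (0 + s * (v - 0))%C with (s * v)%C by ring.
  rewrite Cmod_mult, Cmod_R, Rabs_pos_eq by lra. generalize (Cmod_ge_0 v). nra.
Qed.

Lemma Cexp_plus a b : Cexp (a + b) = (Cexp a * Cexp b)%C.
Proof.
  unfold Cexp. rewrite re_plus, im_plus, exp_plus, cos_plus, sin_plus. apply C_ext; simpl; ring.
Qed.

Lemma Cexp_0 : Cexp 0 = 1%C.
Proof. unfold Cexp. simpl. rewrite exp_0, cos_0, sin_0. apply C_ext; simpl; ring. Qed.

Lemma Cmod_Cexp z : Cmod (Cexp z) = exp (Re z).
Proof.
  unfold Cexp, Cmod. simpl fst; simpl snd.
  replace ((exp (Re z) * cos (Im z)) ^ 2 + (exp (Re z) * sin (Im z)) ^ 2) with ((exp (Re z)) ^ 2).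
  - apply sqrt_pow2. left. apply exp_pos.
  - generalize (sin2_cos2 (Im z)). unfold Rsqr. intros. nra.
Qed.

Lemma Cexp_neq_0 z : Cexp z <> 0%C.
Proof. intros E. apply (f_equal Cmod) in E. rewrite Cmod_Cexp, Cmod_0 in E. generalize (exp_pos (Re z)). lra. Qed.

Lemma Cexp_opp z : Cexp (- z) = (/ Cexp z)%C.
Proof.
  assert (Cexp z * Cexp (- z) = 1)%C. { rewrite <- Cexp_plus. replace (z + - z)%C with (RtoC 0) by ring. apply Cexp_0. }
  rewrite <- (Cmult_1_r (/ Cexp z)), <- H. field. apply Cexp_neq_0.
Qed.

Lemma Cexp_INR n z : Cexp (INR n * z) = (Cexp z ^ n)%C.
Proof.
  induction n. simpl. replace (0 * z)%C with (RtoC 0) by ring. apply Cexp_0.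
  rewrite S_INR, RtoC_plus, Cpow_S, <- IHn, <- Cexp_plus. f_equal. ring.
Qed.

Lemma Re_le_Cmod z : Re z <= Cmod z.
Proof. eapply Rle_trans. apply Rle_abs. apply re_le_Cmod. Qed.

Lemma exp_le (x y : R) : x <= y -> exp x <= exp y.
Proof. intros [H| ->]. left. apply exp_increasing; trivial. lra. Qed.

Lemma Cmod_Cexp_le z : Cmod (Cexp z) <= exp (Cmod z).
Proof. rewrite Cmod_Cexp. apply exp_le, Re_le_Cmod. Qed.

Lemma ccont_cont_on_exp X : cont_on X Cexp.
Proof.
  (* along the segment the derivative is bounded by exp (|z| + 1) *)
  intros z _ e He. set (B := exp (Cmod z + 1)). assert (HB : 0 < B) by apply exp_pos.
  exists (Rmin 1 (e / B)). split. apply Rmin_glb_lt. lra. apply Rdiv_lt_0_compat; trivial.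
  intros z' _ Hd. destruct (Rmin_Rgt_l _ _ _ Hd) as [H1 H2].
  assert (Hcc : forall w, psupp (seg z z') w -> Cmod (Cexp w) <= B).
  { intros w [s [Hs ->]]. eapply Rle_trans. apply Cmod_Cexp_le. apply exp_le. simpl in *.
    eapply Rle_trans. apply Cmod_triangle. apply Rplus_le_compat_l.
    rewrite Cmod_mult, Cmod_R, Rabs_pos_eq by lra. generalize (Cmod_ge_0 (z' - z)). nra. }
  assert (E : cis_int (fun s => Cexp (z + s * (z' - z)) * (z' - z))%C 0 1 (Cexp (z + 1 * (z' - z)) - Cexp (z + 0 * (z' - z)))%C).
  { apply (cis_int_FTC (fun s : R => Cexp (z + s * (z' - z)))%C). lra.
    - intros s _. apply cder_exp. apply seg_cder.
    - intros s _. apply ccont_mult. eapply cder_ccont. apply cder_exp. apply seg_cder. apply ccont_const. }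
  replace (z + 1 * (z' - z))%C with z' in E by ring. replace (z + 0 * (z' - z))%C with z in E by ring.
  eapply cis_int_bound with (M := B * Cmod (z' - z)) in E; [|lra|].
  - eapply Rle_lt_trans. exact E. replace e with (B * (e / B)) by (field; lra). nra.
  - intros s Hs. cbv beta. rewrite Cmod_mult. apply Rmult_le_compat_r. apply Cmod_ge_0. apply Hcc. exists s. auto.
Qed.

Lemma cont_on_exp X f : cont_on X f -> cont_on X (fun z => Cexp (f z)).
Proof.
  intros Hf z Hz e He. destruct (ccont_cont_on_exp (fun _ => True) (f z) I e He) as [d [Hd K]].
  destruct (Hf z Hz d Hd) as [d' [Hd' K']]. exists d'. split; trivial. intros. apply K; auto.
Qed.

Lemma cont_on_pow X f n : cont_on X f -> cont_on X (fun z => f z ^ n)%C.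
Proof. intros Hf. induction n; simpl. apply cont_on_const. apply cont_on_mult; trivial. Qed.

Lemma Cexp_order1 v : Cmod (Cexp v - 1) <= exp (Cmod v) * Cmod v.
Proof.
  replace v with (v - 0)%C at 3 by ring. rewrite <- Cexp_0.
  apply (seg_mvt Cexp Cexp).
  - intros z _. eapply cprim_ext. 2: apply (cprim_exp (fun z => z)); apply cprim_id. simpl. ring.
  - apply cont_on_exp, cont_on_id.
  - intros z Hz. eapply Rle_trans. apply Cmod_Cexp_le. apply exp_le. apply seg0_Cmod; trivial.
Qed.

Lemma Cexp_order2 v : Cmod (Cexp v - 1 - v) <= exp (Cmod v) * Cmod v * Cmod v.
Proof.
  replace v with (v - 0)%C at 5 by ring.
  replace (Cexp v - 1 - v)%C with ((Cexp v - v) - (Cexp 0 - 0))%C by (rewrite Cexp_0; ring).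
  apply (seg_mvt (fun z => Cexp z - z)%C (fun z => Cexp z - 1)%C).
  - intros z _. eapply cprim_ext2.
    3: eapply (cprim_plus (fun z => Cexp z) _ (fun z => (-1) * z)%C);
         [apply (cprim_exp (fun z => z)), cprim_id | apply cprim_scal, cprim_id].
    intros; simpl; ring. simpl; ring.
  - cont. apply cont_on_exp, cont_on_id.
  - intros z Hz. apply seg0_Cmod in Hz. eapply Rle_trans. apply Cexp_order1. apply Rmult_le_compat; trivial.
    left; apply exp_pos. apply Cmod_ge_0. apply exp_le; trivial.
Qed.

(** The key estimate behind the scaling limit: (1 - v) e^(v + v^2/2) = 1 + O(v^3), because its
derivative is - v^2 e^(v + v^2/2). *)
Lemma one_minus_exp_order3 v :
  Cmod ((1 - v) * Cexp (v + v * v / 2) - 1) <= Cmod v ^ 2 * exp (Cmod v + Cmod v ^ 2 / 2) * Cmod v.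
Proof.
  set (G := fun v => ((1 - v) * Cexp (v + v * v / 2))%C).
  replace ((1 - v) * Cexp (v + v * v / 2) - 1)%C with (G v - G 0)%C.
  2:{ unfold G. replace (0 + 0 * 0 / 2)%C with (RtoC 0) by (unfold Cdiv; ring). rewrite Cexp_0. ring. }
  replace v with (v - 0)%C at 5 by ring.
  apply (seg_mvt G (fun z => - (z * z) * Cexp (z + z * z / 2))%C).
  - intros z _. unfold G. eapply cprim_ext2.
    3:{ eapply (cprim_mult (fun v => 1 + (-1) * v)%C _ (fun v => Cexp (v + /2 * (v * v)))%C).
        - apply cprim_plus. apply cprim_const. apply cprim_scal, cprim_id.
        - apply (cprim_exp (fun v => v + /2 * (v * v)))%C. apply cprim_plus. apply cprim_id.
          apply cprim_scal. eapply (cprim_mult (fun z => z) _ (fun z => z)); apply cprim_id. }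
    + intros w. simpl. f_equal. ring. f_equal. unfold Cdiv; ring.
    + simpl. replace (z + / 2 * (z * z))%C with (z + z * z / 2)%C by (unfold Cdiv; ring). field.
  - cont. apply cont_on_exp. unfold Cdiv. cont.
  - intros z Hz. apply seg0_Cmod in Hz. rewrite Cmod_mult, Cmod_opp, Cmod_mult.
    assert (H0 := Cmod_ge_0 z). apply Rmult_le_compat. nra. apply Cmod_ge_0. nra.
    eapply Rle_trans. apply Cmod_Cexp_le. apply exp_le. eapply Rle_trans. apply Cmod_triangle.
    unfold Cdiv. rewrite !Cmod_mult, Cmod_inv, Cmod_R, Rabs_pos_eq by (try lra; intros E; apply RtoC_inj in E; lra).
    nra.
Qed.

(** * Cauchy's theorem for limits of rational functions *)

(** Rational functions of z with poles in A. *)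
Inductive rat (A : list C) : (C -> C) -> Prop :=
| rat_const k : rat A (fun _ => k)
| rat_id : rat A (fun z => z)
| rat_pole a : In a A -> rat A (fun z => / (z - a))%C
| rat_plus f g : rat A f -> rat A g -> rat A (fun z => f z + g z)%C
| rat_mult f g : rat A f -> rat A g -> rat A (fun z => f z * g z)%C.

(** Partial fractions: every term has a primitive off A, except the simple poles 1/(z - a). *)
Inductive span (A : list C) : (C -> C) -> Prop :=
| span_pow n : span A (fun z => z ^ n)%C
| span_pole a n : In a A -> span A (fun z => (/ (z - a)) ^ S n)%C
| span_plus f g : span A f -> span A g -> span A (fun z => f z + g z)%C
| span_scal k f : span A f -> span A (fun z => k * f z)%C.

(** Equality is required off A only, since division by 0 makes rational identities fail at the poles. *)
Definition spanE (A : list C) (f : C -> C) : Prop :=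
  exists g, span A g /\ forall z, ~ In z A -> f z = g z.

Lemma spanE_ext A f g : (forall z, ~ In z A -> f z = g z) -> spanE A g -> spanE A f.
Proof. intros H [h [Hh E]]. exists h. split; trivial. intros z Hz. rewrite H; auto. Qed.

Lemma spanE_plus A f g : spanE A f -> spanE A g -> spanE A (fun z => f z + g z)%C.
Proof. intros [f' [Hf Ef]] [g' [Hg Eg]]. exists (fun z => f' z + g' z)%C. split. constructor; trivial. intros; rewrite Ef, Eg; trivial. Qed.

Lemma spanE_scal A k f : spanE A f -> spanE A (fun z => k * f z)%C.
Proof. intros [f' [Hf Ef]]. exists (fun z => k * f' z)%C. split. constructor; trivial. intros; rewrite Ef; trivial. Qed.

Lemma spanE_pow A n : spanE A (fun z => z ^ n)%C.
Proof. exists (fun z => z ^ n)%C. split. constructor. trivial. Qed.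

Lemma spanE_pole A a n : In a A -> spanE A (fun z => (/ (z - a)) ^ n)%C.
Proof.
  intros Ha. destruct n.
  - apply (spanE_ext A _ (fun z => z ^ 0)%C). intros; reflexivity. apply spanE_pow.
  - exists (fun z => (/ (z - a)) ^ S n)%C. split. constructor; trivial. trivial.
Qed.

Lemma not_in_neq (A : list C) z a : In a A -> ~ In z A -> (z - a <> 0)%C.
Proof. intros Ha Hz E. apply Hz. apply Ceq_minus in E. rewrite E; trivial. Qed.

Lemma spanE_mul_id A f : spanE A f -> spanE A (fun z => z * f z)%C.
Proof.
  intros [g [Hg E]]. apply (spanE_ext A _ (fun z => z * g z)%C). intros; rewrite E; trivial. clear f E.
  induction Hg.
  - apply (spanE_ext A _ (fun z => z ^ S n)%C). intros; reflexivity. apply spanE_pow.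
  - apply (spanE_ext A _ (fun z => (/ (z - a)) ^ n + a * (/ (z - a)) ^ S n)%C).
    + intros z Hz. assert (Hn := not_in_neq A z a H Hz). rewrite Cpow_S. field. trivial.
    + apply spanE_plus. apply spanE_pole; trivial. apply spanE_scal, spanE_pole; trivial.
  - eapply spanE_ext. 2: apply (spanE_plus _ _ _ IHHg1 IHHg2). intros; simpl; ring.
  - eapply spanE_ext. 2: apply (spanE_scal _ k _ IHHg). intros; simpl; ring.
Qed.

(** Products of poles at distinct points a, b are resolved by
1/((z - a)(z - b)) = (1/(z - a) - 1/(z - b)) / (a - b). *)
Lemma spanE_mul_pole A b f : In b A -> spanE A f -> spanE A (fun z => / (z - b) * f z)%C.
Proof.
  intros Hb [g [Hg E]]. apply (spanE_ext A _ (fun z => / (z - b) * g z)%C). intros; rewrite E; trivial. clear f E.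
  induction Hg.
  - induction n.
    + apply (spanE_ext A _ (fun z => (/ (z - b)) ^ 1)%C). intros; simpl; ring. apply spanE_pole; trivial.
    + apply (spanE_ext A _ (fun z => z ^ n + b * (/ (z - b) * z ^ n))%C).
      * intros z Hz. assert (Hn := not_in_neq A z b Hb Hz). rewrite Cpow_S. field. trivial.
      * apply spanE_plus. apply spanE_pow. apply spanE_scal; trivial.
  - destruct (Ceq_dec a b) as [->|Hab].
    + apply (spanE_ext A _ (fun z => (/ (z - b)) ^ S (S n))%C). intros; reflexivity. apply spanE_pole; trivial.
    + assert (Hd : (a - b <> 0)%C). { intros E. apply Hab. apply Ceq_minus; trivial. }
      induction n.
      * apply (spanE_ext A _ (fun z => / (a - b) * ((/ (z - a)) ^ 1 + (-1) * (/ (z - b)) ^ 1))%C).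
        -- intros z Hz. assert (Hn := not_in_neq A z b Hb Hz). assert (Hn' := not_in_neq A z a H Hz). simpl. field. auto.
        -- apply spanE_scal. apply spanE_plus. apply spanE_pole; trivial. apply spanE_scal, spanE_pole; trivial.
      * apply (spanE_ext A _ (fun z => / (a - b) * ((/ (z - a)) ^ S (S n) + (-1) * (/ (z - b) * (/ (z - a)) ^ S n)))%C).
        -- intros z Hz. assert (Hn := not_in_neq A z b Hb Hz). assert (Hn' := not_in_neq A z a H Hz).
           rewrite (Cpow_S _ (S n)). generalize ((/ (z - a)) ^ S n)%C. intros w. field. auto.
        -- apply spanE_scal. apply spanE_plus. apply spanE_pole; trivial. apply spanE_scal. trivial.
  - eapply spanE_ext. 2: apply (spanE_plus _ _ _ IHHg1 IHHg2). intros; simpl; ring.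
  - eapply spanE_ext. 2: apply (spanE_scal _ k _ IHHg). intros; simpl; ring.
Qed.

Lemma spanE_mult A f g : spanE A f -> spanE A g -> spanE A (fun z => f z * g z)%C.
Proof.
  intros [f' [Hf E]] Hg. apply (spanE_ext A _ (fun z => f' z * g z)%C). intros; rewrite E; trivial. clear f E.
  induction Hf.
  - induction n.
    + eapply spanE_ext. 2: exact Hg. intros; simpl; ring.
    + eapply spanE_ext. 2: apply (spanE_mul_id _ _ IHn). intros; simpl; ring.
  - induction n.
    + eapply spanE_ext. 2: apply (spanE_mul_pole _ a _ H Hg). intros; simpl; ring.
    + eapply spanE_ext. 2: apply (spanE_mul_pole _ a _ H IHn). intros; simpl; ring.
  - eapply spanE_ext. 2: apply (spanE_plus _ _ _ IHHf1 IHHf2). intros; simpl; ring.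
  - eapply spanE_ext. 2: apply (spanE_scal _ k _ IHHf). intros; simpl; ring.
Qed.

Lemma rat_spanE A f : rat A f -> spanE A f.
Proof.
  induction 1.
  - apply (spanE_ext A _ (fun z => k * z ^ 0)%C). intros; simpl; ring. apply spanE_scal, spanE_pow.
  - apply (spanE_ext A _ (fun z => z ^ 1)%C). intros; simpl; ring. apply spanE_pow.
  - apply (spanE_ext A _ (fun z => (/ (z - a)) ^ 1)%C). intros; simpl; ring. apply spanE_pole; trivial.
  - apply spanE_plus; trivial.
  - apply spanE_mult; trivial.
Qed.

(** 2 pi i times the winding number, for a closed chain. *)
Definition index (l : chain) (a : C) : C := chint l (fun z => / (z - a))%C.

Definition avoids_list (X : C -> Prop) (A : list C) : Prop := forall a, In a A -> ~ X a.

Lemma cont_on_pole X a : ~ X a -> cont_on X (fun z => / (z - a))%C.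
Proof.
  intros H. apply cont_on_inv. cont. intros z Hz E. apply H. apply Ceq_minus in E. rewrite <- E; trivial.
Qed.

Lemma avoids_not_in X A z : avoids_list X A -> X z -> ~ In z A.
Proof. intros H Hz Hi. apply (H z Hi Hz). Qed.

Lemma cont_on_span X A f : avoids_list X A -> span A f -> cont_on X f.
Proof.
  intros HA. induction 1.
  - apply cont_on_pow, cont_on_id.
  - apply (cont_on_pow X (fun z => / (z - a))%C (S n)), cont_on_pole; auto.
  - cont.
  - cont.
Qed.

Lemma cont_on_rat X A f : avoids_list X A -> rat A f -> cont_on X f.
Proof.
  intros HA. induction 1; cont. apply cont_on_pole; auto.
Qed.

Lemma INR_S_neq n : RtoC (INR (S n)) <> 0%C.
Proof. intros E. apply RtoC_inj in E. revert E. apply not_0_INR. lia. Qed.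

(** Terms with a primitive integrate to 0 over both chains; on the simple poles the integrals agree by
hypothesis on the winding numbers. *)
Lemma chint_span l1 l2 A f : good l1 -> good l2 -> closed_chain l1 -> closed_chain l2 ->
  avoids_list (supp l1) A -> avoids_list (supp l2) A ->
  (forall a, In a A -> index l1 a = index l2 a) -> span A f -> chint l1 f = chint l2 f.
Proof.
  intros G1 G2 C1 C2 A1 A2 HW.
  assert (Prim : forall F f, (forall z, ~ In z A -> cprim F f z) -> span A f -> chint l1 f = chint l2 f).
  { intros F g HF Hg. rewrite (closed_FTC l1 F g), (closed_FTC l2 F g); trivial;
    eauto using avoids_not_in, cont_on_span. }
  induction 1.
  - apply (Prim (fun z => / INR (S n) * z ^ S n)%C). 2: constructor.
    intros z _. eapply cprim_ext2. 3: apply cprim_scal, (cprim_pow (fun z => z)), cprim_id.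
    intros; reflexivity. cbv beta. field. apply INR_S_neq.
  - destruct n.
    + rewrite (chint_ext l1 _ (fun z => / (z - a))%C), (chint_ext l2 (fun z => (/ (z - a)) ^ 1)%C (fun z => / (z - a))%C); trivial.
      apply (HW a H). intros; simpl; ring. intros; simpl; ring.
    + apply (Prim (fun z => (- / INR (S n)) * (/ (z - a)) ^ S n)%C). 2: constructor; trivial.
      intros z Hz. assert (Hn := not_in_neq A z a H Hz). eapply cprim_ext2.
      3: apply cprim_scal, (cprim_pow (fun z => / (z + - a))%C), cprim_inv; [apply cprim_plus; [apply cprim_id | apply cprim_const] |]; exact Hn.
      intros; reflexivity. simpl Cpow. generalize ((/ (z + - a)) ^ n)%C. intros w. change (z - a)%C with (z + - a)%C in *. field. split; trivial. apply INR_S_neq.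
  - rewrite !chint_plus; eauto using cont_on_span. rewrite IHspan1, IHspan2. reflexivity.
  - rewrite !chint_scal; eauto using cont_on_span. rewrite IHspan. reflexivity.
Qed.

Lemma chint_rat l1 l2 A f : good l1 -> good l2 -> closed_chain l1 -> closed_chain l2 ->
  avoids_list (supp l1) A -> avoids_list (supp l2) A ->
  (forall a, In a A -> index l1 a = index l2 a) -> rat A f -> chint l1 f = chint l2 f.
Proof.
  intros G1 G2 C1 C2 A1 A2 HW Hf. destruct (rat_spanE A f Hf) as [g [Hg E]].
  rewrite (chint_ext l1 f g), (chint_ext l2 f g); trivial.
  apply (chint_span l1 l2 A g); trivial.
  intros; apply E; eauto using avoids_not_in. intros; apply E; eauto using avoids_not_in.
Qed.

(** The compact sets on which rational functions with poles in A are bounded. *)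
Definition far (A : list C) (B d : R) (z : C) : Prop :=
  Cmod z <= B /\ forall a, In a A -> d <= Cmod (z - a).

(** Uniform limits, on the sets [far A B d], of rational functions with poles in A.  This class replaces holomorphic
functions on the complement of A: it is closed under sums, products and the exponential, and Cauchy's theorem passes to it
from rational functions. *)
Definition approx (A : list C) (f : C -> C) : Prop :=
  forall B d eta, 0 < B -> 0 < d -> 0 < eta -> exists r, rat A r /\ forall z, far A B d z -> Cmod (f z - r z) <= eta.

Lemma approx_rat A f : rat A f -> approx A f.
Proof.
  intros H B d eta _ _ He. exists f. split; trivial. intros z _. replace (f z - f z)%C with (RtoC 0) by ring. rewrite Cmod_0; lra.
Qed.

Lemma rat_bounded A f B d : 0 < B -> 0 < d -> rat A f -> exists M, 0 < M /\ forall z, far A B d z -> Cmod (f z) <= M.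
Proof.
  intros HB Hd. induction 1.
  - exists (Cmod k + 1). split. generalize (Cmod_ge_0 k); lra. intros; lra.
  - exists B. split; trivial. intros z [Hz _]; trivial.
  - exists (/ d). split. apply Rinv_0_lt_compat; trivial. intros z [_ Hz]. specialize (Hz a H).
    rewrite Cmod_inv. apply Rinv_le_contravar; trivial. intros E. rewrite E, Cmod_0 in Hz. lra.
  - destruct IHrat1 as [M1 [H1 K1]], IHrat2 as [M2 [H2 K2]]. exists (M1 + M2). split. lra.
    intros z Hz. eapply Rle_trans. apply Cmod_triangle. specialize (K1 z Hz). specialize (K2 z Hz). lra.
  - destruct IHrat1 as [M1 [H1 K1]], IHrat2 as [M2 [H2 K2]]. exists (M1 * M2). split. nra.
    intros z Hz. rewrite Cmod_mult. apply Rmult_le_compat; auto using Cmod_ge_0.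
Qed.

Lemma approx_bounded A f B d : 0 < B -> 0 < d -> approx A f -> exists M, 0 < M /\ forall z, far A B d z -> Cmod (f z) <= M.
Proof.
  intros HB Hd Hf. destruct (Hf B d 1 HB Hd Rlt_0_1) as [r [Hr K]].
  destruct (rat_bounded A r B d HB Hd Hr) as [M [HM KM]]. exists (M + 1). split. lra.
  intros z Hz. replace (f z) with (r z + (f z - r z))%C by ring. eapply Rle_trans. apply Cmod_triangle.
  specialize (K z Hz). specialize (KM z Hz). lra.
Qed.

Lemma approx_plus A f g : approx A f -> approx A g -> approx A (fun z => f z + g z)%C.
Proof.
  intros Hf Hg B d eta HB Hd He. destruct (Hf B d (eta/2) HB Hd) as [r [Hr K]]; [lra|].
  destruct (Hg B d (eta/2) HB Hd) as [r' [Hr' K']]; [lra|].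
  exists (fun z => r z + r' z)%C. split. constructor; trivial. intros z Hz.
  replace (f z + g z - (r z + r' z))%C with ((f z - r z) + (g z - r' z))%C by ring.
  eapply Rle_trans. apply Cmod_triangle. specialize (K z Hz). specialize (K' z Hz). lra.
Qed.

Lemma approx_mult A f g : approx A f -> approx A g -> approx A (fun z => f z * g z)%C.
Proof.
  intros Hf Hg B d eta HB Hd He.
  destruct (approx_bounded A g B d HB Hd Hg) as [M [HM KM]].
  destruct (Hf B d (eta/(2 * M)) HB Hd) as [r [Hr K]]. apply Rdiv_lt_0_compat; lra.
  destruct (rat_bounded A r B d HB Hd Hr) as [N [HN KN]].
  destruct (Hg B d (eta/(2 * N)) HB Hd) as [r' [Hr' K']]. apply Rdiv_lt_0_compat; lra.
  exists (fun z => r z * r' z)%C. split. constructor; trivial. intros z Hz.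
  replace (f z * g z - (r z * r' z))%C with ((f z - r z) * g z + r z * (g z - r' z))%C by ring.
  eapply Rle_trans. apply Cmod_triangle. rewrite !Cmod_mult.
  replace eta with (eta / (2 * M) * M + N * (eta / (2 * N))) by (field; lra).
  apply Rplus_le_compat; apply Rmult_le_compat; auto using Cmod_ge_0.
Qed.

Lemma approx_const A k : approx A (fun _ => k).
Proof. apply approx_rat. constructor. Qed.
Lemma approx_id A : approx A (fun z => z).
Proof. apply approx_rat. constructor. Qed.
Lemma approx_pole A a : In a A -> approx A (fun z => / (z - a))%C.
Proof. intros. apply approx_rat. constructor; trivial. Qed.
Lemma approx_pow A f n : approx A f -> approx A (fun z => f z ^ n)%C.
Proof. intros H. induction n; simpl. apply approx_const. apply approx_mult; trivial. Qed.

Lemma approx_ext A f g : (forall z, ~ In z A -> f z = g z) -> approx A f -> approx A g.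
Proof.
  intros E H B d eta HB Hd He. destruct (H B d eta HB Hd He) as [r [Hr K]].
  exists r. split; trivial. intros z Hz. rewrite <- E; auto. intros Hi. destruct Hz as [_ Hz].
  specialize (Hz z Hi). replace (z - z)%C with (RtoC 0) in Hz by ring. rewrite Cmod_0 in Hz. lra.
Qed.

Lemma approx_limit A f : (forall B d eta, 0 < B -> 0 < d -> 0 < eta -> exists g, approx A g /\ forall z, far A B d z -> Cmod (f z - g z) <= eta) -> approx A f.
Proof.
  intros H B d eta HB Hd He. destruct (H B d (eta/2) HB Hd) as [g [Hg K]]; [lra|].
  destruct (Hg B d (eta/2) HB Hd) as [r [Hr K']]; [lra|].
  exists r. split; trivial. intros z Hz. eapply Rle_trans. apply (Cmod_dist_triangle _ (g z)).
  specialize (K z Hz). specialize (K' z Hz). lra.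
Qed.

Lemma Cpow_diff a b c n : 1 <= c -> Cmod a <= c -> Cmod b <= c ->
  Cmod (a ^ n - b ^ n) <= INR n * c ^ n * Cmod (a - b).
Proof.
  intros Hc Ha Hb. induction n.
  - simpl. replace (1 - 1)%C with (RtoC 0) by ring. rewrite Cmod_0. lra.
  - rewrite !Cpow_S. replace (a * a ^ n - b * b ^ n)%C with (a * (a ^ n - b ^ n) + (a - b) * b ^ n)%C by ring.
    eapply Rle_trans. apply Cmod_triangle. rewrite !Cmod_mult, Cmod_pow, S_INR. simpl pow.
    assert (Hbn : Cmod b ^ n <= c ^ n) by (apply pow_incr; split; trivial; apply Cmod_ge_0).
    assert (Hcn : 0 < c ^ n) by (apply pow_lt; lra).
    generalize (Cmod_ge_0 a) (Cmod_ge_0 (a - b)) (pos_INR n) (Cmod_ge_0 (a ^ n - b ^ n)). intros.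
    assert (Cmod a * Cmod (a ^ n - b ^ n) <= c * (INR n * c ^ n * Cmod (a - b))) by (apply Rmult_le_compat; trivial).
    assert (Cmod (a - b) * Cmod b ^ n <= Cmod (a - b) * (c * c ^ n)). { apply Rmult_le_compat_l; trivial. nra. }
    lra.
Qed.

Lemma exp_INR n x : exp (INR n * x) = exp x ^ n.
Proof.
  induction n. simpl. rewrite Rmult_0_l. apply exp_0.
  rewrite S_INR, Rmult_plus_distr_r, exp_plus, IHn, Rmult_1_l. simpl. ring.
Qed.

Lemma one_plus_le_exp x : 1 + x <= exp x.
Proof.
  destruct (Req_dec x 0) as [->|H]. rewrite exp_0; lra. left. apply exp_ineq1; trivial.
Qed.

(** As e^u = (e^(u/N))^N, it suffices to compare e^(u/N) with 1 + u/N, up to O(1/N^2), and to raise to the power N. *)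
Lemma Cexp_compound u M n : 0 < M -> Cmod u <= M ->
  Cmod (Cexp u - (1 + u / INR (S n)) ^ S n) <= M * M * exp (2 * M) / INR (S n).
Proof.
  intros HM Hu. set (N := INR (S n)). assert (HN : 1 <= N). { unfold N. rewrite S_INR. generalize (pos_INR n); lra. }
  assert (HN' : RtoC N <> 0%C) by apply INR_S_neq.
  set (v := (u / N)%C). assert (Hv : Cmod v = Cmod u / N). { unfold v. rewrite Cmod_div, Cmod_R, Rabs_pos_eq; trivial; lra. }
  assert (HvM : Cmod v <= M / N). { rewrite Hv. apply Rmult_le_compat_r; trivial. left; apply Rinv_0_lt_compat; lra. }
  replace (Cexp u) with (Cexp v ^ S n)%C.
  2:{ rewrite <- Cexp_INR. f_equal. fold N. unfold v. field. trivial. }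
  eapply Rle_trans. apply (Cpow_diff _ _ (exp (M / N))).
  - rewrite <- exp_0. apply exp_le. apply Rlt_le, Rdiv_lt_0_compat; lra.
  - eapply Rle_trans. apply Cmod_Cexp_le. apply exp_le; trivial.
  - eapply Rle_trans. apply Cmod_triangle. rewrite Cmod_1. eapply Rle_trans. apply one_plus_le_exp. apply exp_le; trivial.
  - rewrite <- exp_INR. fold N. replace (N * (M / N)) with M by (field; lra).
    replace (Cexp v - (1 + v))%C with (Cexp v - 1 - v)%C by ring.
    assert (E := Cexp_order2 v).
    assert (exp (Cmod v) <= exp M). { apply exp_le. eapply Rle_trans. exact HvM. apply Rle_div_l; nra. }
    replace (2 * M) with (M + M) by ring. rewrite exp_plus.
    assert (0 < exp M) by apply exp_pos. assert (0 <= Cmod v) by apply Cmod_ge_0.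
    assert (Cmod (Cexp v - 1 - v) <= exp M * (M / N) * (M / N)).
    { eapply Rle_trans. exact E. apply Rmult_le_compat; trivial. apply Rmult_le_pos; trivial. left; apply exp_pos.
      apply Rmult_le_compat; trivial. left; apply exp_pos. }
    replace (M * M * (exp M * exp M) / N) with (N * exp M * (exp M * (M / N) * (M / N))) by (field; lra).
    apply Rmult_le_compat_l; trivial. nra.
Qed.

Lemma approx_exp A f : approx A f -> approx A (fun z => Cexp (f z)).
Proof.
  intros Hf. apply approx_limit. intros B d eta HB Hd He.
  destruct (approx_bounded A f B d HB Hd Hf) as [M [HM KM]].
  destruct (nfloor_ex (M * M * exp (2 * M) / eta)) as [n [_ Hn]].
  { apply Rlt_le, Rdiv_lt_0_compat; trivial. repeat apply Rmult_lt_0_compat; trivial. apply exp_pos. }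
  exists (fun z => (1 + f z * / INR (S n)) ^ S n)%C. split.
  - apply approx_pow, approx_plus. apply approx_const. apply approx_mult; trivial. apply approx_const.
  - intros z Hz. eapply Rle_trans. apply (Cexp_compound (f z) M n HM (KM z Hz)).
    rewrite S_INR. apply Rle_div_l. generalize (pos_INR n); lra. apply Rlt_div_l in Hn; trivial. lra.
Qed.

Lemma avoid_far l A : good l -> avoids_list (supp l) A -> exists B d, 0 < B /\ 0 < d /\ forall z, supp l z -> far A B d z.
Proof.
  intros Hl HA. destruct (supp_bounded l Hl) as [B [HB KB]].
  exists B. cut (exists d, 0 < d /\ forall z, supp l z -> forall a, In a A -> d <= Cmod (z - a)).
  { intros [d [Hd K]]. exists d. repeat split; auto. }
  clear HB KB. induction A as [|a A IH].
  - exists 1. split. lra. intros z _ a [].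
  - destruct IH as [d [Hd K]]. { intros b Hb. apply HA. right; trivial. }
    destruct (supp_closed l a Hl) as [d' [Hd' K']]. { apply HA. left; trivial. }
    exists (Rmin d d'). split. apply Rmin_glb_lt; trivial. intros z Hz b [<-|Hb].
    eapply Rle_trans. apply Rmin_r. auto. eapply Rle_trans. apply Rmin_l. auto.
Qed.

Lemma cont_on_limit X f : (forall eta, 0 < eta -> exists g, cont_on X g /\ forall z, X z -> Cmod (f z - g z) <= eta) -> cont_on X f.
Proof.
  intros H z Hz e He. destruct (H (e/3)) as [g [Hg K]]; [lra|]. destruct (Hg z Hz (e/3)) as [d [Hd K']]; [lra|].
  exists d. split; trivial. intros z' Hz' Hd'. specialize (K' z' Hz' Hd').
  assert (K1 := K z Hz). assert (K2 := K z' Hz'). rewrite Cmod_minus_sym in K1.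
  eapply Rle_lt_trans. apply (Cmod_dist_triangle _ (g z')).
  eapply Rle_lt_trans. apply Rplus_le_compat_l. apply (Cmod_dist_triangle _ (g z)). lra.
Qed.

Lemma approx_cont l A f : good l -> avoids_list (supp l) A -> approx A f -> cont_on (supp l) f.
Proof.
  intros Hl HA Hf. destruct (avoid_far l A Hl HA) as [B [d [HB [Hd K]]]].
  apply cont_on_limit. intros eta He. destruct (Hf B d eta HB Hd He) as [r [Hr K']].
  exists r. split. eapply cont_on_rat; eassumption. auto.
Qed.

Lemma small_eq_0 (x : C) (k : R) : 0 <= k -> (forall eta, 0 < eta -> Cmod x <= k * eta) -> x = 0%C.
Proof.
  intros Hk H. apply Cmod_eq_0. apply Rle_antisym; [|apply Cmod_ge_0].
  apply Rnot_lt_le. intros Hx. specialize (H (Cmod x / (2 * (k + 1)))).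
  assert (0 < Cmod x / (2 * (k + 1))) by (apply Rdiv_lt_0_compat; lra). specialize (H H0).
  assert (Cmod x = Cmod x / (2 * (k + 1)) * (2 * (k + 1))) by (field; lra). nra.
Qed.

Lemma chint_minus l f g : good l -> cont_on (supp l) f -> cont_on (supp l) g ->
  chint l (fun z => f z - g z)%C = (chint l f - chint l g)%C.
Proof.
  intros Hl Hf Hg. rewrite (chint_ext l _ (fun z => f z + (-1) * g z)%C); trivial.
  - rewrite chint_plus, chint_scal; trivial. ring. apply cont_on_mult; trivial. apply cont_on_const.
  - intros; ring.
Qed.

(** Difference quotients of rational functions are rational, hence have the same integral over both chains;
this reduces Cauchy's formula to Cauchy's theorem. *)
Lemma rat_quot A f z : ~ In z A -> rat A f -> exists q, rat A q /\ forall w, ~ In w A -> (f w - f z = (w - z) * q w)%C.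
Proof.
  intros Hz. induction 1.
  - exists (fun _ => 0%C). split. constructor. intros; ring.
  - exists (fun _ => 1%C). split. constructor. intros; ring.
  - exists (fun w => - / (z - a) * / (w - a))%C. split. constructor. apply rat_const. constructor; trivial.
    intros w Hw. assert (Hn := not_in_neq A z a H Hz). assert (Hn' := not_in_neq A w a H Hw). field. auto.
  - destruct IHrat1 as [q1 [H1 K1]], IHrat2 as [q2 [H2 K2]]. exists (fun w => q1 w + q2 w)%C. split. constructor; trivial.
    intros w Hw. replace (f w + g w - (f z + g z))%C with ((f w - f z) + (g w - g z))%C by ring. rewrite K1, K2; trivial. ring.
  - destruct IHrat1 as [q1 [H1 K1]], IHrat2 as [q2 [H2 K2]]. exists (fun w => q1 w * g w + f z * q2 w)%C.
    split. constructor. constructor; trivial. constructor. constructor. trivial.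
    intros w Hw. replace (f w * g w - f z * g z)%C with ((f w - f z) * g w + f z * (g w - g z))%C by ring. rewrite K1, K2; trivial. ring.
Qed.

(** Cauchy's theorem in homological form. *)
Lemma cauchy_eq l1 l2 A f : good l1 -> good l2 -> closed_chain l1 -> closed_chain l2 ->
  avoids_list (supp l1) A -> avoids_list (supp l2) A ->
  (forall a, In a A -> index l1 a = index l2 a) ->
  approx A f -> chint l1 f = chint l2 f.
Proof.
  intros G1 G2 C1 C2 A1 A2 HW Hf. destruct (avoid_far (l1 ++ l2) A (good_app _ _ G1 G2)) as [B [d [HB [Hd K]]]].
  { intros a Ha Hs. apply supp_app in Hs. destruct Hs as [Hs|Hs]; [apply (A1 a Ha Hs)|apply (A2 a Ha Hs)]. }
  destruct (chint_bound l1 G1) as [M1 [HM1 K1]]. destruct (chint_bound l2 G2) as [M2 [HM2 K2]].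
  apply Ceq_minus. apply (small_eq_0 _ (M1 + M2)). lra. intros eta He.
  destruct (Hf B d eta HB Hd He) as [r [Hr Kr]].
  assert (E := chint_rat l1 l2 A r G1 G2 C1 C2 A1 A2 HW Hr).
  replace (chint l1 f - chint l2 f)%C with ((chint l1 f - chint l1 r) - (chint l2 f - chint l2 r))%C by (rewrite E; ring).
  rewrite <- !chint_minus; eauto using approx_cont, cont_on_rat.
  eapply Rle_trans. apply Cmod_triangle_minus.
  assert (Cmod (chint l1 (fun z => f z - r z)%C) <= M1 * eta).
  { apply K1. lra. apply cont_on_minus; eauto using approx_cont, cont_on_rat. intros z Hz. apply Kr, K, supp_app; auto. }
  assert (Cmod (chint l2 (fun z => f z - r z)%C) <= M2 * eta).
  { apply K2. lra. apply cont_on_minus; eauto using approx_cont, cont_on_rat. intros z Hz. apply Kr, K, supp_app; auto. }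
  lra.
Qed.

(** Cauchy's formula in homological form.  With r a rational approximation of f, split f(w)/(w - z) as
(f - r)(w)/(w - z), which is small, plus the rational quotient (r(w) - r(z))/(w - z), to which Cauchy's theorem applies, plus
r(z)/(w - z), which yields the winding number. *)
Lemma cauchy_diff l1 l2 A f z : good l1 -> good l2 -> closed_chain l1 -> closed_chain l2 ->
  avoids_list (supp l1) A -> avoids_list (supp l2) A ->
  (forall a, In a A -> index l1 a = index l2 a) ->
  approx A f -> ~ In z A -> ~ supp l1 z -> ~ supp l2 z ->
  (chint l1 (fun w => f w * / (w - z)) - chint l2 (fun w => f w * / (w - z)) = f z * (index l1 z - index l2 z))%C.
Proof.
  intros G1 G2 C1 C2 A1 A2 HW Hf Hz S1 S2.
  assert (Gz : good (seg z z :: nil)) by apply good_1, good_seg.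
  destruct (avoid_far (l1 ++ l2 ++ seg z z :: nil) A) as [B [d [HB [Hd K]]]].
  { apply good_app; trivial. apply good_app; trivial. }
  { intros a Ha Hs. apply supp_app in Hs. destruct Hs as [Hs|Hs]; [apply (A1 a Ha Hs)|].
    apply supp_app in Hs. destruct Hs as [Hs|Hs]; [apply (A2 a Ha Hs)|].
    apply supp_1 in Hs. destruct Hs as [s [_ ->]]. apply Hz. simpl in Ha.
    replace (z + s * (z - z))%C with z in Ha by ring. trivial. }
  assert (Kz : far A B d z). { apply K. rewrite !supp_app. right; right. apply supp_1. exists 0. split. simpl; lra. symmetry. apply seg_start. }
  assert (Kl1 : forall w, supp l1 w -> far A B d w). { intros w Hw. apply K. rewrite !supp_app. auto. }
  assert (Kl2 : forall w, supp l2 w -> far A B d w). { intros w Hw. apply K. rewrite !supp_app. auto. }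
  assert (P1 := cont_on_pole _ _ S1). assert (P2 := cont_on_pole _ _ S2).
  destruct (chint_bound l1 G1) as [M1 [HM1 K1]]. destruct (chint_bound l2 G2) as [M2 [HM2 K2]].
  destruct (supp_closed l1 z G1 S1) as [d1 [Hd1 D1]]. destruct (supp_closed l2 z G2 S2) as [d2 [Hd2 D2]].
  apply Ceq_minus. apply (small_eq_0 _ (M1 / d1 + M2 / d2 + Cmod (index l1 z - index l2 z))).
  { generalize (Cmod_ge_0 (index l1 z - index l2 z)) (Rdiv_lt_0_compat _ _ HM1 Hd1) (Rdiv_lt_0_compat _ _ HM2 Hd2). lra. }
  intros eta He.
  destruct (Hf B d eta HB Hd He) as [r [Hr Kr]].
  destruct (rat_quot A r z Hz Hr) as [q [Hq Eq]].
  assert (E := chint_rat l1 l2 A q G1 G2 C1 C2 A1 A2 HW Hq).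
  assert (Dec : forall l, good l -> avoids_list (supp l) A -> ~ supp l z ->
    chint l (fun w => f w * / (w - z))%C = (chint l (fun w => (f w - r w) * / (w - z)) + chint l q + r z * index l z)%C).
  { intros l Gl Al Sl. assert (Pl := cont_on_pole _ _ Sl).
    assert (Cf : cont_on (supp l) f) by eauto using approx_cont. assert (Cr : cont_on (supp l) r) by eauto using cont_on_rat.
    assert (Cq : cont_on (supp l) q) by eauto using cont_on_rat.
    unfold index. rewrite <- chint_scal, <- !chint_plus; trivial; cont.
    apply chint_ext; trivial. intros w Hw.
    assert (Hn : (w - z <> 0)%C). { intros E0. apply Ceq_minus in E0. subst. auto. }
    assert (E1 := Eq w (avoids_not_in _ _ _ Al Hw)).
    replace (q w) with ((r w - r z) * / (w - z))%C by (rewrite E1; field; trivial). field. trivial. }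
  rewrite (Dec l1), (Dec l2); trivial. rewrite E.
  match goal with |- Cmod ?x <= _ => replace x with
    ((chint l1 (fun w => (f w - r w) * / (w - z)) - chint l2 (fun w => (f w - r w) * / (w - z))) - (f z - r z) * (index l1 z - index l2 z))%C by ring end.
  eapply Rle_trans. apply Cmod_triangle_minus. rewrite Cmod_mult.
  assert (Bd : forall l M dl, good l -> avoids_list (supp l) A -> ~ supp l z -> 0 < dl -> (forall w, supp l w -> dl <= Cmod (w - z)) ->
     (forall w, supp l w -> far A B d w) -> 0 < M ->
    (forall f B, 0 <= B -> cont_on (supp l) f -> (forall z, supp l z -> Cmod (f z) <= B) -> Cmod (chint l f) <= M * B) ->
    Cmod (chint l (fun w => (f w - r w) * / (w - z))%C) <= M / dl * eta).
  { intros l M dl Gl Al Sl Hdl Dl Fl HM KM. assert (Pl := cont_on_pole _ _ Sl).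
    assert (Cf : cont_on (supp l) f) by eauto using approx_cont. assert (Cr : cont_on (supp l) r) by eauto using cont_on_rat.
    replace (M / dl * eta) with (M * (eta * / dl)) by (field; lra). apply KM; cont.
    { apply Rmult_le_pos. lra. left; apply Rinv_0_lt_compat; trivial. }
    intros w Hw. rewrite Cmod_mult. specialize (Dl w Hw).
    apply Rmult_le_compat; try apply Cmod_ge_0; auto.
    rewrite Cmod_inv. apply Rinv_le_contravar; trivial. intros E0. rewrite E0, Cmod_0 in Dl. lra. }
  assert (B1 := Bd l1 M1 d1 G1 A1 S1 Hd1 D1 Kl1 HM1 K1). assert (B2 := Bd l2 M2 d2 G2 A2 S2 Hd2 D2 Kl2 HM2 K2).
  assert (B3 := Kr z Kz).
  assert (Cmod (f z - r z) * Cmod (index l1 z - index l2 z) <= eta * Cmod (index l1 z - index l2 z)) by (apply Rmult_le_compat_r; trivial; apply Cmod_ge_0).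
  assert (Tr := Cmod_triangle_minus (chint l1 (fun w => (f w - r w) * / (w - z))%C) (chint l2 (fun w => (f w - r w) * / (w - z))%C)).
  lra.
Qed.

(** * Winding numbers *)

(** Quadratically small increments force a zero derivative; this avoids computing any derivative of an
integral with respect to a parameter. *)
Lemma flat_const_R (r : R -> R) a b : a <= b ->
  (forall u, a <= u <= b -> exists k d, 0 <= k /\ 0 < d /\ forall v, a <= v <= b -> Rabs (v - u) < d ->
     Rabs (r v - r u) <= k * (v - u) ^ 2) -> r b = r a.
Proof.
  intros Hab H. destruct (Rle_lt_or_eq_dec a b Hab) as [Hlt|<-]; trivial.
  assert (E : r (clamp a b a) = r (clamp a b b)).
  { apply (eq_is_derive (fun s => r (clamp a b s)) a b); trivial.
    intros u Hu. apply is_derive_Reals. intros e He.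
    destruct (H u Hu) as [k [d [Hk [Hd K]]]].
    assert (Hm : 0 < Rmin d (e / (k + 1))). { apply Rmin_glb_lt; trivial. apply Rdiv_lt_0_compat; lra. }
    exists (mkposreal _ Hm). intros h Hh0 Hh. simpl in Hh.
    destruct (Rmin_Rgt_l _ _ _ Hh) as [H1 H2].
    assert (Hc := clamp_lip a b (u + h) u). replace (u + h - u) with h in Hc by ring.
    rewrite (clamp_id a b u) in * by lra.
    specialize (K (clamp a b (u + h)) (clamp_in a b _ Hab) ltac:(lra)).
    change (Rabs ((r (clamp a b (u + h)) - r u) / h - 0) < e).
    rewrite Rminus_0_r. unfold Rdiv. rewrite Rabs_mult, Rabs_inv.
    assert (Hp : 0 < Rabs h) by (apply Rabs_pos_lt; trivial).
    apply Rlt_div_l; trivial.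
    assert ((clamp a b (u + h) - u) ^ 2 <= Rabs h ^ 2).
    { rewrite <- (pow2_abs (clamp a b (u + h) - u)). apply pow_incr. split; trivial. apply Rabs_pos. }
    assert (Rabs (r (clamp a b (u + h)) - r u) <= k * Rabs h ^ 2) by nra.
    assert (Rabs h * (k + 1) < e) by (apply Rlt_div_r; lra). nra. }
  rewrite !clamp_id in E by lra. auto.
Qed.

Lemma flat_const (r : R -> C) a b : a <= b ->
  (forall u, a <= u <= b -> exists k d, 0 <= k /\ 0 < d /\ forall v, a <= v <= b -> Rabs (v - u) < d ->
     Cmod (r v - r u) <= k * (v - u) ^ 2) -> r b = r a.
Proof.
  intros Hab H. apply C_ext.
  - apply (flat_const_R (fun s => Re (r s))); trivial. intros u Hu. destruct (H u Hu) as [k [d [Hk [Hd K]]]].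
    exists k, d. repeat split; trivial. intros v Hv Hvd. rewrite <- re_minus. eapply Rle_trans. apply re_le_Cmod. auto.
  - apply (flat_const_R (fun s => Im (r s))); trivial. intros u Hu. destruct (H u Hu) as [k [d [Hk [Hd K]]]].
    exists k, d. repeat split; trivial. intros v Hv Hvd. rewrite <- im_minus. eapply Rle_trans. apply im_le_Cmod. auto.
Qed.

Definition flat (phi : C -> C) (p : C) : Prop :=
  exists k d, 0 <= k /\ 0 < d /\ forall q, Cmod (q - p) < d -> Cmod (phi q - phi p) <= k * Cmod (q - p) ^ 2.

Lemma flat_curve phi (g : R -> C) a b : a <= b -> (forall s, a <= s <= b -> exists d, cder g s d) ->
  (forall s, a <= s <= b -> flat phi (g s)) -> phi (g b) = phi (g a).
Proof.
  intros Hab Hg H. apply (flat_const (fun s => phi (g s))); trivial. intros u Hu.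
  destruct (H u Hu) as [k [d [Hk [Hd K]]]]. destruct (Hg u Hu) as [D HD].
  destruct (cder_lip _ _ _ HD) as [e [He L]]. set (l := (Cmod D + 1) * 2) in *.
  assert (Hl : 0 < l) by (unfold l; generalize (Cmod_ge_0 D); lra).
  exists (k * l ^ 2), (Rmin e (d / l)). split. apply Rmult_le_pos; trivial. nra.
  split. apply Rmin_glb_lt; trivial. apply Rdiv_lt_0_compat; trivial.
  intros v Hv Hvd.
  destruct (Rmin_Rgt_l _ _ _ Hvd) as [H1 H2].
  specialize (L v H1).
  assert (Cmod (g v - g u) < d). { eapply Rle_lt_trans. exact L. rewrite Rmult_comm. apply Rlt_div_r; trivial. }
  eapply Rle_trans. apply K; trivial. rewrite Rmult_assoc. apply Rmult_le_compat_l; trivial.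
  rewrite <- (pow2_abs (v - u)), <- Rpow_mult_distr. apply pow_incr. split; trivial. apply Cmod_ge_0.
Qed.

Lemma flat_seg phi p q : (forall z, psupp (seg p q) z -> flat phi z) -> phi q = phi p.
Proof.
  intros H. assert (E : phi (pg (seg p q) (pb (seg p q))) = phi (pg (seg p q) (pa (seg p q)))).
  2:{ rewrite seg_start, seg_end in E. exact E. }
  apply flat_curve. simpl; lra.
  - intros s Hs. eexists. apply seg_cder.
  - intros s Hs. apply H. exists s; auto.
Qed.

Lemma flat_piecewise phi c a b : piecewise_C1 c a b -> (forall s, a <= s <= b -> flat phi (c s)) ->
  forall s, a <= s <= b -> phi (c s) = phi (c a).
Proof.
  intros Hc. cut (a < b /\ ((forall s, a <= s <= b -> flat phi (c s)) -> forall s, a <= s <= b -> phi (c s) = phi (c a))).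
  { tauto. }
  induction Hc as [a b g dg Hab Hg _ E | a b d _ [Hab IH1] _ [Hbd IH2]].
  - split; trivial. intros H s Hs. rewrite !E by lra. apply (flat_curve phi g). lra.
    + intros r Hr. exists (dg r). apply cder_of_is_derive, Hg.
    + intros r Hr. rewrite <- E by lra. apply H. lra.
  - split. lra. intros H s Hs.
    destruct (Rle_dec s b). apply IH1; try lra. intros; apply H; lra.
    rewrite (IH2 ltac:(intros; apply H; lra) s) by lra. apply IH1; try lra. intros; apply H; lra.
Qed.

(** The derivative of the index with respect to p is the integral of (z - p)^(-2), which vanishes as this has a primitive; a second
order expansion of the Cauchy kernel bounds the remainder. *)
Lemma flat_index l p : good l -> closed_chain l -> ~ supp l p -> flat (index l) p.
Proof.
  intros Gl Cl Hp. destruct (supp_closed l p Gl Hp) as [d [Hd D]]. destruct (chint_bound l Gl) as [M [HM K]].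
  exists (M * (2 / (d * d * d))), (d / 2). split. { apply Rmult_le_pos. lra. apply Rlt_le, Rdiv_lt_0_compat. lra. repeat apply Rmult_lt_0_compat; lra. } split. lra.
  intros q Hq.
  assert (Dq : forall z, supp l z -> d / 2 <= Cmod (z - q)).
  { intros z Hz. specialize (D z Hz). assert (T := Cmod_dist_triangle z q p). lra. }
  assert (Sq : ~ supp l q). { intros Hs. specialize (Dq q Hs). replace (q - q)%C with (RtoC 0) in Dq by ring. rewrite Cmod_0 in Dq. lra. }
  assert (Pp := cont_on_pole _ _ Hp). assert (Pq := cont_on_pole _ _ Sq).
  assert (Np : forall z, supp l z -> (z - p <> 0)%C). { intros z Hz E. apply Ceq_minus in E. subst; auto. }
  assert (Nq : forall z, supp l z -> (z - q <> 0)%C). { intros z Hz E. apply Ceq_minus in E. subst; auto. }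
  unfold index. rewrite <- chint_minus; trivial.
  assert (E0 : chint l (fun z => / (z - p) * / (z - p))%C = 0%C).
  { apply (closed_FTC l (fun z => (-1) * / (z + - p))%C); trivial; cont.
    intros z Hz. eapply cprim_ext2. 3: apply cprim_scal, cprim_inv; [apply cprim_plus; [apply cprim_id | apply cprim_const]|].
    intros; reflexivity. simpl. change (z - p)%C with (z + - p)%C. field. apply (Np z Hz). apply (Np z Hz). }
  assert (E1 : chint l (fun z => / (z - q) - / (z - p))%C = chint l (fun z => (q - p) * (q - p) * (/ (z - p) * / (z - p) * / (z - q)))%C).
  { rewrite (chint_ext l _ (fun z => (q - p) * (/ (z - p) * / (z - p)) + (q - p) * (q - p) * (/ (z - p) * / (z - p) * / (z - q)))%C); trivial.
    - rewrite chint_plus, (chint_scal l (q - p)%C), E0; cont. ring.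
    - intros z Hz. field. auto. }
  rewrite E1. replace (M * (2 / (d * d * d)) * Cmod (q - p) ^ 2) with (M * (Cmod (q - p) * Cmod (q - p) * (/ d * / d * / (d / 2)))) by (field; lra).
  assert (0 < / d) by (apply Rinv_0_lt_compat; lra). assert (0 < / (d / 2)) by (apply Rinv_0_lt_compat; lra).
  generalize (Cmod_ge_0 (q - p)). intros.
  apply K; cont. { repeat apply Rmult_le_pos; lra. }
  intros z Hz. rewrite !Cmod_mult.
  assert (Cmod (/ (z - p)) <= / d). { rewrite Cmod_inv by auto. apply Rinv_le_contravar; auto. }
  assert (Cmod (/ (z - q)) <= / (d / 2)). { rewrite Cmod_inv by auto. apply Rinv_le_contravar; auto. lra. }
  generalize (Cmod_ge_0 (/ (z - p))) (Cmod_ge_0 (/ (z - q))). intros.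
  apply Rmult_le_compat_l. nra. apply Rmult_le_compat; trivial. nra. apply Rmult_le_compat; trivial.
Qed.

Lemma index_seg l p q : good l -> closed_chain l -> (forall z, psupp (seg p q) z -> ~ supp l z) -> index l q = index l p.
Proof. intros Gl Cl H. apply flat_seg. intros z Hz. apply flat_index; auto. Qed.

(** The index is constant along the ray and tends to 0 at infinity. *)
Lemma index_ray l q (e : C) : good l -> closed_chain l -> e <> 0%C -> (forall t, 0 <= t -> ~ supp l (q + t * e)%C) -> index l q = 0%C.
Proof.
  intros Gl Cl He H. destruct (supp_bounded l Gl) as [B [HB KB]]. destruct (chint_bound l Gl) as [M [HM K]].
  assert (Hm : 0 < Cmod e) by (apply Cmod_gt_0; exact He).
  apply (small_eq_0 _ M). lra. intros eta Heta.
  set (t := (B + Cmod q + / eta) / Cmod e).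
  assert (Hie : 0 < / eta) by (apply Rinv_0_lt_compat; trivial).
  assert (Ht : 0 < t). { apply Rdiv_lt_0_compat; trivial. generalize (Cmod_ge_0 q). lra. }
  rewrite <- (index_seg l q (q + t * e)%C); trivial.
  2:{ intros z [s [Hs ->]]. simpl in *. replace (q + s * (q + t * e - q))%C with (q + (s * t)%R * e)%C by (rewrite RtoC_mult; ring).
      apply H. apply Rmult_le_pos; lra. }
  assert (Sq : ~ supp l (q + t * e)%C) by (apply H; lra).
  apply K; [lra | apply cont_on_pole; trivial |].
  intros z Hz.
  assert (/ eta <= Cmod (z - (q + t * e))).
  { specialize (KB z Hz). assert (T := Cmod_triangle_rev (t * e) (z - q)).
    replace (t * e - (z - q))%C with (- (z - (q + t * e)))%C in T by ring. rewrite Cmod_opp in T.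
    assert (T2 := Cmod_triangle_minus z q). rewrite Cmod_mult, Cmod_R, Rabs_pos_eq in T by lra.
    assert (t * Cmod e = B + Cmod q + / eta) by (unfold t; field; lra). lra. }
  rewrite Cmod_inv. rewrite <- (Rinv_inv eta). apply Rinv_le_contravar; trivial.
  intros E. rewrite E, Cmod_0 in H0. lra.
Qed.

(** A ray leaving the half-plane avoids the chain. *)
Lemma index_halfplane l q (e : C) : good l -> closed_chain l -> e <> 0%C -> (forall z, supp l z -> 0 < Re (e * (z - q))) -> index l q = 0%C.
Proof.
  intros Gl Cl He H. apply (index_ray l q (- Cconj e)); trivial.
  - intros E. apply He. rewrite <- (Cconj_conj e). replace (Cconj e) with (RtoC 0). apply C_ext; simpl; ring.
    rewrite <- (Copp_0). rewrite <- E. ring.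
  - intros t Ht Hs. specialize (H _ Hs).
    replace (e * (q + t * - Cconj e - q))%C with (RtoC (- t) * (e * Cconj e))%C in H by (rewrite RtoC_opp; ring).
    rewrite re_scal_l, re_mult, re_conj, im_conj in H. nra.
Qed.

Definition square (c : C) (h : R) : chain :=
  seg (c + h * (1 - Ci)) (c + h * (1 + Ci)) ::
  seg (c + h * (1 + Ci)) (c + h * (-1 + Ci)) ::
  seg (c + h * (-1 + Ci)) (c + h * (-1 - Ci)) ::
  seg (c + h * (-1 - Ci)) (c + h * (1 - Ci)) :: nil.

Lemma good_square c h : good (square c h).
Proof. intros p [<-|[<-|[<-|[<-|[]]]]]; apply good_seg. Qed.

Lemma closed_square c h : closed_chain (square c h).
Proof. intros G. unfold square, boundary, fold_right. rewrite !seg_start, !seg_end. ring. Qed.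

Lemma supp_square c h z : 0 <= h -> supp (square c h) z ->
  (Re z - Re c = h \/ Re z - Re c = - h \/ Im z - Im c = h \/ Im z - Im c = - h) /\
  Rabs (Re z - Re c) <= h /\ Rabs (Im z - Im c) <= h.
Proof.
  intros Hh [p [[<-|[<-|[<-|[<-|[]]]]] [s [Hs ->]]]]; simpl in *; destruct c as [x y]; simpl;
  (split; [|split; apply Rabs_le; nra]).
  - left. ring.
  - right; right; left. ring.
  - right; left. ring.
  - right; right; right. ring.
Qed.

(** Up to the similarity z -> c + h om z, which preserves dz/z, each side is 1 + (2 s - 1) i with 0 <= s <= 1, along which
1/z has the primitive (ln |z|, arg z) with arg z = atan (2 s - 1). *)
Lemma pint_quarter (c : C) (h : R) (om : C) : h <> 0 -> om <> 0%C ->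
  pint (seg (c + h * (om * (1 - Ci))) (c + h * (om * (1 + Ci)))) (fun z => / (z - c))%C = (0, PI / 2).
Proof.
  intros Hh Ho. apply cis_int_cint.
  set (F := fun s : R => (ln (1 + (2 * s - 1) ^ 2) / 2, atan (2 * s - 1)) : C).
  set (f := fun s : R => (2 * (2 * s - 1) / (1 + (2 * s - 1) ^ 2), 2 / (1 + (2 * s - 1) ^ 2)) : C).
  assert (E : cis_int f 0 1 (F 1 - F 0)%C).
  { apply cis_int_FTC. lra.
    - intros s _. split; simpl.
      + auto_derive. nra. field. nra.
      + auto_derive. trivial. unfold Rsqr. field. nra.
    - intros s _. split; simpl; apply (ex_derive_continuous (V := R_NormedModule)); auto_derive; nra. }
  replace (F 1 - F 0)%C with ((0, PI / 2) : C) in E.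
  - eapply cis_int_ext; [simpl; lra| |exact E]. intros s _. simpl pg; simpl pd.
    assert (Hn : (1 + (2 * s - 1) * Ci <> 0)%C).
    { intros E0. apply (f_equal Re) in E0. simpl in E0. lra. }
    assert (Ef : f s = (2 * Ci * / (1 + (2 * s - 1) * Ci))%C).
    { unfold f. apply C_ext; simpl; field; nra. }
    assert (Hh' : RtoC h <> 0%C) by (intros E0; apply RtoC_inj in E0; auto).
    rewrite Ef.
    replace (c + h * (om * (1 - Ci)) + s * (c + h * (om * (1 + Ci)) - (c + h * (om * (1 - Ci)))) - c)%C with
     (h * om * (1 + (2 * s - 1) * Ci))%C by ring. field. auto.
  - unfold F. apply C_ext; simpl. field_simplify. replace (1 + ((2 * 1 - 1) * ((2 * 1 - 1) * 1))) with (1 + ((2 * 0 - 1) * ((2 * 0 - 1) * 1))) by ring.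
    field.
    replace (2 * 1 - 1) with 1 by ring. replace (2 * 0 - 1) with (- (1)) by ring. rewrite atan_opp, atan_1. field.
Qed.

Lemma index_square_center c h : 0 < h -> index (square c h) c = two_pi_i.
Proof.
  intros Hh. unfold index, square, chint, fold_right.
  assert (Q : forall om p q : C, om <> 0%C -> p = (c + h * (om * (1 - Ci)))%C -> q = (c + h * (om * (1 + Ci)))%C ->
    pint (seg p q) (fun z => / (z - c))%C = (0, PI / 2)).
  { intros om p q Ho -> ->. apply pint_quarter; trivial. lra. }
  assert (Ni : Ci <> 0%C) by apply Ci_nz.
  rewrite (Q 1%C), (Q Ci), (Q (-1)%C), (Q (- Ci)%C).
  - unfold two_pi_i. apply C_ext; simpl; field.
  - intros E. apply Ni. rewrite <- Copp_0, <- E. ring.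
  - apply C_ext; simpl; ring.
  - apply C_ext; simpl; ring.
  - intros E. apply (f_equal Re) in E. simpl in E. lra.
  - apply C_ext; simpl; ring.
  - apply C_ext; simpl; ring.
  - trivial.
  - apply C_ext; simpl; ring.
  - apply C_ext; simpl; ring.
  - apply C1_nz.
  - apply C_ext; simpl; ring.
  - apply C_ext; simpl; ring.
Qed.

Lemma index_square_in c h q : 0 < h -> Rabs (Re q - Re c) < h -> Rabs (Im q - Im c) < h -> index (square c h) q = two_pi_i.
Proof.
  intros Hh H1 H2. rewrite <- (index_square_center c h Hh). apply index_seg. apply good_square. apply closed_square.
  intros z [s [Hs ->]] Hz. apply supp_square in Hz; [|lra]. destruct Hz as [Hz _]. simpl in *. destruct c as [x y], q as [u v]; simpl in *.
  apply Rabs_def2 in H1. apply Rabs_def2 in H2. destruct Hz as [Hz|[Hz|[Hz|Hz]]]; nra.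
Qed.

Lemma index_square_out c h q : 0 < h -> h < Rabs (Re q - Re c) \/ h < Rabs (Im q - Im c) -> index (square c h) q = 0%C.
Proof.
  intros Hh H.
  assert (Cases : h < Re q - Re c \/ h < Re c - Re q \/ h < Im q - Im c \/ h < Im c - Im q).
  { unfold Rabs in H. destruct H as [H|H]; destruct Rcase_abs in H; lra. }
  assert (B : forall z, supp (square c h) z -> - h <= Re z - Re c <= h /\ - h <= Im z - Im c <= h).
  { intros z Hz. apply supp_square in Hz; [|lra]. destruct Hz as [_ [H1 H2]]. apply Rabs_le_between in H1. apply Rabs_le_between in H2. lra. }
  assert (G := good_square c h). assert (Cl := closed_square c h).
  destruct Cases as [K|[K|[K|K]]].
  - apply (index_halfplane _ _ (-1)%C); trivial. { intros E. apply (f_equal Re) in E. simpl in E. lra. }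
    intros z Hz. specialize (B z Hz). destruct z, q, c; simpl in *. lra.
  - apply (index_halfplane _ _ 1%C); trivial. apply C1_nz.
    intros z Hz. specialize (B z Hz). destruct z, q, c; simpl in *. lra.
  - apply (index_halfplane _ _ Ci); trivial. apply Ci_nz.
    intros z Hz. specialize (B z Hz). destruct z, q, c; simpl in *. lra.
  - apply (index_halfplane _ _ (- Ci)%C); trivial. { intros E. apply (f_equal Im) in E. simpl in E. lra. }
    intros z Hz. specialize (B z Hz). destruct z, q, c; simpl in *. lra.
Qed.

(** * Double integrals with a Cauchy kernel *)

(** The Cauchy integral of F over k, with the sign of the kernels under study. *)
Notation cauchy_int k F w := (chint k (fun z => F z * / (w - z))%C).

Lemma cont_on_bounded l f : good l -> cont_on (supp l) f -> exists M, 0 < M /\ forall z, supp l z -> Cmod (f z) <= M.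
Proof.
  induction l as [|p l IH]; intros Gl Hf.
  - exists 1. split. lra. intros z [q [[] _]].
  - destruct (IH (good_tl _ _ Gl) (cont_on_cons_tl _ _ _ Hf)) as [M [HM K]].
    assert (Hp := good_hd _ _ Gl). assert (Hlt : pa p < pb p) by apply Hp.
    destruct (ccont_bounded (fun s => f (pg p (clamp (pa p) (pb p) s))) (pa p) (pb p)) as [D [HD KD]]. lra.
    { intros s Hs. apply (ccont_comp_on (psupp p) f (fun r => pg p (clamp (pa p) (pb p) r))).
      - eauto using cont_on_cons_hd.
      - intros r. exists (clamp (pa p) (pb p) r). split; trivial. apply clamp_in. lra.
      - apply ccont_clamp. lra. intros r Hr. apply good_piece_ccont; assumption. }
    exists (M + D). split. lra. intros z [q [[<-|Hq] Hz]].
    + destruct Hz as [s [Hs ->]]. specialize (KD s Hs). cbv beta in KD. rewrite clamp_id in KD by lra. lra.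
    + assert (Cmod (f z) <= M) by (apply K; exists q; auto). lra.
Qed.

Lemma kernel_lip (w w0 z : C) d : 0 < d -> d <= Cmod (z - w0) -> Cmod (w - w0) < d / 2 ->
  (w - z <> 0)%C /\ (w0 - z <> 0)%C /\ Cmod (/ (w - z) - / (w0 - z)) <= 2 / (d * d) * Cmod (w - w0).
Proof.
  intros Hd Hz Hw.
  assert (H1 : d / 2 <= Cmod (w - z)).
  { rewrite Cmod_minus_sym. assert (T := Cmod_dist_triangle z w w0). lra. }
  assert (H2 : d <= Cmod (w0 - z)) by (rewrite Cmod_minus_sym; trivial).
  assert (N1 : (w - z <> 0)%C) by (intros E; rewrite E, Cmod_0 in H1; lra).
  assert (N2 : (w0 - z <> 0)%C) by (intros E; rewrite E, Cmod_0 in H2; lra).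
  repeat split; trivial. rewrite Cinv_diff; trivial. rewrite Cmod_div by (apply Cmult_neq_0; trivial).
  replace (w0 - z - (w - z))%C with (w0 - w)%C by ring. rewrite (Cmod_minus_sym w0 w), Cmod_mult.
  unfold Rdiv. rewrite Rmult_comm. apply Rmult_le_compat_r. apply Cmod_ge_0.
  replace (2 * / (d * d)) with (/ (d / 2 * d)) by (field; lra). apply Rinv_le_contravar. nra.
  apply Rmult_le_compat; lra.
Qed.

Lemma cont_on_kernel k psi w : cont_on (supp k) psi -> ~ supp k w -> cont_on (supp k) (fun z => psi z * / (w - z))%C.
Proof.
  intros Hp Hw. cont. apply cont_on_inv; cont. intros z Hz E. apply Hw. apply Ceq_minus in E. subst. trivial.
Qed.

Lemma kernel_int_lip k psi w0 : good k -> cont_on (supp k) psi -> ~ supp k w0 ->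
  exists K d, 0 <= K /\ 0 < d /\ forall w, Cmod (w - w0) < d ->
    ~ supp k w /\ Cmod (cauchy_int k psi w - cauchy_int k psi w0)%C <= K * Cmod (w - w0).
Proof.
  intros Gk Hp H0. destruct (supp_closed k w0 Gk H0) as [d [Hd D]]. destruct (chint_bound k Gk) as [M [HM K]].
  destruct (cont_on_bounded k psi Gk Hp) as [N [HN KN]].
  exists (M * (N * (2 / (d * d)))), (d / 2).
  assert (0 < 2 / (d * d)) by (apply Rdiv_lt_0_compat; nra).
  split. repeat apply Rmult_le_pos; lra. split. lra.
  intros w Hw.
  assert (Sw : ~ supp k w). { intros Hs. destruct (kernel_lip w w0 w d Hd (D w Hs) Hw) as [E _]. apply E. ring. }
  split; trivial. rewrite <- chint_minus; auto using cont_on_kernel.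
  assert (Hc := Cmod_ge_0 (w - w0)).
  replace (M * (N * (2 / (d * d))) * Cmod (w - w0)) with (M * (N * (2 / (d * d) * Cmod (w - w0)))) by ring.
  apply K. repeat apply Rmult_le_pos; lra. apply cont_on_minus; auto using cont_on_kernel.
  intros z Hz. replace (psi z * / (w - z) - psi z * / (w0 - z))%C with (psi z * (/ (w - z) - / (w0 - z)))%C by ring.
  rewrite Cmod_mult. apply Rmult_le_compat; auto using Cmod_ge_0.
  apply (kernel_lip w w0 z d Hd (D z Hz) Hw).
Qed.

Lemma kernel_int_cont (X : C -> Prop) k psi : good k -> cont_on (supp k) psi -> (forall w, X w -> ~ supp k w) ->
  cont_on X (fun w => cauchy_int k psi w)%C.
Proof.
  intros Gk Hp HX w0 H0 e He. destruct (kernel_int_lip k psi w0 Gk Hp (HX w0 H0)) as [K [d [HK [Hd L]]]].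
  exists (Rmin d (e / (K + 1))). split. { apply Rmin_glb_lt; trivial. apply Rdiv_lt_0_compat; lra. }
  intros w _ Hw. destruct (Rmin_Rgt_l _ _ _ Hw) as [H1 H2].
  eapply Rle_lt_trans. apply (L w H1). apply Rlt_div_r in H2; [|lra]. generalize (Cmod_ge_0 (w - w0)). nra.
Qed.

Lemma kernel_int_cont_r (X : C -> Prop) l phi : good l -> cont_on (supp l) phi -> (forall z, X z -> ~ supp l z) ->
  cont_on X (fun z => chint l (fun w => phi w * / (w - z)))%C.
Proof.
  intros Gl Hp HX. apply (cont_on_ext X (fun z => (-1) * chint l (fun w => phi w * / (z - w)))%C).
  - intros z Hz. rewrite <- chint_scal; auto using cont_on_kernel. apply chint_ext; trivial.
    intros w Hw. assert ((w - z <> 0)%C). { intros E. apply Ceq_minus in E. subst. apply (HX z Hz Hw). }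
    assert ((z - w <> 0)%C). { intros E. apply Ceq_minus in E. subst. apply (HX w Hz Hw). }
    field. auto.
  - apply cont_on_mult. apply cont_on_const. apply kernel_int_cont; trivial.
Qed.

Definition subpiece (p : piece) (a b : R) : piece := mkpiece (pg p) (pd p) a b.

Lemma good_subpiece p a b : good_piece p -> pa p <= a -> a < b -> b <= pb p -> good_piece (subpiece p a b).
Proof. intros [_ H] H1 H2 H3. split. exact H2. simpl. intros s Hs. apply H. lra. Qed.

Lemma psupp_subpiece p a b z : pa p <= a -> b <= pb p -> psupp (subpiece p a b) z -> psupp p z.
Proof. intros H1 H2 [s [Hs E]]. simpl in *. exists s. split; trivial. lra. Qed.

Lemma pint_bound_on p f a b D B : good_piece p -> cont_on (psupp p) f -> pa p <= a -> a <= b -> b <= pb p ->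
  0 <= B -> (forall s, pa p <= s <= pb p -> Cmod (pd p s) <= D) -> (forall s, a <= s <= b -> Cmod (f (pg p s)) <= B) ->
  Cmod (cint (fun s => f (pg p s) * pd p s)%C a b) <= B * D * (b - a).
Proof.
  intros Hp Hf H1 H2 H3 HB HD Hs. eapply cis_int_bound; [exact H2| | apply (piece_int_sub p f a b); trivial].
  intros s Hs'. cbv beta. rewrite Cmod_mult. apply Rmult_le_compat; auto using Cmod_ge_0. apply HD. lra.
Qed.

(** Exchange of two contour integrals with a Cauchy kernel.  The defect E, as a function of the
upper limit of the first integral, has quadratic modulus of continuity: over a short arc, the kernel may be
replaced by its value at an end point, for which the exchange is trivial, with an error which is the product of two small quantities. *)
Lemma swap_piece p k phi psi : good_piece p -> good k -> (forall w, psupp p w -> ~ supp k w) ->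
  cont_on (psupp p) phi -> cont_on (supp k) psi ->
  pint p (fun w => phi w * cauchy_int k psi w)%C =
  chint k (fun z => psi z * pint p (fun w => phi w * / (w - z)))%C.
Proof.
  intros Gp Gk Dis Hphi Hpsi.
  set (h := fun w => cauchy_int k psi w%C).
  assert (Hlt : pa p < pb p) by apply Gp.
  assert (Ch : cont_on (psupp p) h) by (apply kernel_int_cont; auto).
  set (J := fun u v f => cint (fun s => f (pg p s) * pd p s)%C u v).
  assert (JC : forall u v f, cont_on (psupp p) f -> pa p <= u -> u <= v -> v <= pb p -> cis_int (fun s => f (pg p s) * pd p s)%C u v (J u v f)).
  { intros u v f Hf H1 H2 H3. apply piece_int_sub; trivial. }
  assert (Cker : forall z, supp k z -> cont_on (psupp p) (fun w => phi w * / (w - z))%C).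
  { intros z Hz. cont. apply cont_on_pole. intros H. apply (Dis z H Hz). }
  assert (JK : forall u v, pa p <= u -> u < v -> v <= pb p -> cont_on (supp k) (fun z => psi z * J u v (fun w => phi w * / (w - z)))%C).
  { intros u v H1 H2 H3. cont.
    apply (cont_on_ext _ (fun z => chint (subpiece p u v :: nil) (fun w => phi w * / (w - z)))%C).
    - intros z Hz. simpl. unfold pint, J; simpl. ring.
    - apply kernel_int_cont_r. apply good_1, good_subpiece; trivial.
      + eapply cont_on_sub. 2: exact Hphi. intros z Hz. apply supp_1 in Hz. eapply psupp_subpiece. 3: exact Hz. trivial. trivial.
      + intros z Hz Hs. apply supp_1 in Hs. apply (Dis z); trivial. eapply psupp_subpiece. 3: exact Hs. trivial. trivial. }
  set (E := fun u v => (J u v (fun w => phi w * h w)%C - chint k (fun z => psi z * J u v (fun w => phi w * / (w - z))))%C).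
  assert (JChas : forall u v f, cont_on (psupp p) f -> pa p <= u -> u <= v -> v <= pb p -> J (pa p) v f = (J (pa p) u f + J u v f)%C).
  { intros u v f Hf H1 H2 H3. apply cis_int_cint. eapply cis_int_Chasles; apply JC; trivial; lra. }
  assert (J0 : forall u f, J u u f = 0%C).
  { intros u f. unfold J, cint. rewrite !RInt_point. reflexivity. }
  assert (Cph : cont_on (psupp p) (fun w => phi w * h w)%C) by cont.
  (* near u0 the kernel is compared with its value at w0 = pg p u0 *)
  destruct (ccont_bounded (pd p) (pa p) (pb p)) as [D [HD KD]]. lra. intros s Hs. apply (proj2 Gp s Hs).
  destruct (cont_on_bounded (p :: nil) phi (good_1 _ Gp)) as [Mp [HMp KMp]]. { eapply cont_on_sub. 2: exact Hphi. intros z. apply supp_1. }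
  destruct (cont_on_bounded k psi Gk Hpsi) as [Ms [HMs KMs]].
  destruct (chint_bound k Gk) as [Mk [HMk KMk]].
  assert (Short : forall u0, pa p <= u0 <= pb p -> exists K d, 0 <= K /\ 0 < d /\ forall u v, pa p <= u -> u < v -> v <= pb p ->
     (u = u0 \/ v = u0) -> v - u < d -> Cmod (E u v) <= K * (v - u) ^ 2).
  { intros u0 Hu0. set (w0 := pg p u0). assert (Hw0 : psupp p w0) by (exists u0; auto).
    destruct (kernel_int_lip k psi w0 Gk Hpsi (Dis w0 Hw0)) as [K1 [d1 [HK1 [Hd1 L1]]]].
    destruct (supp_closed k w0 Gk (Dis w0 Hw0)) as [d2 [Hd2 D2]].
    destruct (cder_lip (pg p) u0 (pd p u0)) as [d3 [Hd3 L3]]. apply (proj2 Gp u0 Hu0).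
    remember ((Cmod (pd p u0) + 1) * 2) as L eqn:EL. assert (HL : 0 < L) by (rewrite EL; generalize (Cmod_ge_0 (pd p u0)); lra).
    remember (2 / (d2 * d2)) as K2 eqn:EK2. assert (HK2 : 0 < K2) by (rewrite EK2; apply Rdiv_lt_0_compat; nra).
    exists (Mp * K1 * L * D + Mk * Ms * Mp * K2 * L * D), (Rmin d3 (Rmin (d1 / L) (d2 / 2 / L))).
    split. { apply Rplus_le_le_0_compat; repeat apply Rmult_le_pos; lra. }
    split. { repeat apply Rmin_glb_lt; trivial; apply Rdiv_lt_0_compat; lra. }
    intros u v H1 H2 H3 Huv Hd.
    assert (B1 := Rlt_le_trans _ _ _ Hd (Rmin_l _ _)). assert (B2 := Rlt_le_trans _ _ _ (Rlt_le_trans _ _ _ Hd (Rmin_r _ _)) (Rmin_l _ _)).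
    assert (B3 := Rlt_le_trans _ _ _ (Rlt_le_trans _ _ _ Hd (Rmin_r _ _)) (Rmin_r _ _)).
    assert (Near : forall s, u <= s <= v -> Cmod (pg p s - w0) <= L * (v - u) /\ Cmod (pg p s - w0) < d1 /\ Cmod (pg p s - w0) < d2 / 2).
    { intros s Hs. assert (Rabs (s - u0) <= v - u) by (apply Rabs_le; destruct Huv; lra).
      assert (Cmod (pg p s - w0) <= L * (v - u)). { eapply Rle_trans. apply L3. lra. apply Rmult_le_compat_l; lra. }
      apply Rlt_div_r in B2; trivial. apply Rlt_div_r in B3; trivial. repeat split; lra. }
    assert (Pker : forall z, supp k z -> cont_on (psupp p) (fun w => phi w * (/ (w - z) - / (w0 - z)))%C).
    { intros z Hz. cont. apply cont_on_pole. intros H. apply (Dis z H Hz). }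
    assert (JL : J u v (fun w => phi w * h w)%C = (J u v (fun w => phi w * (h w - h w0)) + h w0 * J u v phi)%C).
    { apply cis_int_cint. eapply cis_int_ext. lra. 2: apply cis_int_plus; [apply JC; trivial; [cont|lra] | apply cis_int_scal, JC; trivial; lra].
      intros s _. simpl. ring. }
    assert (JR : forall z, supp k z -> J u v (fun w => phi w * / (w - z))%C = (J u v (fun w => phi w * (/ (w - z) - / (w0 - z))) + / (w0 - z) * J u v phi)%C).
    { intros z Hz. apply cis_int_cint. eapply cis_int_ext. lra. 2: apply cis_int_plus; [apply JC; auto; lra | apply cis_int_scal, JC; trivial; lra].
      intros s _. simpl. ring. }
    assert (CR : cont_on (supp k) (fun z => psi z * J u v (fun w => phi w * (/ (w - z) - / (w0 - z))))%C).
    { apply (cont_on_ext _ (fun z => psi z * J u v (fun w => phi w * / (w - z)) - J u v phi * (psi z * / (w0 - z)))%C).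
      - intros z Hz. rewrite (JR z Hz). ring.
      - apply cont_on_minus. apply JK; trivial. apply cont_on_mult. apply cont_on_const. apply cont_on_kernel; auto. }
    assert (EE : E u v = (J u v (fun w => phi w * (h w - h w0)) - chint k (fun z => psi z * J u v (fun w => phi w * (/ (w - z) - / (w0 - z)))))%C).
    { unfold E. rewrite JL.
      rewrite (chint_ext k (fun z => psi z * J u v (fun w => phi w * / (w - z)))%C (fun z => psi z * J u v (fun w => phi w * (/ (w - z) - / (w0 - z))) + J u v phi * (psi z * / (w0 - z)))%C); trivial.
      - rewrite chint_plus, chint_scal; trivial; auto using cont_on_kernel.
        + unfold h. ring.
        + apply cont_on_mult. apply cont_on_const. apply cont_on_kernel; auto.
      - intros z Hz. rewrite (JR z Hz). ring. }
    rewrite EE. eapply Rle_trans. apply Cmod_triangle_minus.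
    assert (0 <= L * (v - u)) by (apply Rmult_le_pos; lra).
    assert (T1 : Cmod (J u v (fun w => phi w * (h w - h w0))%C) <= Mp * (K1 * (L * (v - u))) * D * (v - u)).
    { apply pint_bound_on; trivial; try lra; cont. repeat apply Rmult_le_pos; lra.
      intros s Hs. rewrite Cmod_mult. destruct (Near s Hs) as [N1 [N2 N3]]. apply Rmult_le_compat; auto using Cmod_ge_0.
      apply KMp. apply supp_1. exists s. split; trivial; lra.
      eapply Rle_trans. apply L1; trivial. apply Rmult_le_compat_l; trivial. }
    assert (T2 : Cmod (chint k (fun z => psi z * J u v (fun w => phi w * (/ (w - z) - / (w0 - z))))%C) <= Mk * (Ms * (Mp * (K2 * (L * (v - u))) * D * (v - u)))).
    { apply KMk; trivial. repeat apply Rmult_le_pos; lra.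
      intros z Hz. rewrite Cmod_mult. apply Rmult_le_compat; auto using Cmod_ge_0.
      apply pint_bound_on; auto; try lra. repeat apply Rmult_le_pos; lra.
      intros s Hs. rewrite Cmod_mult. destruct (Near s Hs) as [N1 [N2 N3]]. apply Rmult_le_compat; auto using Cmod_ge_0.
      apply KMp. apply supp_1. exists s. split; trivial; lra.
      eapply Rle_trans. apply (kernel_lip (pg p s) w0 z d2 Hd2 (D2 z Hz) N3). rewrite <- EK2. apply Rmult_le_compat_l; lra. }
    eapply Rle_trans. apply Rplus_le_compat; [exact T1 | exact T2]. right. ring. }
  assert (EChas : forall u v, pa p < u -> u < v -> v <= pb p -> E (pa p) v = (E (pa p) u + E u v)%C).
  { intros u v H1 H2 H3. unfold E. rewrite (JChas u v) by (trivial; lra).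
    rewrite (chint_ext k (fun z => psi z * J (pa p) v (fun w => phi w * / (w - z)))%C (fun z => psi z * J (pa p) u (fun w => phi w * / (w - z)) + psi z * J u v (fun w => phi w * / (w - z)))%C); trivial.
    - rewrite chint_plus; trivial. ring. apply JK; lra. apply JK; lra.
    - intros z Hz. rewrite (JChas u v) by (auto; lra). ring. }
  assert (E0 : forall u, E u u = 0%C).
  { intros u. unfold E. rewrite J0. rewrite (chint_ext k _ (fun z => 0 * psi z)%C); trivial.
    rewrite chint_scal; trivial. ring. intros z Hz. rewrite J0. ring. }
  assert (EChas' : forall u v, pa p <= u -> u <= v -> v <= pb p -> E (pa p) v = (E (pa p) u + E u v)%C).
  { intros u v H1 H2 H3. destruct (Req_dec u v) as [->|N]. rewrite E0. ring.
    destruct (Req_dec u (pa p)) as [->|N']. rewrite E0. ring. apply EChas; lra. }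
  assert (Fin : E (pa p) (pb p) = E (pa p) (pa p)).
  { apply (flat_const (fun v => E (pa p) v)). lra. intros u Hu. destruct (Short u Hu) as [K [d [HK [Hd S]]]].
    exists K, d. repeat split; trivial. intros v Hv Hvd.
    destruct (Rtotal_order u v) as [H|[H|H]].
    - rewrite (EChas' u v) by lra. replace (E (pa p) u + E u v - E (pa p) u)%C with (E u v) by ring.
      rewrite Rabs_pos_eq in Hvd by lra. apply S; auto; lra.
    - subst v. replace (E (pa p) u - E (pa p) u)%C with (RtoC 0) by ring. rewrite Cmod_0. nra.
    - rewrite (EChas' v u) by lra. replace (E (pa p) v - (E (pa p) v + E v u))%C with (- E v u)%C by ring. rewrite Cmod_opp.
      replace ((v - u) ^ 2) with ((u - v) ^ 2) by ring.
      rewrite Rabs_minus_sym, Rabs_pos_eq in Hvd by lra. apply S; auto; lra. }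
  rewrite E0 in Fin. unfold E, J in Fin. apply Ceq_minus in Fin. exact Fin.
Qed.

Lemma swap l k phi psi : good l -> good k -> (forall w, supp l w -> ~ supp k w) ->
  cont_on (supp l) phi -> cont_on (supp k) psi ->
  chint l (fun w => phi w * cauchy_int k psi w)%C =
  chint k (fun z => psi z * chint l (fun w => phi w * / (w - z)))%C.
Proof.
  intros Gl Gk Dis Hphi Hpsi. induction l as [|p l IH].
  - simpl. rewrite (chint_ext k _ (fun z => 0 * psi z)%C); trivial.
    rewrite chint_scal; trivial. ring. intros; ring.
  - assert (Dp : forall w, psupp p w -> ~ supp k w). { intros w Hw. apply Dis. exists p. split; [left|]; trivial. }
    assert (Dl : forall w, supp l w -> ~ supp k w). { intros w [q [Hq Hw]]. apply Dis. exists q. split; [right|]; trivial. }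
    simpl. rewrite IH; eauto using good_tl, cont_on_cons_tl.
    rewrite swap_piece; eauto using good_hd, cont_on_cons_hd.
    rewrite <- chint_plus; trivial; eauto using good_tl.
    + apply chint_ext; trivial. intros; ring.
    + cont. apply (cont_on_ext _ (fun z => chint (p :: nil) (fun w => phi w * / (w - z)))%C). intros; simpl; ring.
      apply kernel_int_cont_r. apply good_1. eauto using good_hd.
      eapply cont_on_sub. 2: eapply cont_on_cons_hd; exact Hphi. intros z Hz. apply supp_1; trivial.
      intros z Hz Hs. apply supp_1 in Hs. apply (Dp z Hs Hz).
    + cont. apply kernel_int_cont_r. eauto using good_tl. eauto using cont_on_cons_tl.
      intros z Hz Hs. apply (Dl z Hs Hz).
Qed.

(** Moving the w-contour from l1 to l2 across the z-contour k: after exchanging the integrals, Cauchy's formula gives, for each z, the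
residue F(z) W(z) times the jump n of the index, which is the same for all z on k. *)
Lemma double_cauchy l1 l2 k A W F n : good l1 -> good l2 -> good k -> closed_chain l1 -> closed_chain l2 ->
  avoids_list (supp l1) A -> avoids_list (supp l2) A -> avoids_list (supp k) A ->
  (forall a, In a A -> index l1 a = index l2 a) -> approx A W -> cont_on (supp k) F ->
  (forall z, supp k z -> ~ supp l1 z /\ ~ supp l2 z /\ (index l1 z - index l2 z = n)%C) ->
  chint l1 (fun w => W w * cauchy_int k F w)%C =
  (chint l2 (fun w => W w * cauchy_int k F w) + n * chint k (fun z => F z * W z))%C.
Proof.
  intros G1 G2 Gk C1 C2 A1 A2 Ak HW AW CF Hk.
  assert (CW : cont_on (supp k) W) by eauto using approx_cont.
  assert (CW1 : cont_on (supp l1) W) by eauto using approx_cont.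
  assert (CW2 : cont_on (supp l2) W) by eauto using approx_cont.
  assert (D1 : forall z, supp k z -> ~ supp l1 z) by (intros z Hz; apply (Hk z Hz)).
  assert (D2 : forall z, supp k z -> ~ supp l2 z) by (intros z Hz; destruct (Hk z Hz) as [_ [H _]]; exact H).
  rewrite (swap l1 k W F); trivial. 2:{ intros w Hw Hs. apply (D1 w Hs Hw). }
  rewrite (swap l2 k W F); trivial. 2:{ intros w Hw Hs. apply (D2 w Hs Hw). }
  rewrite <- chint_scal, <- chint_plus; trivial; cont.
  - apply chint_ext; trivial. intros z Hz. destruct (Hk z Hz) as [S1 [S2 Hn]].
    assert (E := cauchy_diff l1 l2 A W z G1 G2 C1 C2 A1 A2 HW AW (avoids_not_in _ _ _ Ak Hz) S1 S2).
    rewrite Hn in E.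
    assert (E' : (chint l1 (fun w => W w * / (w - z)) = chint l2 (fun w => W w * / (w - z)) + W z * n)%C) by (rewrite <- E; ring).
    rewrite E'. ring.
  - apply kernel_int_cont_r; trivial.
Qed.

(** * From contours to chains *)

(** The integral over 1/c is included: the inverse of S enters the limit kernel as a curve of its own. *)
Lemma piecewise_chain c a b : piecewise_C1 c a b -> exists l,
  a < b /\ good l /\ (forall z, supp l z <-> exists s, a <= s <= b /\ z = c s) /\
  (forall G, boundary l G = (G (c b) - G (c a))%C) /\
  (forall f, cont_on (supp l) f -> cis_int (fun s => f (c s) * velocity c s)%C a b (chint l f)) /\
  ((forall s, a <= s <= b -> c s <> 0%C) -> forall f, cont_on (supp (inv_chain l)) f ->
     cis_int (fun s => f (/ c s) * velocity (fun r => / c r) s)%C a b (chint (inv_chain l) f)).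
Proof.
  induction 1 as [a b g dg Hab Hg Hdg E | a b d _ IH1 _ IH2].
  - set (p := mkpiece g dg a b). assert (Gp : good_piece p).
    { split; trivial. simpl. intros s _. split. apply cder_of_is_derive, Hg. apply ccont_of_continuous, Hdg. }
    assert (Hc : forall s, a < s < b -> cder c s (dg s)).
    { intros s Hs. apply (cder_ext_loc g). 2: apply cder_of_is_derive, Hg.
      exists (Rmin (s - a) (b - s)). split. apply Rmin_glb_lt; lra. intros r Hr.
      destruct (Rmin_Rgt_l _ _ _ Hr) as [H1 H2].
      apply Rabs_def2 in H1. apply Rabs_def2 in H2. symmetry. apply E. lra. }
    exists (p :: nil). split; trivial. split. apply good_1; trivial. split; [|split; [|split]].
    + intros z. rewrite supp_1. split; intros [s [Hs ->]]; exists s; split; trivial. symmetry; apply E; trivial. apply E; trivial.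
    + intros G. simpl. rewrite !E by lra. ring.
    + intros f Hf. replace (chint (p :: nil) f) with (pint p f) by (simpl; ring).
      eapply cis_int_ext. lra. 2: apply (pint_correct p f Gp). 2: apply (cont_on_cons_hd _ _ _ Hf).
      intros s Hs. simpl. rewrite (cder_velocity c s _ (Hc s Hs)), E by lra. reflexivity.
    + intros Hn f Hf.
      assert (Gi : good (inv_chain (p :: nil))).
      { apply good_inv. apply good_1; trivial. intros Hs. apply supp_1 in Hs. destruct Hs as [s [Hs E0]].
        apply (Hn s Hs). rewrite E; trivial. symmetry; trivial. }
      replace (chint (inv_chain (p :: nil)) f) with (pint (inv_piece p) f) by (simpl; ring).
      eapply cis_int_ext. lra. 2: apply (pint_correct (inv_piece p) f (good_hd _ _ Gi)). 2: apply (cont_on_cons_hd _ _ _ Hf).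
      intros s Hs. simpl. rewrite (cder_velocity _ s _ (cder_inv c s _ (Hc s Hs) (Hn s ltac:(lra)))), E by lra. reflexivity.
  - destruct IH1 as [l1 [Hab [G1 [S1 [B1 [I1 V1]]]]]]. destruct IH2 as [l2 [Hbd [G2 [S2 [B2 [I2 V2]]]]]].
    exists (l1 ++ l2). split. lra. split. apply good_app; trivial. split; [|split; [|split]].
    + intros z. rewrite supp_app, S1, S2. split.
      * intros [[s [Hs Ez]]|[s [Hs Ez]]]; exists s; split; trivial; lra.
      * intros [s [Hs Ez]]. destruct (Rle_dec s b); [left|right]; exists s; split; trivial; lra.
    + intros G. rewrite boundary_app, B1, B2. ring.
    + intros f Hf. rewrite chint_app. apply cis_int_Chasles with b; [apply I1|apply I2];
      (eapply cont_on_sub; [|exact Hf]); intros z Hz; apply supp_app; auto.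
    + intros Hn f Hf. unfold inv_chain. rewrite map_app. fold (inv_chain l1) (inv_chain l2). rewrite chint_app.
      assert (Hs : forall z, supp (inv_chain l1) z \/ supp (inv_chain l2) z -> supp (inv_chain (l1 ++ l2)) z).
      { intros z. rewrite !supp_inv, supp_app. trivial. }
      apply cis_int_Chasles with b; [apply V1|apply V2];
      try (intros; apply Hn; lra); (eapply cont_on_sub; [|exact Hf]); intros z Hz; apply Hs; auto.
Qed.

Lemma two_pi_i_neq_0 : two_pi_i <> 0%C.
Proof. intros E. apply (f_equal Im) in E. unfold two_pi_i in E. simpl in E. generalize PI_RGT_0. lra. Qed.

Lemma contour_chain c : closed_contour c -> exists l,
  good l /\ closed_chain l /\ (forall z, supp l z <-> exists s, 0 <= s <= 1 /\ z = c s) /\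
  (forall f, cont_on (supp l) f -> contour_int c f = chint l f).
Proof.
  intros [Hp Hc]. destruct (piecewise_chain c 0 1 Hp) as [l [_ [G [S [B [I _]]]]]].
  exists l. split; trivial. split. intros H. rewrite B, Hc. ring. split; trivial.
  intros f Hf. apply cis_int_RInt. apply I; trivial.
Qed.

Lemma cycle_chain gs : (forall c, In c gs -> closed_contour c) -> exists l,
  good l /\ closed_chain l /\ (forall z, supp l z <-> exists c s, In c gs /\ 0 <= s <= 1 /\ z = c s) /\
  (forall f, cont_on (supp l) f -> cycle_int gs f = chint l f).
Proof.
  induction gs as [|c gs IH]; intros H.
  - exists nil. split. intros p []. split. intros G; reflexivity. split.
    + intros z. split. intros [p [[] _]]. intros [c [s [[] _]]].
    + intros f _. reflexivity.
  - destruct IH as [l [G [Cl [S I]]]]. { intros; apply H; right; trivial. }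
    destruct (contour_chain c) as [l' [G' [Cl' [S' I']]]]. { apply H; left; trivial. }
    exists (l' ++ l). split. apply good_app; trivial. split. apply closed_app; trivial. split.
    + intros z. rewrite supp_app, S, S'. split.
      * intros [[s [Hs E]]|[c' [s [Hc' Hs]]]]. exists c, s. split; [left|]; auto. exists c', s. split; [right|]; trivial.
      * intros [c' [s [[<-|Hc'] [Hs E]]]]. left; exists s; auto. right; exists c', s; auto.
    + intros f Hf. rewrite chint_app. rewrite <- I, <- I'; trivial; (eapply cont_on_sub; [|exact Hf]); intros z Hz; apply supp_app; auto.
Qed.

Lemma cycle_avoids_supp gs l p : (forall z, supp l z <-> exists c s, In c gs /\ 0 <= s <= 1 /\ z = c s) ->
  cycle_avoids gs p -> ~ supp l p.
Proof.
  intros S H Hs. apply S in Hs. destruct Hs as [c [s [Hc [Hs E]]]]. apply (H c Hc s Hs). auto.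
Qed.

Lemma encircles_index gs l p : (forall z, supp l z <-> exists c s, In c gs /\ 0 <= s <= 1 /\ z = c s) ->
  (forall f, cont_on (supp l) f -> cycle_int gs f = chint l f) ->
  encircles gs p -> ~ supp l p /\ index l p = two_pi_i.
Proof.
  intros S I [H1 H2]. assert (N : ~ supp l p) by (eapply cycle_avoids_supp; eassumption). split; trivial.
  unfold cycle_winding in H2. rewrite I in H2. 2: apply cont_on_pole; trivial.
  change (/ two_pi_i * index l p = 1)%C in H2.
  replace (index l p) with (two_pi_i * (/ two_pi_i * index l p))%C. rewrite H2. ring. field. apply two_pi_i_neq_0.
Qed.

Lemma outside_index gs l p : (forall z, supp l z <-> exists c s, In c gs /\ 0 <= s <= 1 /\ z = c s) ->
  (forall f, cont_on (supp l) f -> cycle_int gs f = chint l f) ->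
  outside gs p -> ~ supp l p /\ index l p = 0%C.
Proof.
  intros S I [H1 H2]. assert (N : ~ supp l p) by (eapply cycle_avoids_supp; eassumption). split; trivial.
  unfold cycle_winding in H2. rewrite I in H2. 2: apply cont_on_pole; trivial.
  change (/ two_pi_i * index l p = 0)%C in H2.
  replace (index l p) with (two_pi_i * (/ two_pi_i * index l p))%C. rewrite H2. ring. field. apply two_pi_i_neq_0.
Qed.

(** * Inversion, and the contours of the kernel *)

(** The zeros and singularities of the kernel weights. *)
Notation poles e := (RtoC 0 :: RtoC e :: RtoC (/ e) :: nil).

Lemma index_app l l' p : index (l ++ l') p = (index l p + index l' p)%C.
Proof. apply chint_app. Qed.

Lemma supp_neq l z w : supp l z -> ~ supp l w -> (z - w <> 0)%C.
Proof. intros H N E. apply Ceq_minus in E. subst. auto. Qed.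

(** By partial fractions: the pull-back of dz/(z - p) under z -> 1/z is du/(u - 1/p) - du/u. *)
Lemma index_inv l (p : C) : good l -> ~ supp l 0%C -> p <> 0%C -> ~ supp l (/ p)%C ->
  index (inv_chain l) p = (index l (/ p) - index l 0)%C.
Proof.
  intros G H0 Hp Hs. unfold index. rewrite chint_inv, <- chint_minus; trivial; try (apply cont_on_pole; trivial).
  apply chint_ext; trivial. intros z Hz.
  assert (N0 := supp_neq l z _ Hz H0). assert (N1 := supp_neq l z _ Hz Hs).
  assert (Nz : z <> 0%C). { intros E. apply N0. rewrite E. ring. }
  assert (N2 : (z * p - 1 <> 0)%C). { intros E. apply N1. replace (z - / p)%C with ((z * p - 1) * / p)%C by (field; trivial). rewrite E. ring. }
  replace (z - 0)%C with z in * by ring. field. repeat split; trivial.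
  intros E. apply N2. replace (z * p - 1)%C with (- (1 - p * z))%C by ring. rewrite E. ring.
Qed.

Lemma index_inv_0 l : good l -> ~ supp l 0%C -> index (inv_chain l) 0 = (- index l 0)%C.
Proof.
  intros G H0. unfold index. rewrite chint_inv. replace (- chint l (fun z => / (z - 0)))%C with ((-1) * chint l (fun z => / (z - 0)))%C by ring.
  rewrite <- chint_scal; trivial; try (apply cont_on_pole; trivial).
  apply chint_ext; trivial. intros z Hz. assert (N0 := supp_neq l z _ Hz H0). replace (z - 0)%C with z in * by ring.
  field. trivial.
Qed.

Lemma not_supp_inv_0 l : ~ supp l 0%C -> ~ supp (inv_chain l) 0%C.
Proof. intros H Hs. apply supp_inv in Hs. rewrite Cinv_0 in Hs. auto. Qed.

Lemma kernel_sign k F w : good k -> cont_on (supp k) F -> ~ supp k w ->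
  cauchy_int k F w%C = ((-1) * chint k (fun z => F z * / (z - w)))%C.
Proof.
  intros G HF Hw. rewrite <- chint_scal; trivial. apply chint_ext; trivial.
  - intros z Hz. assert (N := supp_neq k z w Hz Hw). assert ((w - z <> 0)%C). { intros E. apply N. replace (z - w)%C with (- (w - z))%C by ring. rewrite E. ring. }
    field. auto.
  - cont. apply cont_on_pole; trivial.
Qed.

(** For z = 1/u, dz/(w - z) becomes (1/w) (1/u) du / (1/w - u): the factors 1/w and 1/u pass to the functions around
the Cauchy kernel, which keeps its form. *)
Lemma inner_inv k F (w : C) : good k -> ~ supp k 0%C -> cont_on (supp k) (fun u => F (/ u) * / u)%C -> w <> 0%C -> ~ supp k (/ w)%C ->
  cauchy_int (inv_chain k) F w%C = (/ w * chint k (fun u => (F (/ u) * / u) * / (/ w - u)))%C.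
Proof.
  intros Gk Hk CF Nw Dis.
  rewrite chint_inv, <- chint_scal; auto using cont_on_kernel. apply chint_ext; trivial. intros u Hu.
  assert (Nu : u <> 0%C) by (intros ->; auto).
  assert (N1 : (1 - w * u <> 0)%C).
  { intros E. apply Dis. replace (/ w)%C with u; trivial.
    replace u with ((w * u) * / w)%C by (field; trivial). replace (w * u)%C with (1 - (1 - w * u))%C by ring. rewrite E. field; trivial. }
  replace (w - / u)%C with (- (1 - w * u) * / u)%C by (field; trivial).
  replace (/ w - u)%C with ((1 - w * u) * / w)%C by (field; trivial).
  generalize (F (/ u)%C). intros x. field. repeat split; trivial.
  all: intros E; apply N1; rewrite <- E; ring || (replace (1 - w * u)%C with (- (- (1 - w * u)))%C by ring; rewrite E; ring).
Qed.

(** The change of variables w -> 1/w, z -> 1/z in a double integral with Cauchy kernel; the sign is the orientation of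
the inverse of l. *)
Lemma inv_double l k W F : good l -> good k -> ~ supp l 0%C -> ~ supp k 0%C ->
  cont_on (supp l) W -> cont_on (supp k) (fun u => F (/ u) * / u)%C ->
  (forall w, supp l w -> ~ supp k (/ w)%C) ->
  chint l (fun w => W w * cauchy_int (inv_chain k) F w)%C =
  ((-1) * chint (inv_chain l) (fun w => (W (/ w) * / w) * chint k (fun u => (F (/ u) * / u) * / (w - u))))%C.
Proof.
  intros Gl Gk Hl Hk CW CF Dis. rewrite chint_inv.
  assert (Cl0 : forall w, supp l w -> w <> 0%C) by (intros w Hw ->; auto).
  assert (Ck0 : forall w, supp k w -> w <> 0%C) by (intros w Hw ->; auto).
  assert (Inner : forall w, supp l w -> cauchy_int (inv_chain k) F w%C = (/ w * chint k (fun u => (F (/ u) * / u) * / (/ w - u)))%C).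
  { intros w Hw. apply inner_inv; auto. }
  assert (X : cont_on (fun w' => supp l (/ w')%C) (fun w' => chint k (fun u => (F (/ u) * / u) * / (w' - u)))%C).
  { apply kernel_int_cont; trivial. intros w' Hw' Hs. apply (Dis _ Hw'). rewrite Cinv_inv. exact Hs. }
  assert (CI : cont_on (supp l) (fun w => chint k (fun u => (F (/ u) * / u) * / (/ w - u)))%C).
  { intros w Hw e He. assert (Hw' : supp l (/ / w)%C) by (rewrite Cinv_inv; exact Hw).
    destruct (X (/ w)%C Hw' e He) as [d [Hd K]].
    destruct (cont_on_inv (supp l) (fun w => w) (cont_on_id _) Cl0 w Hw d Hd) as [d' [Hd' K']].
    exists d'. split; trivial. intros z' Hz' Hd0. apply K. cbv beta. rewrite Cinv_inv; trivial. apply K'; trivial. }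
  rewrite <- chint_scal; trivial.
  - apply chint_ext; trivial. intros w Hw. rewrite (Inner w Hw), Cinv_inv. assert (Nw := Cl0 w Hw).
    generalize (chint k (fun u => (F (/ u) * / u) * / (/ w - u))%C). intros x. field. trivial.
  - assert (cont_on (supp l) (fun w => / w)%C) by (apply cont_on_inv; cont).
    cont. 1: apply (cont_on_ext _ W); [intros z _; rewrite Cinv_inv; reflexivity | trivial].
    1: apply cont_on_inv; [assumption | intros z Hz; apply Cinv_neq_0; auto].
    apply cont_on_inv; cont. intros z Hz. apply Cmult_neq_0; auto.
Qed.

Lemma Cmod_U w : supp (square 0 1) w -> Rabs (Re w) <= 1 /\ Rabs (Im w) <= 1 /\ 1 <= Cmod w.
Proof.
  intros H. apply supp_square in H; [|lra]. simpl in H. rewrite !Rminus_0_r in H. destruct H as [H [H1 H2]].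
  repeat split; trivial. destruct H as [H|[H|[H|H]]].
  - eapply Rle_trans; [|apply re_le_Cmod]. rewrite H. rewrite Rabs_R1. lra.
  - eapply Rle_trans; [|apply re_le_Cmod]. rewrite H, Rabs_Ropp, Rabs_R1. lra.
  - eapply Rle_trans; [|apply im_le_Cmod]. rewrite H. rewrite Rabs_R1. lra.
  - eapply Rle_trans; [|apply im_le_Cmod]. rewrite H, Rabs_Ropp, Rabs_R1. lra.
Qed.

Lemma index_U_in z : Cmod z < 1 -> ~ supp (square 0 1) z /\ index (square 0 1) z = two_pi_i.
Proof.
  intros H. split. intros Hs. apply Cmod_U in Hs. lra.
  apply index_square_in. lra. simpl; rewrite Rminus_0_r. eapply Rle_lt_trans. apply re_le_Cmod. trivial.
  simpl; rewrite Rminus_0_r. eapply Rle_lt_trans. apply im_le_Cmod. trivial.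
Qed.

Lemma index_U_out z : 1 < Re z -> ~ supp (square 0 1) z /\ index (square 0 1) z = 0%C.
Proof.
  intros H. split. intros Hs. apply Cmod_U in Hs. destruct Hs as [Hs _]. apply Rabs_le_between in Hs. lra.
  apply index_square_out. lra. left. simpl; rewrite Rminus_0_r. rewrite Rabs_pos_eq; lra.
Qed.

Lemma Cmod_inv_lt1 (z : C) : 1 < Cmod z -> Cmod (/ z) < 1.
Proof.
  intros H. rewrite Cmod_inv. rewrite <- Rinv_1. apply Rinv_lt_contravar; lra.
  intros ->. rewrite Cmod_0 in H. lra.
Qed.

Lemma not_supp_U_0 : ~ supp (square 0 1) 0%C.
Proof. apply index_U_in. rewrite Cmod_0. lra. Qed.

Lemma avoids_1 X (a : C) : ~ X a -> avoids_list X (a :: nil).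
Proof. intros H b [<-|[]]. exact H. Qed.

Lemma index_nil p : index nil p = 0%C.
Proof. reflexivity. Qed.

Lemma good_nil : good nil.
Proof. intros p []. Qed.
Lemma closed_nil : closed_chain nil.
Proof. intros G. reflexivity. Qed.

(** The inner part of the z-contour, transported to the right half-plane by inversion.  The inverse of l is a loop about 0 of the
opposite orientation which does not wind about k, so that its negative can be deformed into the unit square. *)
Lemma inv_side l k W F : good l -> closed_chain l -> good k -> ~ supp l 0%C -> index l 0 = two_pi_i ->
  cont_on (supp l) W -> approx (RtoC 0 :: nil) (fun w => W (/ w) * / w)%C -> cont_on (supp k) (fun u => F (/ u) * / u)%C ->
  (forall z, supp k z -> 1 < Re z /\ ~ supp l (/ z)%C /\ index l (/ z) = two_pi_i) ->
  chint l (fun w => W w * cauchy_int (inv_chain k) F w)%C =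
  chint (square 0 1) (fun w => (W (/ w) * / w) * chint k (fun u => (F (/ u) * / u) * / (w - u)))%C.
Proof.
  intros Gl Cl Gk Hl0 Wl0 CW AW CF Hk.
  assert (Hk0 : ~ supp k 0%C). { intros Hs. apply Hk in Hs. simpl in Hs. lra. }
  assert (GU := good_square 0 1). assert (CU := closed_square 0 1). assert (Gi := good_inv l Gl Hl0).
  rewrite inv_double; trivial. 2:{ intros w Hw Hs. destruct (Hk _ Hs) as [_ [H _]]. apply H. rewrite Cinv_inv. trivial. }
  assert (Hi0 := not_supp_inv_0 l Hl0).
  assert (Hki : forall z, supp k z -> ~ supp (inv_chain l) z).
  { intros z Hz Hs. apply supp_inv in Hs. destruct (Hk z Hz) as [_ [H _]]. auto. }
  assert (CWi : cont_on (supp (inv_chain l)) (fun w => W (/ w) * / w)%C) by (eapply approx_cont; eauto using avoids_1).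
  assert (CWu : cont_on (supp (square 0 1)) (fun w => W (/ w) * / w)%C) by (eapply approx_cont; eauto using avoids_1, not_supp_U_0).
  assert (D : chint (inv_chain l ++ square 0 1) (fun w => (W (/ w) * / w) * chint k (fun u => (F (/ u) * / u) * / (w - u)))%C =
    (chint nil (fun w => (W (/ w) * / w) * chint k (fun u => (F (/ u) * / u) * / (w - u)))%C + 0 * chint k (fun u => (F (/ u) * / u) * (W (/ u) * / u)))%C).
  { apply (double_cauchy _ _ _ (RtoC 0 :: nil)); trivial.
    - apply good_app; trivial.
    - apply good_nil.
    - apply closed_app; trivial. apply closed_inv; trivial.
    - apply closed_nil.
    - apply avoids_1. rewrite supp_app. intros [H|H]; auto. apply (not_supp_U_0 H).
    - apply avoids_1. intros [p [[] _]].
    - apply avoids_1; trivial.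
    - intros a [<-|[]]. rewrite index_app, index_inv_0, Wl0; trivial.
      destruct (index_U_in 0%C) as [_ ->]. rewrite Cmod_0; lra. rewrite index_nil; ring.
    - intros z Hz. destruct (Hk z Hz) as [H1 [H2 H3]]. destruct (index_U_out z H1) as [H4 H5]. repeat split.
      + rewrite supp_app. intros [H|H]; auto. apply (Hki z Hz H).
      + intros [p [[] _]].
      + rewrite index_app, index_inv, H3, Wl0, H5; trivial. rewrite index_nil; ring. intros ->. simpl in H1; lra. }
  rewrite chint_app in D. revert D.
  generalize (chint (inv_chain l) (fun w => W (/ w) * / w * chint k (fun u => F (/ u) * / u * / (w - u))))%C.
  generalize (chint (square 0 1) (fun w => W (/ w) * / w * chint k (fun u => F (/ u) * / u * / (w - u))))%C.
  intros x y D. replace x with ((y + x) - y)%C by ring. rewrite D. change (chint nil _) with (RtoC 0). ring.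
Qed.

Lemma square_in_not_supp c h q : 0 < h -> Rabs (Re q - Re c) < h -> Rabs (Im q - Im c) < h -> ~ supp (square c h) q.
Proof.
  intros Hh H1 H2 Hs. apply supp_square in Hs; [|lra]. apply Rabs_def2 in H1. apply Rabs_def2 in H2.
  destruct Hs as [[H|[H|[H|H]]] _]; lra.
Qed.

Lemma Cmod_sq0 r w : 0 < r -> supp (square 0 r) w -> Cmod w <= 2 * r.
Proof.
  intros Hr H. apply supp_square in H; [|lra]. simpl in H. rewrite !Rminus_0_r in H. destruct H as [_ [H1 H2]].
  eapply Rle_trans. apply Cmod_le_sum. lra.
Qed.

Lemma sq0_out r z : 0 < r -> 2 * r < Cmod z -> ~ supp (square 0 r) z /\ index (square 0 r) z = 0%C.
Proof.
  intros Hr H. split. intros Hs. apply Cmod_sq0 in Hs; lra.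
  apply index_square_out; trivial. simpl. rewrite !Rminus_0_r.
  assert (T := Cmod_le_sum z). destruct (Rlt_dec r (Rabs (Re z))); [left; trivial|right]. lra.
Qed.

Lemma sq0_in r z : 0 < r -> Cmod z < r -> ~ supp (square 0 r) z /\ index (square 0 r) z = two_pi_i.
Proof.
  intros Hr H. assert (H1 := re_le_Cmod z). assert (H2 := im_le_Cmod z).
  split; [apply square_in_not_supp | apply index_square_in]; trivial; simpl; rewrite Rminus_0_r; lra.
Qed.

Lemma index_near l d w : good l -> closed_chain l -> (forall z, supp l z -> d <= Cmod (z - 0)) -> Cmod w < d ->
  ~ supp l w /\ index l w = index l 0.
Proof.
  intros G Cl D Hw. assert (N : forall z, Cmod z <= Cmod w -> ~ supp l z).
  { intros z Hz Hs. specialize (D z Hs). replace (z - 0)%C with z in D by ring. lra. }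
  split. apply N. lra. apply index_seg; trivial. intros z Hz. apply N. apply seg0_Cmod; trivial.
Qed.

Lemma avoids_3 X (a b c : C) : ~ X a -> ~ X b -> ~ X c -> avoids_list X (a :: b :: c :: nil).
Proof. intros H1 H2 H3 x [<-|[<-|[<-|[]]]]; trivial. Qed.

(** A square whose left side lies on the line Re z = sg. *)
Definition right_square (sg h : R) : chain := square (sg + h)%R h.

Lemma supp_right_square sg h z : 0 < h -> supp (right_square sg h) z -> sg <= Re z.
Proof. intros Hh H. apply supp_square in H; [|lra]. destruct H as [_ [H _]]. simpl in H. apply Rabs_le_between in H. lra. Qed.

Lemma right_square_out sg h z : 0 < h -> Re z < sg -> ~ supp (right_square sg h) z /\ index (right_square sg h) z = 0%C.
Proof.
  intros Hh H. split. intros Hs. apply supp_right_square in Hs; lra.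
  apply index_square_out; trivial. left. simpl. rewrite Rabs_left; lra.
Qed.

Lemma right_square_in sg h (x : R) : 0 < h -> sg < x -> x < sg + 2 * h -> ~ supp (right_square sg h) x /\ index (right_square sg h) x = two_pi_i.
Proof.
  intros Hh H1 H2. split; [apply square_in_not_supp | apply index_square_in]; trivial; simpl; try (apply Rabs_def1; lra);
  rewrite Rminus_0_r, Rabs_R0; trivial.
Qed.

Lemma right_square_inv sg h (e : R) : 0 < e < 1 -> 1 < sg -> 0 < h -> sg < / e -> / e < sg + 2 * h ->
  let Q := inv_chain (right_square sg h) in
  good Q /\ closed_chain Q /\ (~ supp Q 0%C /\ index Q 0 = 0%C) /\ (~ supp Q e /\ index Q e = two_pi_i) /\
  (~ supp Q (/ e)%R /\ index Q (/ e)%R = 0%C) /\ (forall z, supp Q z -> Cmod z < 1).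
Proof.
  intros He Hsg Hh H1 H2 Q. assert (Hie : 0 < / e) by (apply Rinv_0_lt_compat; lra).
  destruct (right_square_out sg h 0%C Hh) as [N0 W0]. simpl; lra.
  destruct (right_square_out sg h e Hh) as [Ne We]. simpl; lra.
  destruct (right_square_in sg h (/ e) Hh H1 H2) as [Ni Wi].
  assert (Gr : good (right_square sg h)) by apply good_square.
  assert (Ec : (/ RtoC e)%C = RtoC (/ e)) by (rewrite RtoC_inv; [reflexivity | lra]).
  assert (Ei : (/ RtoC (/ e))%C = RtoC e) by (rewrite <- Ec; apply Cinv_inv).
  split; [apply good_inv; trivial|]. split; [apply closed_inv, closed_square|].
  split; [split; [apply not_supp_inv_0; trivial | unfold Q; rewrite index_inv_0, W0; trivial; ring]|].
  split; [split|split; [split|]].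
  - unfold Q. rewrite supp_inv, Ec. trivial.
  - unfold Q. rewrite index_inv, Ec, Wi, W0; trivial. ring. intros E; apply RtoC_inj in E; lra. rewrite Ec. trivial.
  - unfold Q. rewrite supp_inv, Ei. trivial.
  - unfold Q. rewrite index_inv, Ei, We, W0; trivial. ring. intros E; apply RtoC_inj in E; lra. rewrite Ei. trivial.
  - intros z Hz. unfold Q in Hz. apply supp_inv in Hz. apply supp_right_square in Hz; trivial. rewrite <- (Cinv_inv z). apply Cmod_inv_lt1.
    eapply Rlt_le_trans. exact Hsg. eapply Rle_trans. exact Hz. apply Re_le_Cmod.
Qed.

(** Two moves.  With w on a tiny loop about 0, the z-contour J can be deformed freely off 0, e and 1/e, into R about 1/e and the inverse of R about e,
as both have the same winding numbers.  Then the w-loop is enlarged to the unit square: it does not reach R, but crosses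
the inverse of R, and leaves a residue there. *)
Lemma kernel_reduce (e sg h : R) l0 J W F :
  0 < e < 1 -> 2 <= sg -> 0 < h -> sg < / e -> / e < sg + 2 * h ->
  good l0 -> closed_chain l0 -> good J -> closed_chain J ->
  (~ supp l0 0%C /\ index l0 0 = two_pi_i) -> (~ supp J 0%C /\ index J 0 = 0%C) ->
  (~ supp J e /\ index J e = two_pi_i) -> (~ supp J (/ e)%R /\ index J (/ e)%R = two_pi_i) ->
  (forall z, supp J z -> ~ supp l0 z /\ index l0 z = 0%C) ->
  approx (RtoC 0 :: nil) W -> approx (poles e) F ->
  chint l0 (fun w => W w * cauchy_int J F w)%C =
  (chint (square 0 1) (fun w => W w * cauchy_int (right_square sg h) F w) +
   chint (square 0 1) (fun w => W w * cauchy_int (inv_chain (right_square sg h)) F w) -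
   two_pi_i * chint (inv_chain (right_square sg h)) (fun z => F z * W z))%C.
Proof.
  intros He Hsg Hh Hs1 Hs2 Gl Cl GJ CJ [Hl0 Wl0] [HJ0 WJ0] [HJe WJe] [HJi WJi] HlJ AW AF.
  assert (Hie : 0 < / e) by (apply Rinv_0_lt_compat; lra).
  destruct (right_square_out sg h 0%C Hh) as [NR0 WR0]. simpl; lra.
  destruct (right_square_out sg h e Hh) as [NRe WRe]. simpl; lra.
  destruct (right_square_in sg h (/ e) Hh Hs1 Hs2) as [NRi WRi].
  destruct (right_square_inv sg h e He) as [GQ [CQ [[NQ0 WQ0] [[NQe WQe] [[NQi WQi] HQ]]]]]; trivial; try lra.
  assert (GR : good (right_square sg h)) by apply good_square. assert (CR : closed_chain (right_square sg h)) by apply closed_square.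
  assert (HR : forall z, supp (right_square sg h) z -> sg <= Re z) by (intros z; apply supp_right_square; trivial).
  set (R1 := right_square sg h) in *. set (Q := inv_chain R1) in *.
  assert (GRQ : good (R1 ++ Q)) by (apply good_app; trivial).
  assert (CRQ : closed_chain (R1 ++ Q)) by (apply closed_app; trivial).
  assert (NRQ0 : ~ supp (R1 ++ Q) 0%C) by (rewrite supp_app; tauto).
  destruct (supp_closed J 0%C GJ HJ0) as [dJ [HdJ DJ]].
  destruct (supp_closed (R1 ++ Q) 0%C GRQ NRQ0) as [dR [HdR DR]].
  assert (Hr : exists r, 0 < r /\ 4 * r <= dJ /\ 4 * r <= dR /\ 4 * r <= 1).
  { exists (Rmin 1 (Rmin dJ dR) / 4).
    assert (0 < Rmin 1 (Rmin dJ dR)) by (repeat apply Rmin_glb_lt; lra).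
    assert (M1 := Rmin_l 1 (Rmin dJ dR)). assert (M2 := Rmin_r 1 (Rmin dJ dR)).
    assert (M3 := Rmin_l dJ dR). assert (M4 := Rmin_r dJ dR). repeat split; lra. }
  destruct Hr as [r [Hr0 [Hr1 [Hr2 Hr3]]]].
  set (U' := square 0 r).
  assert (GU' : good U') by apply good_square. assert (CU' : closed_chain U') by apply closed_square.
  assert (GU := good_square 0 1). assert (CU := closed_square 0 1).
  destruct (sq0_in r 0%C Hr0) as [NU'0 WU'0]. rewrite Cmod_0; trivial. fold U' in NU'0, WU'0.
  destruct (index_U_in 0%C) as [NU0 WU0]. rewrite Cmod_0; lra.
  assert (HU' : forall w, supp U' w -> Cmod w < dJ /\ Cmod w < dR).
  { intros w Hw. apply Cmod_sq0 in Hw; trivial. lra. }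
  assert (HJU' : forall z, supp J z -> ~ supp U' z /\ index U' z = 0%C).
  { intros z Hz. apply sq0_out; trivial. specialize (DJ z Hz). replace (z - 0)%C with z in DJ by ring. lra. }
  assert (HRU' : forall z, supp R1 z \/ supp Q z -> ~ supp U' z /\ index U' z = 0%C).
  { intros z Hz. apply supp_app in Hz. apply sq0_out; trivial. specialize (DR z Hz). replace (z - 0)%C with z in DR by ring. lra. }
  assert (AvJ : avoids_list (supp J) (poles e)) by (apply avoids_3; trivial).
  assert (AvR : avoids_list (supp R1) (poles e)) by (apply avoids_3; trivial).
  assert (AvQ : avoids_list (supp Q) (poles e)) by (apply avoids_3; trivial).
  assert (AvRQ : avoids_list (supp (R1 ++ Q)) (poles e)).
  { intros a Ha. rewrite supp_app. intros [H|H]; [apply (AvR a Ha H) | apply (AvQ a Ha H)]. }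
  assert (CFJ : cont_on (supp J) F) by eauto using approx_cont.
  assert (CFR : cont_on (supp R1) F) by eauto using approx_cont.
  assert (CFQ : cont_on (supp Q) F) by eauto using approx_cont.
  assert (CFRQ : cont_on (supp (R1 ++ Q)) F) by eauto using approx_cont.
  assert (CWU' : cont_on (supp U') W) by (eapply approx_cont; eauto using avoids_1).
  (* shrink the w-contour to a tiny square around 0 *)
  rewrite (double_cauchy l0 U' J (RtoC 0 :: nil) W F 0); eauto using avoids_1.
  2:{ intros a [<-|[]]. congruence. }
  2:{ intros z Hz. destruct (HlJ z Hz) as [A1 B1]. destruct (HJU' z Hz) as [A2 B2]. rewrite B1, B2. repeat split; trivial. ring. }
  (* seen from there, the z-contour is a loop about e plus a loop about 1/e *)
  assert (Inner : forall w, supp U' w -> cauchy_int J F w%C =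
     (cauchy_int R1 F w + cauchy_int Q F w)%C).
  { intros w Hw. destruct (HU' w Hw) as [Hw1 Hw2].
    destruct (index_near J dJ w GJ CJ DJ Hw1) as [NJ WJ]. destruct (index_near (R1 ++ Q) dR w GRQ CRQ DR Hw2) as [NR WR].
    assert (Nw0 : w <> 0%C). { intros ->. auto. }
    rewrite <- chint_app, !kernel_sign; trivial. f_equal.
    assert (Na : ~ In w (poles e)).
    { assert (Cmod w <= 2 * r) by (apply Cmod_sq0; trivial).
      intros [E|[E|[E|[]]]]; auto.
      - assert (Cmod (RtoC e) < dR) by (rewrite E; trivial).
        destruct (index_near (R1 ++ Q) dR e GRQ CRQ DR H0) as [_ X]. rewrite !index_app, WRe, WQe, WR0, WQ0 in X.
        apply two_pi_i_neq_0. replace two_pi_i with (0 + two_pi_i)%C by ring. rewrite X. ring.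
      - assert (Cmod (RtoC (/ e)) < 1) by (rewrite E; lra). rewrite Cmod_R, Rabs_pos_eq in H0 by lra. lra. }
    assert (E := cauchy_diff J (R1 ++ Q) _ F w GJ GRQ CJ CRQ AvJ AvRQ).
    rewrite WJ, WR, WJ0, index_app, WR0, WQ0 in E.
    apply Ceq_minus. rewrite E; trivial. ring.
    intros a [<-|[<-|[<-|[]]]]; rewrite index_app; rewrite ?WJ0, ?WR0, ?WQ0, ?WJe, ?WRe, ?WQe, ?WJi, ?WRi, ?WQi; ring. }
  rewrite (chint_ext U' _ (fun w => W w * cauchy_int R1 F w + W w * cauchy_int Q F w)%C); trivial.
  2:{ intros w Hw. rewrite (Inner w Hw). ring. }
  rewrite chint_plus; trivial.
  2:{ apply cont_on_mult; trivial. apply kernel_int_cont; trivial. intros w Hw Hs. apply (HRU' w); auto. }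
  2:{ apply cont_on_mult; trivial. apply kernel_int_cont; trivial. intros w Hw Hs. apply (HRU' w); auto. }
  (* enlarge the w-contour to the unit square, crossing the loop about e *)
  rewrite (double_cauchy U' (square 0 1) R1 (RtoC 0 :: nil) W F 0); eauto using avoids_1.
  2:{ intros a [<-|[]]. congruence. }
  2:{ intros z Hz. destruct (HRU' z) as [A1 B1]; auto. destruct (index_U_out z) as [A2 B2]. specialize (HR z Hz); lra. rewrite B1, B2. repeat split; trivial. ring. }
  rewrite (double_cauchy U' (square 0 1) Q (RtoC 0 :: nil) W F (- two_pi_i)); eauto using avoids_1.
  2:{ intros a [<-|[]]. congruence. }
  2:{ intros z Hz. destruct (HRU' z) as [A1 B1]; auto. destruct (index_U_in z (HQ z Hz)) as [A2 B2]. rewrite B1, B2. repeat split; trivial. ring. }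
  ring.
Qed.

(** The contour l0 leaves e outside while the unit square encloses it; the loop about e makes up for this. *)
Lemma single_reduce (e sg h : R) l0 H :
  0 < e < 1 -> 2 <= sg -> 0 < h -> sg < / e -> / e < sg + 2 * h ->
  good l0 -> closed_chain l0 ->
  (~ supp l0 0%C /\ index l0 0 = two_pi_i) -> (~ supp l0 e /\ index l0 e = 0%C) -> (~ supp l0 (/ e)%R /\ index l0 (/ e)%R = 0%C) ->
  approx (poles e) H ->
  chint l0 H = (chint (square 0 1) H - chint (inv_chain (right_square sg h)) H)%C.
Proof.
  intros He Hsg Hh Hs1 Hs2 Gl Cl [N0 W0] [Ne We] [Ni Wi] AH.
  assert (Hie : 1 < / e) by lra.
  destruct (right_square_inv sg h e He) as [GQ [CQ [[NQ0 WQ0] [[NQe WQe] [[NQi WQi] HQ]]]]]; trivial; try lra.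
  destruct (index_U_in 0%C) as [NU0 WU0]. rewrite Cmod_0; lra.
  destruct (index_U_in e) as [NUe WUe]. rewrite Cmod_R, Rabs_pos_eq; lra.
  destruct (index_U_out (/ e)%R) as [NUi WUi]. simpl; lra.
  assert (E := cauchy_eq (l0 ++ inv_chain (right_square sg h)) (square 0 1) (poles e) H).
  rewrite chint_app in E. rewrite <- E; trivial. ring.
  - apply good_app; trivial.
  - apply good_square.
  - apply closed_app; trivial.
  - apply closed_square.
  - apply avoids_3; rewrite supp_app; tauto.
  - apply avoids_3; trivial.
  - intros a [<-|[<-|[<-|[]]]]; rewrite index_app; rewrite ?W0, ?We, ?Wi, ?WQ0, ?WQe, ?WQi, ?WU0, ?WUe, ?WUi; ring.
Qed.

(** The loop about e winds neither about 0 nor about 1/e. *)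
Lemma inner_loop_0 (e sg h : R) H :
  0 < e < 1 -> 2 <= sg -> 0 < h -> sg < / e -> / e < sg + 2 * h ->
  approx (RtoC 0 :: RtoC (/ e) :: nil) H -> chint (inv_chain (right_square sg h)) H = 0%C.
Proof.
  intros He Hsg Hh Hs1 Hs2 AH.
  destruct (right_square_inv sg h e He) as [GQ [CQ [[NQ0 WQ0] [[NQe WQe] [[NQi WQi] HQ]]]]]; trivial; try lra.
  change (RtoC 0) with (chint nil H). apply (cauchy_eq _ _ (RtoC 0 :: RtoC (/ e) :: nil)); trivial.
  - apply good_nil.
  - apply closed_nil.
  - intros a [<-|[<-|[]]]; trivial.
  - intros a _ [p [[] _]].
  - intros a [<-|[<-|[]]]; rewrite ?WQ0, ?WQi; reflexivity.
Qed.

(** * The weights *)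

Lemma Cpowz_nat z n : Cpowz z (Z.of_nat n) = (z ^ n)%C.
Proof. destruct n; trivial. simpl Z.of_nat. unfold Cpowz. rewrite SuccNat2Pos.id_succ. reflexivity. Qed.

Lemma Cpowz_opp z n : Cpowz z (- n) = (/ Cpowz z n)%C.
Proof.
  destruct n; simpl; trivial.
  - field.
  - rewrite Cinv_inv. reflexivity.
Qed.

Lemma Cpowz_sub (z : C) a b : z <> 0%C -> Cpowz z (Z.of_nat a - Z.of_nat b) = (z ^ a * / z ^ b)%C.
Proof.
  intros Hz. assert (Nz := fun n => Cpow_nz z n Hz).
  destruct (Nat.le_ge_cases b a) as [H|H].
  - replace (Z.of_nat a - Z.of_nat b)%Z with (Z.of_nat (a - b)) by lia. rewrite Cpowz_nat.
    replace (z ^ a)%C with (z ^ (a - b) * z ^ b)%C by (rewrite <- Cpow_add_r; f_equal; lia). field. auto.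
  - replace (Z.of_nat a - Z.of_nat b)%Z with (- Z.of_nat (b - a))%Z by lia. rewrite Cpowz_opp, Cpowz_nat.
    replace (z ^ b)%C with (z ^ (b - a) * z ^ a)%C by (rewrite <- Cpow_add_r; f_equal; lia). field. auto.
Qed.

Lemma Z_diff n : exists a b, n = (Z.of_nat a - Z.of_nat b)%Z.
Proof. exists (Z.to_nat n), (Z.to_nat (- n)). lia. Qed.

Lemma Cpowz_neq_0 (z : C) n : z <> 0%C -> Cpowz z n <> 0%C.
Proof.
  intros Hz. destruct (Z_diff n) as [a [b ->]]. rewrite Cpowz_sub; trivial. apply Cmult_neq_0.
  apply Cpow_nz; trivial. apply Cinv_neq_0, Cpow_nz; trivial.
Qed.

Lemma Cpowz_add (z : C) n m : z <> 0%C -> Cpowz z (n + m) = (Cpowz z n * Cpowz z m)%C.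
Proof.
  intros Hz. assert (Nz := fun n => Cpow_nz z n Hz). destruct (Z_diff n) as [a [b ->]]. destruct (Z_diff m) as [c [d ->]].
  replace (Z.of_nat a - Z.of_nat b + (Z.of_nat c - Z.of_nat d))%Z with (Z.of_nat (a + c) - Z.of_nat (b + d))%Z by lia.
  rewrite !Cpowz_sub, !Cpow_add_r; trivial. field. auto.
Qed.

Lemma Cpowz_inv (z : C) n : z <> 0%C -> Cpowz (/ z) n = Cpowz z (- n).
Proof.
  intros Hz. assert (Nz := fun n => Cpow_nz z n Hz). rewrite Cpowz_opp. destruct (Z_diff n) as [a [b ->]].
  rewrite !Cpowz_sub; trivial; try (apply Cinv_neq_0; trivial). rewrite !Cpow_inv; trivial. field. auto.
Qed.

Lemma Cpowz_1 z : Cpowz z 1 = z.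
Proof. simpl. ring. Qed.

Lemma Cpowz_add_1 (z : C) n : z <> 0%C -> Cpowz z (n + 1) = (Cpowz z n * z)%C.
Proof. intros Hz. rewrite Cpowz_add, Cpowz_1; trivial. Qed.

Lemma Cinv_mult (a b : C) : a <> 0%C -> b <> 0%C -> (/ (a * b) = / a * / b)%C.
Proof. intros. field. auto. Qed.

(** The kernel weight, with the exponents [m/2] and [(m+1)/2] as natural numbers. *)
Definition wt (t e : R) (a b : nat) (y : Z) (w : C) : C :=
  (Cexp (t * (w + / w)) * (1 - e * w) ^ a * (1 - e / w) ^ b * Cpowz w y)%C.

(** The inverse of the limit weight times a power of w, up to the constant e^(eps^2) coming
from (w + 1/w)^2 = w^2 + w^(-2) + 2, which cancels in the limit kernel. *)
Definition lim_wt (eps mu : R) (y : Z) (w : C) : C :=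
  (Cexp (- (eps * mu * (w + / w) + eps ^ 2 / 2 * (w * w + / w * / w))) * Cpowz w y)%C.

(** The symmetry behind the whole argument: inversion exchanges the exponents. *)
Lemma wt_inv t e a b y (w : C) : w <> 0%C -> wt t e a b y (/ w) = wt t e b a (- y) w.
Proof.
  intros Hw. unfold wt. rewrite Cpowz_inv; trivial. unfold Cdiv. rewrite Cinv_inv. rewrite (Cplus_comm (/ w) w). ring.
Qed.

Lemma lim_wt_inv eps mu y (w : C) : w <> 0%C -> lim_wt eps mu y (/ w) = lim_wt eps mu (- y) w.
Proof.
  intros Hw. unfold lim_wt. rewrite Cpowz_inv; trivial. rewrite Cinv_inv. f_equal. f_equal. ring.
Qed.

Lemma wt_shift t e a b y (w : C) : w <> 0%C -> wt t e a b (y + 1) w = (wt t e a b y w * w)%C.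
Proof. intros Hw. unfold wt. rewrite Cpowz_add_1; trivial. ring. Qed.

Lemma lim_wt_shift eps mu y (w : C) : w <> 0%C -> lim_wt eps mu (y + 1) w = (lim_wt eps mu y w * w)%C.
Proof. intros Hw. unfold lim_wt. rewrite Cpowz_add_1; trivial. ring. Qed.

Lemma wt_inv_shift t e a b y (w : C) : w <> 0%C -> (wt t e a b y (/ w) * / w)%C = wt t e b a (- y - 1) w.
Proof.
  intros Hw. rewrite wt_inv; trivial. replace (- y)%Z with ((- y - 1) + 1)%Z at 1 by ring.
  rewrite wt_shift; trivial. field. trivial.
Qed.

Lemma lim_wt_inv_shift eps mu y (w : C) : w <> 0%C -> (lim_wt eps mu y (/ w) * / w)%C = lim_wt eps mu (- y - 1) w.
Proof.
  intros Hw. rewrite lim_wt_inv; trivial. replace (- y)%Z with ((- y - 1) + 1)%Z at 1 by ring.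
  rewrite lim_wt_shift; trivial. field. trivial.
Qed.

(** The points where the weight is neither singular nor zero. *)
Definition regular_pt (e : R) (w : C) : Prop := w <> 0%C /\ (1 - e * w <> 0)%C /\ (1 - e / w <> 0)%C.

Lemma wt_neq_0 t e a b y w : regular_pt e w -> wt t e a b y w <> 0%C.
Proof.
  intros [H0 [H1 H2]]. unfold wt. repeat apply Cmult_neq_0. apply Cexp_neq_0. apply Cpow_nz; trivial. apply Cpow_nz; trivial. apply Cpowz_neq_0; trivial.
Qed.

Lemma lim_wt_neq_0 eps mu y (w : C) : w <> 0%C -> lim_wt eps mu y w <> 0%C.
Proof. intros H. unfold lim_wt. apply Cmult_neq_0. apply Cexp_neq_0. apply Cpowz_neq_0; trivial. Qed.

Lemma regular_avoid (e : R) (w : C) : 0 < e -> ~ In w (poles e) -> regular_pt e w.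
Proof.
  intros He H. assert (Ne : RtoC e <> 0%C) by (intros E; apply RtoC_inj in E; lra).
  assert (H0 : w <> 0%C). { intros E; apply H; left; auto. } split; trivial. split.
  - intros E. apply H. right; right; left. rewrite RtoC_inv by lra.
    replace w with ((e * w) * / e)%C by (field; trivial). replace (e * w)%C with (1 - (1 - e * w))%C by ring. rewrite E. field; trivial.
  - intros E. apply H. right; left. replace (RtoC e) with ((e / w) * w)%C by (field; trivial).
    replace (e / w)%C with (1 - (1 - e / w))%C by ring. rewrite E. ring.
Qed.

Lemma approx_inv0 A : In (RtoC 0) A -> approx A (fun z => / z)%C.
Proof. intros H. apply (approx_ext A (fun z => / (z - 0))%C). intros z _. f_equal. ring. apply approx_pole; trivial. Qed.

Lemma approx_Cpowz A n : In (RtoC 0) A -> approx A (fun z => Cpowz z n).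
Proof.
  intros H. destruct (Z_diff n) as [a [b ->]]. apply (approx_ext A (fun z => z ^ a * (/ z) ^ b)%C).
  - intros z Hz. assert (z <> 0%C). { intros E. subst. auto. } rewrite Cpowz_sub, Cpow_inv; trivial.
  - apply approx_mult; apply approx_pow. apply approx_id. apply approx_inv0; trivial.
Qed.

Lemma approx_minus A f g : approx A f -> approx A g -> approx A (fun z => f z - g z)%C.
Proof.
  intros Hf Hg. apply (approx_ext A (fun z => f z + (-1) * g z)%C). intros; ring.
  apply approx_plus; trivial. apply approx_mult; trivial. apply approx_const.
Qed.

Lemma approx_wt A t e a b y : In (RtoC 0) A -> approx A (wt t e a b y).
Proof.
  intros H. unfold wt, Cdiv. assert (H0 := approx_inv0 A H).
  repeat apply approx_mult.
  - apply approx_exp. apply approx_mult. apply approx_const. apply approx_plus; trivial. apply approx_id.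
  - apply approx_pow, approx_minus. apply approx_const. apply approx_mult. apply approx_const. apply approx_id.
  - apply approx_pow, approx_minus. apply approx_const. apply approx_mult; trivial. apply approx_const.
  - apply approx_Cpowz; trivial.
Qed.

Lemma approx_lim_wt A eps mu y : In (RtoC 0) A -> approx A (lim_wt eps mu y).
Proof.
  intros H. unfold lim_wt. assert (H0 := approx_inv0 A H). apply approx_mult. 2: apply approx_Cpowz; trivial.
  apply approx_exp.
  apply (approx_ext A (fun w => (-1) * (eps * mu * (w + / w) + eps ^ 2 / 2 * (w * w + / w * / w)))%C). intros; ring.
  apply approx_mult. apply approx_const. apply approx_plus; (apply approx_mult; [apply approx_const|]); apply approx_plus; trivial.
  apply approx_id. apply approx_mult; apply approx_id. apply approx_mult; trivial.
Qed.

Lemma approx_inv_lim_wt A eps mu y : In (RtoC 0) A -> approx A (fun z => / lim_wt eps mu y z)%C.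
Proof.
  intros H. assert (H0 := approx_inv0 A H).
  apply (approx_ext A (fun w => Cexp (eps * mu * (w + / w) + eps ^ 2 / 2 * (w * w + / w * / w)) * Cpowz w (- y))%C).
  { intros w Hw. assert (w <> 0%C). { intros E. subst. auto. } unfold lim_wt. rewrite Cpowz_opp, Cexp_opp, Cinv_mult, Cinv_inv; trivial. apply Cinv_neq_0, Cexp_neq_0. apply Cpowz_neq_0; trivial. }
  apply approx_mult. 2: apply approx_Cpowz; trivial.
  apply approx_exp. apply approx_plus; (apply approx_mult; [apply approx_const|]); apply approx_plus; trivial.
  apply approx_id. apply approx_mult; apply approx_id. apply approx_mult; trivial.
Qed.

Lemma approx_inv_wt t e a b y : 0 < e -> approx (poles e) (fun z => / wt t e a b y z)%C.
Proof.
  intros He. set (A := RtoC 0 :: RtoC e :: RtoC (/ e) :: nil). assert (H : In (RtoC 0) A) by (left; trivial).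
  assert (Ne : RtoC e <> 0%C) by (intros E; apply RtoC_inj in E; lra).
  assert (H0 := approx_inv0 A H).
  apply (approx_ext A (fun w => Cexp (- t * (w + / w)) * (- / e * / (w - RtoC (/ e))) ^ a * (w * / (w - e)) ^ b * Cpowz w (- y))%C).
  { intros w Hw. destruct (regular_avoid e w He Hw) as [W0 [W1 W2]]. unfold wt. rewrite Cpowz_opp.
    replace (- t * (w + / w))%C with (- (t * (w + / w)))%C by ring. rewrite Cexp_opp.
    assert (W3 : (w - RtoC (/ e) <> 0)%C) by (apply (not_in_neq A); trivial; right; right; left; trivial).
    assert (W4 : (w - e <> 0)%C) by (apply (not_in_neq A); trivial; right; left; trivial).
    rewrite !Cinv_mult; try apply Cmult_neq_0; try apply Cmult_neq_0; try apply Cexp_neq_0; try apply Cpow_nz; try apply Cpowz_neq_0; trivial.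
    rewrite <- !Cpow_inv; trivial. f_equal. f_equal; [f_equal|]; f_equal.
    - rewrite RtoC_inv by lra. rewrite RtoC_inv in W3 by lra.
      replace (1 - e * w)%C with (- e * (w - / e))%C by (field; trivial). field. split; trivial.
      intros E. apply W1. replace (1 - e * w)%C with (- (w * e - 1))%C by ring. rewrite E. ring.
    - field. repeat split; trivial. }
  repeat apply approx_mult.
  - apply approx_exp. apply approx_mult. apply approx_const. apply approx_plus; trivial. apply approx_id.
  - apply approx_pow, approx_mult. apply approx_const. apply approx_pole. right; right; left; trivial.
  - apply approx_pow, approx_mult. apply approx_id. apply approx_pole. right; left; trivial.
  - apply approx_Cpowz; trivial.
Qed.

(** When the exponents of the first weight dominate, the quotient is a polynomial in z and 1/z: no pole at e. *)
Definition wt_quot (t e : R) (a b : nat) (y : Z) (w : C) : C := ((1 - e * w) ^ a * (1 - e / w) ^ b * Cpowz w y)%C.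

Lemma approx_wt_quot A t e a b y : In (RtoC 0) A -> approx A (wt_quot t e a b y).
Proof.
  intros H. unfold wt_quot, Cdiv. assert (H0 := approx_inv0 A H).
  repeat apply approx_mult.
  - apply approx_pow, approx_minus. apply approx_const. apply approx_mult. apply approx_const. apply approx_id.
  - apply approx_pow, approx_minus. apply approx_const. apply approx_mult; trivial. apply approx_const.
  - apply approx_Cpowz; trivial.
Qed.

Lemma wt_quot_eq t e a1 b1 y1 a2 b2 y2 w : (a2 <= a1)%nat -> (b2 <= b1)%nat -> regular_pt e w ->
  (wt t e a1 b1 y1 w * / wt t e a2 b2 y2 w)%C = wt_quot t e (a1 - a2) (b1 - b2) (y1 - y2) w.
Proof.
  intros Ha Hb Hw. assert (Nw := wt_neq_0 t e a2 b2 y2 w Hw). destruct Hw as [H0 [H1 H2]].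
  replace (wt t e a1 b1 y1 w) with (wt t e a2 b2 y2 w * wt_quot t e (a1 - a2) (b1 - b2) (y1 - y2) w)%C.
  field; trivial.
  unfold wt, wt_quot. replace a1 with (a2 + (a1 - a2))%nat at 2 by lia. replace b1 with (b2 + (b1 - b2))%nat at 2 by lia.
  replace y1 with (y2 + (y1 - y2))%Z at 2 by lia. rewrite !Cpow_add_r, Cpowz_add; trivial. ring.
Qed.

(** * The kernel on fixed contours *)

Definition double_int (k : chain) (W F : C -> C) : C :=
  chint (square 0 1) (fun w => W w * cauchy_int k F w)%C.

Lemma contour_int_ext c f g : (forall s, 0 <= s <= 1 -> f (c s) = g (c s)) -> contour_int c f = contour_int c g.
Proof.
  intros H. unfold contour_int. apply (RInt_ext (V := C_R_CompleteNormedModule)). rewrite Rmin_left, Rmax_right by lra. intros x Hx. rewrite H by lra. reflexivity.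
Qed.

Lemma cycle_int_ext gs f g : (forall c s, In c gs -> 0 <= s <= 1 -> f (c s) = g (c s)) -> cycle_int gs f = cycle_int gs g.
Proof.
  unfold cycle_int. induction gs as [|c gs IH]; simpl; intros H; trivial. f_equal.
  apply contour_int_ext. intros; apply H; auto. apply IH. intros; apply H; auto.
Qed.

Lemma kernel_weight_wt t e x m a b w : (m / 2 = Z.of_nat a)%Z -> ((m + 1) / 2 = Z.of_nat b)%Z ->
  kernel_weight t e (IZR x) m w = wt t e a b x w.
Proof.
  intros Ha Hb. unfold kernel_weight, wt. rewrite Ha, Hb, !Cpowz_nat, ZfloorZ. reflexivity.
Qed.

(** If m1 < m2, the residue left by [kernel_reduce] cancels the loop about e left by [single_reduce]; otherwise the single
integral is absent and the residue vanishes by [inner_loop_0]. *)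
Lemma K_reduced (t e sg h : R) g0 gs x1 m1 x2 m2 a1 b1 a2 b2 :
  0 < e < 1 -> 2 <= sg -> 0 < h -> sg < / e -> / e < sg + 2 * h -> kernel_contours e g0 gs ->
  (m1 / 2 = Z.of_nat a1)%Z -> ((m1 + 1) / 2 = Z.of_nat b1)%Z ->
  (m2 / 2 = Z.of_nat a2)%Z -> ((m2 + 1) / 2 = Z.of_nat b2)%Z ->
  K t e g0 gs (IZR x1) m1 (IZR x2) m2 =
  (- ((if Z_lt_dec m1 m2 then 1 else 0) / two_pi_i)
     * chint (square 0 1) (fun w => wt t e a1 b1 x1 w * / wt t e a2 b2 (x2 + 1) w)
   + / (two_pi_i * two_pi_i) *
     (double_int (right_square sg h) (wt t e a1 b1 x1) (fun z => / wt t e a2 b2 (x2 + 1) z) +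
      double_int (right_square sg h) (wt t e b1 a1 (- x1 - 1)) (fun z => / wt t e b2 a2 (- x2) z)))%C.
Proof.
  intros He Hsg Hh Hs1 Hs2 [Hg0 [E0 [Oe [Oi [Hgs [Je [Ji [J0 HJ]]]]]]]] Ha1 Hb1 Ha2 Hb2.
  destruct (cycle_chain (g0 :: nil)) as [l0 [Gl [Cl [Sl Il]]]]. { intros c [<-|[]]; trivial. }
  destruct (cycle_chain gs Hgs) as [J [GJ [CJ [SJ IJ]]]].
  assert (Ec : (/ RtoC e)%C = RtoC (/ e)) by (rewrite RtoC_inv; [reflexivity | lra]).
  rewrite Ec in Oi, Ji.
  destruct (encircles_index _ _ _ Sl Il E0) as [Nl0 Wl0]. destruct (outside_index _ _ _ Sl Il Oe) as [Nle Wle].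
  destruct (outside_index _ _ _ Sl Il Oi) as [Nli Wli].
  destruct (outside_index _ _ _ SJ IJ J0) as [NJ0 WJ0]. destruct (encircles_index _ _ _ SJ IJ Je) as [NJe WJe].
  destruct (encircles_index _ _ _ SJ IJ Ji) as [NJi WJi].
  assert (HlJ : forall z, supp J z -> ~ supp l0 z /\ index l0 z = 0%C).
  { intros z Hz. apply SJ in Hz. destruct Hz as [c [s [Hc [Hs ->]]]]. apply (outside_index _ _ _ Sl Il). apply HJ; trivial. }
  set (A := RtoC 0 :: RtoC e :: RtoC (/ e) :: nil).
  assert (Avl : avoids_list (supp l0) A) by (apply avoids_3; trivial).
  assert (AvJ : avoids_list (supp J) A) by (apply avoids_3; trivial).
  set (W := wt t e a1 b1 x1). set (F := fun z => (/ wt t e a2 b2 (x2 + 1) z)%C).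
  assert (AW : approx (RtoC 0 :: nil) W) by (apply approx_wt; left; trivial).
  assert (AW3 : approx A W) by (apply approx_wt; left; trivial).
  assert (AF : approx A F) by (apply approx_inv_wt; lra).
  assert (CWl : cont_on (supp l0) W) by eauto using approx_cont.
  assert (CFl : cont_on (supp l0) F) by eauto using approx_cont.
  assert (CFJ : cont_on (supp J) F) by eauto using approx_cont.
  assert (Int0 : forall f, contour_int g0 f = cycle_int (g0 :: nil) f) by (intros f; unfold cycle_int; simpl; ring).
  assert (Sg0 : forall s, 0 <= s <= 1 -> supp l0 (g0 s)). { intros s Hs. apply Sl. exists g0, s. split; [left|]; auto. }
  assert (SgJ : forall c s, In c gs -> 0 <= s <= 1 -> supp J (c s)). { intros c s Hc Hs. apply SJ. exists c, s. auto. }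
  assert (Reg : forall X w, avoids_list X A -> X w -> regular_pt e w).
  { intros X w HX Hw. apply regular_avoid. lra. eapply avoids_not_in; eassumption. }
  unfold K.
  rewrite (contour_int_ext g0 _ (fun w => W w * F w)%C).
  2:{ intros s Hs. assert (R0 := Reg _ _ Avl (Sg0 s Hs)). destruct R0 as [N0 [N1 N2]].
      unfold W, F. rewrite wt_shift; trivial. unfold wt. rewrite Ha1, Ha2, Hb1, Hb2, !ZfloorZ, !Cpowz_sub; trivial.
      replace (x1 - x2)%Z with (x1 + - x2)%Z by ring. rewrite Cpowz_add, Cpowz_opp; trivial. field.
      repeat split; trivial; try (apply Cpowz_neq_0; trivial); try (apply Cpow_nz; trivial). apply Cexp_neq_0. }
  rewrite (contour_int_ext g0 (fun w => cycle_int gs _) (fun w => W w * cauchy_int J F w)%C).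
  2:{ intros s Hs. assert (R0 := Reg _ _ Avl (Sg0 s Hs)). set (w := g0 s) in *.
      assert (Nw : ~ supp J w). { intros Hw. destruct (HlJ w Hw) as [H _]. apply H. apply Sg0; trivial. }
      rewrite (cycle_int_ext gs _ (fun z => W w * (F z * / (w - z)))%C).
      - rewrite IJ. apply chint_scal; trivial. apply cont_on_kernel; trivial.
        apply cont_on_mult. apply cont_on_const. apply cont_on_kernel; trivial.
      - intros c r Hc Hr. assert (R1 := Reg _ _ AvJ (SgJ c r Hc Hr)). set (z := c r) in *.
        rewrite (kernel_weight_wt _ _ _ _ a1 b1), (kernel_weight_wt _ _ _ _ a2 b2); trivial. fold W.
        assert (Nz := proj1 R1). unfold F. rewrite wt_shift; trivial. assert (Nwt := wt_neq_0 t e a2 b2 x2 z R1).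
        assert (w - z <> 0)%C. { intros E. apply Nw. apply Ceq_minus in E. rewrite E. apply SgJ; trivial. }
        field. auto. }
  rewrite !Int0, !Il.
  2:{ apply cont_on_mult; trivial. apply kernel_int_cont; trivial. intros w Hw Hs. destruct (HlJ w Hs). auto. }
  2:{ apply cont_on_mult; trivial. }
  rewrite (kernel_reduce e sg h l0 J W F); auto.
  rewrite (single_reduce e sg h l0 (fun w => W w * F w)%C); auto. 2: apply approx_mult; trivial.
  assert (Hie : 1 < / e) by lra.
  destruct (right_square_inv sg h e He) as [GQ [CQ [[NQ0 WQ0] [[NQe WQe] [[NQi WQi] HQ]]]]]; trivial; try lra.
  destruct (right_square_out sg h 0%C Hh) as [NR0 _]. simpl; lra.
  destruct (right_square_out sg h e Hh) as [NRe _]. simpl; lra.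
  destruct (right_square_in sg h (/ e) Hh Hs1 Hs2) as [NRi _].
  assert (AvQ : avoids_list (supp (inv_chain (right_square sg h))) A) by (apply avoids_3; trivial).
  assert (AvR : avoids_list (supp (right_square sg h)) A) by (apply avoids_3; trivial).
  assert (GU := good_square 0 1). assert (CU := closed_square 0 1).
  destruct (index_U_in 0%C) as [NU0 WU0]. rewrite Cmod_0; lra.
  assert (Wn : forall w : C, w <> 0%C -> (W (/ w) * / w)%C = wt t e b1 a1 (- x1 - 1) w) by (intros w Hw; apply wt_inv_shift; trivial).
  assert (Fn : forall u : C, regular_pt e u -> (F (/ u) * / u)%C = (/ wt t e b2 a2 (- x2) u)%C).
  { intros u Hu. assert (Hu0 := proj1 Hu). unfold F. rewrite wt_inv; trivial. replace (- x2)%Z with (- (x2 + 1) + 1)%Z by ring.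
    rewrite wt_shift; trivial. rewrite Cinv_mult; trivial. apply wt_neq_0; destruct Hu as [H1 [H2 H3]]; repeat split; trivial. }
  (* inversion turns the loop about e into the square about 1/e *)
  rewrite (inv_side (square 0 1) (right_square sg h) W F); trivial.
  2: apply good_square.
  2:{ eapply approx_cont; eauto using avoids_1. }
  2:{ apply (approx_ext _ (wt t e b1 a1 (- x1 - 1))). intros w Hw. symmetry; apply Wn. intros E; apply Hw; left; auto. apply approx_wt; left; trivial. }
  2:{ apply (cont_on_ext _ (fun z => / wt t e b2 a2 (- x2) z)%C). intros u Hu. symmetry; apply Fn. apply (Reg _ _ AvR Hu).
      eapply approx_cont; [apply good_square | exact AvR | apply approx_inv_wt; lra]. }
  2:{ intros z Hz. apply supp_right_square in Hz; trivial. assert (1 < Cmod z). { assert (T := Re_le_Cmod z). lra. }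
      split. lra. apply index_U_in, Cmod_inv_lt1; trivial. }
  rewrite (chint_ext (square 0 1) (fun w => W (/ w) * / w * _)%C (fun w => wt t e b1 a1 (- x1 - 1) w * chint (right_square sg h) (fun z => / wt t e b2 a2 (- x2) z * / (w - z)))%C); trivial.
  2:{ intros w Hw. rewrite Wn. f_equal. apply chint_ext. apply good_square. intros z Hz. rewrite Fn; trivial. apply (Reg _ _ AvR Hz).
      intros ->. auto. }
  fold (double_int (right_square sg h) W F). fold (double_int (right_square sg h) (wt t e b1 a1 (- x1 - 1)) (fun z => / wt t e b2 a2 (- x2) z)%C).
  rewrite (chint_ext (inv_chain (right_square sg h)) (fun z => F z * W z)%C (fun z => W z * F z)%C); trivial. 2: intros; ring.
  change (chint (square 0 1) (fun w => W w * / wt t e a2 b2 (x2 + 1) w)%C) with (chint (square 0 1) (fun w => W w * F w)%C).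
  destruct (Z_lt_dec m1 m2) as [Hm|Hm].
  - field. apply two_pi_i_neq_0.
  - replace (chint (inv_chain (right_square sg h)) (fun z => W z * F z)%C) with (RtoC 0). field. apply two_pi_i_neq_0.
    symmetry. rewrite (chint_ext _ _ (wt_quot t e (a1 - a2) (b1 - b2) (x1 - (x2 + 1)))); trivial.
    apply (inner_loop_0 e); trivial. apply approx_wt_quot; left; trivial.
    intros z Hz. apply wt_quot_eq.
    + assert (m2 / 2 <= m1 / 2)%Z by (apply Z.div_le_mono; lia). lia.
    + assert ((m2 + 1) / 2 <= (m1 + 1) / 2)%Z by (apply Z.div_le_mono; lia). lia.
    + apply (Reg _ _ AvQ Hz).
Qed.

(** * Scaling of the weights on compact sets *)

(** The exponents attached to the section index 2 L^2 + 2 mu L + O(1). *)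
Definition near_section (mu L : R) (n : nat) : Prop := Rabs (INR n - (L ^ 2 + mu * L)) <= 2.

Definition growth (mu : R) (n : R -> nat) : Prop := exists L1, forall L, L1 <= L -> near_section mu L (n L).

Notation scaled_wt eps a b L y := (wt (eps * L) (eps / L) (a L) (b L) y).

(** The factor of the weight that depends on v = w, resp. on v = 1/w. *)
Definition factor (eps L : R) (n : nat) (v : C) : C := (Cexp (eps * L * v) * (1 - eps / L * v) ^ n)%C.
Definition factor_lim (eps mu : R) (v : C) : C := Cexp (- (eps * mu * v + eps ^ 2 / 2 * (v * v))).

(** With u = eps v / L and X = (1 - u) e^(u + u^2/2), the quotient is X^n e^th: here X^n = 1 + O(n |u|^3) = 1 + O(1/L), and th
collects the differences between n and L^2, which are O(1/L). *)
Lemma factor_asym (eps mu B : R) : 0 < eps -> 0 < B -> exists k L0, 0 < k /\ 1 <= L0 /\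
  forall L n v, L0 <= L -> near_section mu L n -> Cmod v <= B ->
    Cmod (factor eps L n v * / factor_lim eps mu v - 1) <= k / L.
Proof.
  intros He HB.
  set (C1 := 2 * eps * B + Rabs mu * eps ^ 2 * B ^ 2 + 2 * eps ^ 2 * B ^ 2).
  set (C2 := exp 2 * (eps * B) ^ 3). set (C3 := (3 + Rabs mu) * C2).
  assert (HeB : 0 < eps * B) by nra.
  assert (HC2 : 0 < C2) by (apply Rmult_lt_0_compat; [apply exp_pos | apply pow_lt; trivial]).
  assert (Hmu := Rabs_pos mu).
  assert (HC3 : 0 < C3) by (apply Rmult_lt_0_compat; lra).
  assert (HC1 : 0 < C1). { assert (0 < eps ^ 2 * B ^ 2) by (apply Rmult_lt_0_compat; apply pow_lt; trivial). unfold C1. nra. }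
  exists (exp C3 * C3 * exp C1 + exp C1 * C1), (Rmax 1 (eps * B)).
  assert (E3 := exp_pos C3). assert (E1 := exp_pos C1).
  split. { apply Rplus_lt_0_compat; [apply Rmult_lt_0_compat; [apply Rmult_lt_0_compat|]|apply Rmult_lt_0_compat]; trivial. }
  split. apply Rmax_l.
  intros L n v HL Hn Hv.
  assert (HL1 : 1 <= L) by (eapply Rle_trans; [apply Rmax_l | exact HL]).
  assert (HLB : eps * B <= L) by (eapply Rle_trans; [apply Rmax_r | exact HL]).
  assert (HiL : 0 < / L) by (apply Rinv_0_lt_compat; lra).
  assert (HLc : RtoC L <> 0%C) by (intros E; apply RtoC_inj in E; lra).
  assert (Hv0 := Cmod_ge_0 v).
  set (u := (eps / L * v)%C).
  assert (Hu : Cmod u <= eps * B / L).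
  { unfold u. rewrite <- RtoC_div by lra. rewrite Cmod_mult, Cmod_R, Rabs_pos_eq by (apply Rlt_le, Rdiv_lt_0_compat; lra).
    unfold Rdiv. replace (eps * B * / L) with (eps * / L * B) by ring. apply Rmult_le_compat_l; trivial. apply Rmult_le_pos; lra. }
  assert (Hu0 := Cmod_ge_0 u).
  assert (Hu1 : Cmod u <= 1). { eapply Rle_trans. exact Hu. apply Rle_div_l; lra. }
  set (X := ((1 - u) * Cexp (u + u * u / 2))%C).
  set (rho := INR n - (L ^ 2 + mu * L)).
  (* th is what remains of the exponent once n (u + u^2/2) has been split off *)
  set (th := (- (rho * (eps * v / L) + mu * (eps ^ 2 * (v * v) / (2 * L)) + rho * (eps ^ 2 * (v * v) / (2 * L * L))))%C).
  assert (Eq : (factor eps L n v * / factor_lim eps mu v = X ^ n * Cexp th)%C).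
  { unfold factor, factor_lim. rewrite <- Cexp_opp.
    replace (X ^ n)%C with ((1 - u) ^ n * Cexp (INR n * (u + u * u / 2)))%C by (unfold X; rewrite Cpow_mult_l, Cexp_INR; reflexivity).
    change (eps / L * v)%C with u.
    transitivity ((1 - u) ^ n * (Cexp (eps * L * v) * Cexp (- - (eps * mu * v + eps ^ 2 / 2 * (v * v)))))%C. ring.
    rewrite <- (Cmult_assoc ((1 - u) ^ n)%C), <- !Cexp_plus. f_equal. f_equal. unfold th, u.
    replace (INR n) with (rho + (L ^ 2 + mu * L)) by (unfold rho; ring). rewrite !RtoC_plus, !RtoC_mult, !RtoC_pow. field. trivial. }
  assert (Hth : Cmod th <= C1 / L).
  { unfold th. rewrite Cmod_opp.
    assert (Hn' : Rabs rho <= 2) by exact Hn.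
    eapply Rle_trans. apply Cmod_triangle. eapply Rle_trans. apply Rplus_le_compat_r. apply Cmod_triangle.
    unfold Cdiv. rewrite !Cmod_mult, !Cmod_inv, !Cmod_mult, !Cmod_R by (try (apply Cmult_neq_0); try (apply Cmult_neq_0); trivial; intros E; apply RtoC_inj in E; lra).
    rewrite <- !RtoC_pow, !Cmod_R. rewrite !(Rabs_pos_eq eps), !(Rabs_pos_eq L), !(Rabs_pos_eq 2), !(Rabs_pos_eq (eps ^ 2)) by (try apply pow_le; lra).
    assert (Hvv : Cmod v * Cmod v <= B * B) by nra.
    assert (Hrho := Rabs_pos rho).
    assert (He2 : 0 < eps ^ 2) by (apply pow_lt; trivial).
    replace (C1 / L) with (2 * (eps * B * / L) + Rabs mu * (eps ^ 2 * (B * B) * / L) + 2 * (eps ^ 2 * (B * B) * / L)) by (unfold C1; field; lra).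
    apply Rplus_le_compat; [apply Rplus_le_compat|].
    - apply Rmult_le_compat; trivial. repeat apply Rmult_le_pos; lra. apply Rmult_le_compat_r. lra. apply Rmult_le_compat_l; lra.
    - apply Rmult_le_compat_l; trivial. rewrite Rinv_mult. apply Rmult_le_compat; try (repeat apply Rmult_le_pos; lra). apply Rmult_le_compat_l; lra.
    - apply Rmult_le_compat; trivial. repeat apply Rmult_le_pos; try lra. left; apply Rinv_0_lt_compat; nra.
      apply Rmult_le_compat; try (repeat apply Rmult_le_pos; lra). left; apply Rinv_0_lt_compat; nra. apply Rmult_le_compat_l; lra.
      apply Rinv_le_contravar. lra. nra. }
  assert (Hdelta : Cmod (X - 1) <= C2 / L ^ 3).
  { eapply Rle_trans. apply one_minus_exp_order3.
    replace (C2 / L ^ 3) with ((eps * B / L) ^ 2 * exp 2 * (eps * B / L)) by (unfold C2; field; lra).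
    apply Rmult_le_compat; trivial. apply Rmult_le_pos. apply pow_le; trivial. left; apply exp_pos.
    apply Rmult_le_compat. apply pow_le; trivial. left; apply exp_pos. apply pow_incr; auto. apply exp_le. nra. }
  assert (Hnd : INR n * Cmod (X - 1) <= C3 / L).
  { assert (INR n <= (3 + Rabs mu) * L ^ 2).
    { unfold near_section in Hn. apply Rabs_le_between in Hn. assert (mu <= Rabs mu) by apply Rle_abs.
      assert (L <= L ^ 2) by nra. assert (1 <= L ^ 2) by nra. assert (mu * L <= Rabs mu * L ^ 2) by nra. lra. }
    replace (C3 / L) with ((3 + Rabs mu) * L ^ 2 * (C2 / L ^ 3)) by (unfold C3; field; lra).
    apply Rmult_le_compat; trivial. apply pos_INR. apply Cmod_ge_0. }
  assert (HX : Cmod (X ^ n - 1) <= exp C3 * C3 / L).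
  { rewrite <- (Cpow_1_l n). eapply Rle_trans. apply (Cpow_diff X 1 (exp (Cmod (X - 1)))).
    - rewrite <- exp_0. apply exp_le, Cmod_ge_0.
    - replace X with (1 + (X - 1))%C at 1 by ring. eapply Rle_trans. apply Cmod_triangle. rewrite Cmod_1. apply one_plus_le_exp.
    - rewrite Cmod_1, <- exp_0. apply exp_le, Cmod_ge_0.
    - rewrite <- exp_INR.
      assert (C3 / L <= C3). { apply Rle_div_l; nra. }
      assert (exp (INR n * Cmod (X - 1)) <= exp C3) by (apply exp_le; lra).
      replace (INR n * exp (INR n * Cmod (X - 1)) * Cmod (X - 1)) with (exp (INR n * Cmod (X - 1)) * (INR n * Cmod (X - 1))) by ring.
      replace (exp C3 * C3 / L) with (exp C3 * (C3 / L)) by (unfold Rdiv; ring).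
      apply Rmult_le_compat; trivial. left; apply exp_pos. apply Rmult_le_pos. apply pos_INR. apply Cmod_ge_0. }
  assert (Hth1 : Cmod th <= C1). { eapply Rle_trans. exact Hth. apply Rle_div_l; nra. }
  assert (HE : Cmod (Cexp th - 1) <= exp C1 * C1 / L).
  { eapply Rle_trans. apply Cexp_order1. replace (exp C1 * C1 / L) with (exp C1 * (C1 / L)) by (unfold Rdiv; ring).
    apply Rmult_le_compat; trivial. left; apply exp_pos. apply Cmod_ge_0. apply exp_le; trivial. }
  assert (HE' : Cmod (Cexp th) <= exp C1). { eapply Rle_trans. apply Cmod_Cexp_le. apply exp_le; trivial. }
  rewrite Eq. replace (X ^ n * Cexp th - 1)%C with ((X ^ n - 1) * Cexp th + (Cexp th - 1))%C by ring.
  eapply Rle_trans. apply Cmod_triangle. rewrite Cmod_mult.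
  replace ((exp C3 * C3 * exp C1 + exp C1 * C1) / L) with (exp C3 * C3 / L * exp C1 + exp C1 * C1 / L) by (field; lra).
  apply Rplus_le_compat; trivial. apply Rmult_le_compat; trivial; apply Cmod_ge_0.
Qed.

Definition uconv (D : C -> Prop) (f : R -> C -> C) (g : C -> C) : Prop :=
  forall eta, 0 < eta -> exists L0, forall L, L0 <= L -> forall w, D w -> Cmod (f L w - g w) <= eta.

Definition bounded_on (D : C -> Prop) (g : C -> C) : Prop := exists M, 0 < M /\ forall w, D w -> Cmod (g w) <= M.

Lemma uconv_ext D f f' g : (exists L0, forall L, L0 <= L -> forall w, D w -> f L w = f' L w) -> uconv D f g -> uconv D f' g.
Proof.
  intros [L1 E] H eta He. destruct (H eta He) as [L0 K]. exists (Rmax L0 L1). intros L HL w Hw.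
  rewrite <- E; trivial. apply K; trivial. eapply Rle_trans; [apply Rmax_l | exact HL]. eapply Rle_trans; [apply Rmax_r | exact HL].
Qed.

Lemma uconv_const D g : uconv D (fun _ => g) g.
Proof. intros eta He. exists 0. intros L _ w _. replace (g w - g w)%C with (RtoC 0) by ring. rewrite Cmod_0; lra. Qed.

Lemma uconv_mult D f g f' g' : bounded_on D g -> bounded_on D g' -> uconv D f g -> uconv D f' g' ->
  uconv D (fun L w => f L w * f' L w)%C (fun w => g w * g' w)%C.
Proof.
  intros [M [HM KM]] [N [HN KN]] Hf Hf' eta He.
  set (e1 := Rmin 1 (eta / (2 * (N + 1)))). set (e2 := eta / (2 * M)).
  assert (H1 : 0 < e1) by (apply Rmin_glb_lt; [lra | apply Rdiv_lt_0_compat; lra]).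
  assert (H2 : 0 < Rmin 1 e2) by (apply Rmin_glb_lt; [lra | apply Rdiv_lt_0_compat; lra]).
  destruct (Hf e1 H1) as [L1 K1]. destruct (Hf' _ H2) as [L2 K2].
  exists (Rmax L1 L2). intros L HL w Hw.
  specialize (K1 L (Rle_trans _ _ _ (Rmax_l _ _) HL) w Hw). specialize (K2 L (Rle_trans _ _ _ (Rmax_r _ _) HL) w Hw).
  specialize (KM w Hw). specialize (KN w Hw).
  assert (E1 : e1 <= eta / (2 * (N + 1))) by apply Rmin_r. assert (E2 := Rmin_l 1 e2). assert (E3 := Rmin_r 1 e2).
  replace (f L w * f' L w - g w * g' w)%C with ((f L w - g w) * f' L w + g w * (f' L w - g' w))%C by ring.
  assert (B : Cmod (f' L w) <= N + 1). { replace (f' L w) with (g' w + (f' L w - g' w))%C by ring. eapply Rle_trans. apply Cmod_triangle. lra. }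
  eapply Rle_trans. apply Cmod_triangle. rewrite !Cmod_mult.
  replace eta with (eta / (2 * (N + 1)) * (N + 1) + M * e2) by (unfold e2; field; lra).
  apply Rplus_le_compat; apply Rmult_le_compat; auto using Cmod_ge_0; lra.
Qed.

Lemma uconv_inv D f g m : 0 < m -> (forall w, D w -> m <= Cmod (g w)) -> uconv D f g ->
  uconv D (fun L w => / f L w)%C (fun w => / g w)%C.
Proof.
  intros Hm Km Hf eta He.
  assert (H1 : 0 < Rmin (m / 2) (eta * m * m / 2)). { apply Rmin_glb_lt. lra. assert (0 < eta * m * m) by (repeat apply Rmult_lt_0_compat; trivial). lra. }
  destruct (Hf _ H1) as [L0 K]. exists L0. intros L HL w Hw. specialize (K L HL w Hw). specialize (Km w Hw).
  assert (B1 := Rmin_l (m / 2) (eta * m * m / 2)). assert (B2 := Rmin_r (m / 2) (eta * m * m / 2)).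
  assert (B : m / 2 <= Cmod (f L w)). { assert (T := Cmod_triangle_rev (g w) (f L w)). rewrite Cmod_minus_sym in T. lra. }
  assert (N1 : f L w <> 0%C) by (intros E; rewrite E, Cmod_0 in B; lra).
  assert (N2 : g w <> 0%C) by (intros E; rewrite E, Cmod_0 in Km; lra).
  rewrite Cinv_diff, Cmod_div, Cmod_mult, Cmod_minus_sym; trivial. 2: apply Cmult_neq_0; trivial.
  apply Rle_div_l. nra. assert (m / 2 * m <= Cmod (f L w) * Cmod (g w)) by (apply Rmult_le_compat; lra). nra.
Qed.

Lemma uconv_factor eps mu B n : 0 < eps -> 0 < B -> growth mu n ->
  uconv (fun v => Cmod v <= B) (fun L => factor eps L (n L)) (factor_lim eps mu).
Proof.
  intros He HB [L1 Hn] eta Heta. destruct (factor_asym eps mu B He HB) as [k [L0 [Hk [HL0 K]]]].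
  set (M := exp (eps * Rabs mu * B + eps ^ 2 / 2 * (B * B))). assert (HM : 0 < M) by apply exp_pos.
  exists (Rmax (Rmax L0 L1) (k * M / eta)). intros L HL v Hv.
  destruct (Rmax_le _ _ _ HL) as [Hm HLc]. destruct (Rmax_le _ _ _ Hm) as [HLa HLb]. clear Hm.
  specialize (K L (n L) v HLa (Hn L HLb) Hv).
  assert (Nl : factor_lim eps mu v <> 0%C) by apply Cexp_neq_0.
  assert (BM : Cmod (factor_lim eps mu v) <= M).
  { unfold factor_lim. eapply Rle_trans. apply Cmod_Cexp_le. apply exp_le. rewrite Cmod_opp. eapply Rle_trans. apply Cmod_triangle.
    unfold Cdiv. rewrite !Cmod_mult, Cmod_inv, !Cmod_R by (intros E; apply RtoC_inj in E; lra). rewrite <- RtoC_pow, !Cmod_R.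
    rewrite (Rabs_pos_eq eps), (Rabs_pos_eq 2), (Rabs_pos_eq (eps ^ 2)) by (try apply pow_le; lra).
    assert (H0 := Cmod_ge_0 v). assert (H1 := Rabs_pos mu). assert (0 < eps ^ 2) by (apply pow_lt; trivial).
    apply Rplus_le_compat; apply Rmult_le_compat; nra. }
  replace (factor eps L (n L) v - factor_lim eps mu v)%C with ((factor eps L (n L) v * / factor_lim eps mu v - 1) * factor_lim eps mu v)%C by (field; trivial).
  rewrite Cmod_mult. assert (HLp : 0 < L) by lra.
  eapply Rle_trans. apply Rmult_le_compat; [apply Cmod_ge_0 | apply Cmod_ge_0 | exact K | exact BM].
  replace (k / L * M) with (k * M / L) by (field; lra). apply Rle_div_l; trivial. apply Rle_div_l in HLc; trivial. lra.
Qed.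

Lemma wt_factor eps L a b y (w : C) : 0 < L -> w <> 0%C -> wt (eps * L) (eps / L) a b y w = (factor eps L a w * factor eps L b (/ w) * Cpowz w y)%C.
Proof.
  intros HL Hw. unfold wt, factor. rewrite RtoC_div, RtoC_mult by lra. rewrite Cmult_plus_distr_l, Cexp_plus. unfold Cdiv. ring.
Qed.

Lemma lim_wt_factor eps mu y (w : C) : lim_wt eps mu y w = (factor_lim eps mu w * factor_lim eps mu (/ w) * Cpowz w y)%C.
Proof.
  unfold lim_wt, factor_lim. rewrite <- Cexp_plus. f_equal. f_equal. ring.
Qed.

Definition annulus (B d : R) : C -> Prop := far (RtoC 0 :: nil) B d.

Lemma annulus_spec B d w : 0 < d -> annulus B d w -> w <> 0%C /\ Cmod w <= B /\ Cmod (/ w) <= / d.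
Proof.
  intros Hd [H1 H2]. specialize (H2 _ (or_introl eq_refl)). replace (w - 0)%C with w in H2 by ring.
  assert (w <> 0%C) by (intros ->; rewrite Cmod_0 in H2; lra). repeat split; trivial.
  rewrite Cmod_inv; trivial. apply Rinv_le_contravar; trivial.
Qed.

Lemma approx_factor_lim A eps mu : approx A (factor_lim eps mu).
Proof.
  unfold factor_lim. apply approx_exp. apply (approx_ext A (fun v => (-1) * (eps * mu * v + eps ^ 2 / 2 * (v * v)))%C). intros; ring.
  apply approx_mult. apply approx_const. apply approx_plus; (apply approx_mult; [apply approx_const|]). apply approx_id. apply approx_mult; apply approx_id.
Qed.

Lemma factor_lim_bounded eps mu B : 0 < B -> exists M, 0 < M /\ forall v, Cmod v <= B -> Cmod (factor_lim eps mu v) <= M.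
Proof.
  intros HB. destruct (approx_bounded nil (factor_lim eps mu) B 1 HB Rlt_0_1 (approx_factor_lim nil eps mu)) as [M [HM K]].
  exists M. split; trivial. intros v Hv. apply K. split; trivial. intros a [].
Qed.

Lemma uconv_wt eps mu B d a b y : 0 < eps -> 0 < B -> 0 < d -> growth mu a -> growth mu b ->
  uconv (annulus B d) (fun L => scaled_wt eps a b L y) (lim_wt eps mu y).
Proof.
  intros He HB Hd Ha Hb. assert (Hid : 0 < / d) by (apply Rinv_0_lt_compat; trivial).
  apply (uconv_ext _ (fun L w => factor eps L (a L) w * factor eps L (b L) (/ w) * Cpowz w y)%C).
  { exists 1. intros L HL w Hw. destruct (annulus_spec B d w Hd Hw) as [H0 _]. rewrite wt_factor; trivial. lra. }
  destruct (factor_lim_bounded eps mu B HB) as [M1 [HM1 K1]]. destruct (factor_lim_bounded eps mu (/ d) Hid) as [M2 [HM2 K2]].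
  intros eta Heta.
  assert (H := uconv_mult (annulus B d) (fun L w => factor eps L (a L) w * factor eps L (b L) (/ w))%C (fun w => factor_lim eps mu w * factor_lim eps mu (/ w))%C (fun _ w => Cpowz w y) (fun w => Cpowz w y)).
  destruct H with (eta := eta) as [L0 K]; trivial.
  - exists (M1 * M2). split. nra. intros w Hw. destruct (annulus_spec B d w Hd Hw) as [H0 [H1 H2]]. rewrite Cmod_mult. apply Rmult_le_compat; auto using Cmod_ge_0.
  - destruct (approx_bounded (RtoC 0 :: nil) (fun w => Cpowz w y) B d HB Hd) as [M [HM KM]]. apply approx_Cpowz; left; trivial. exists M. auto.
  - apply (uconv_mult _ (fun L w => factor eps L (a L) w) (fun w => factor_lim eps mu w) (fun L w => factor eps L (b L) (/ w)%C) (fun w => factor_lim eps mu (/ w)%C)).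
    + exists M1. split; trivial. intros w Hw. destruct (annulus_spec B d w Hd Hw) as [H0 [H1 H2]]. auto.
    + exists M2. split; trivial. intros w Hw. destruct (annulus_spec B d w Hd Hw) as [H0 [H1 H2]]. auto.
    + intros e' He'. destruct (uconv_factor eps mu B a He HB Ha e' He') as [L0 K]. exists L0. intros L HL w Hw.
      destruct (annulus_spec B d w Hd Hw) as [H0 [H1 H2]]. apply K; trivial.
    + intros e' He'. destruct (uconv_factor eps mu (/ d) b He Hid Hb e' He') as [L0 K]. exists L0. intros L HL w Hw.
      destruct (annulus_spec B d w Hd Hw) as [H0 [H1 H2]]. apply K; trivial.
  - apply uconv_const.
  - exists L0. intros L HL w Hw. rewrite lim_wt_factor. apply K; trivial.
Qed.

Lemma lim_wt_bounded eps mu y B d : 0 < B -> 0 < d -> bounded_on (annulus B d) (lim_wt eps mu y).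
Proof. intros HB Hd. apply approx_bounded; trivial. apply approx_lim_wt; left; trivial. Qed.

Lemma inv_lim_wt_bounded eps mu y B d : 0 < B -> 0 < d -> bounded_on (annulus B d) (fun z => / lim_wt eps mu y z)%C.
Proof. intros HB Hd. apply approx_bounded; trivial. apply approx_inv_lim_wt; left; trivial. Qed.

Lemma uconv_inv_wt eps mu B d a b y : 0 < eps -> 0 < B -> 0 < d -> growth mu a -> growth mu b ->
  uconv (annulus B d) (fun L w => / scaled_wt eps a b L y w)%C (fun w => / lim_wt eps mu y w)%C.
Proof.
  intros He HB Hd Ha Hb. destruct (inv_lim_wt_bounded eps mu y B d HB Hd) as [M [HM K]].
  apply (uconv_inv _ _ _ (/ M)). apply Rinv_0_lt_compat; trivial.
  - intros w Hw. destruct (annulus_spec B d w Hd Hw) as [H0 _]. specialize (K w Hw). cbv beta in K.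
    assert (Nl := lim_wt_neq_0 eps mu y w H0). rewrite Cmod_inv in K; trivial.
    rewrite <- (Rinv_inv (Cmod (lim_wt eps mu y w))). apply Rinv_le_contravar; trivial. apply Rinv_0_lt_compat. apply Cmod_gt_0; trivial.
  - apply uconv_wt; trivial.
Qed.

(** * Vertical lines and decay of the inverse weight *)

(** The vertical line is traversed downwards, as S is. *)
Definition vpiece (sg a b : R) : piece := mkpiece (fun s => sg - s * Ci)%C (fun _ => - Ci)%C a b.

Lemma good_vpiece sg a b : a < b -> good_piece (vpiece sg a b).
Proof.
  intros H. split; trivial. intros s _. split. 2: apply ccont_const.
  simpl. eapply cder_ext_loc. 2: apply (cder_eq _ _ _ _ (cder_plus _ _ s _ _ (cder_const sg s) (cder_mult _ _ s _ _ (seg_cder 0 1 s) (cder_const (- Ci)%C s)))).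
  exists 1. split. lra. intros r _. ring. ring.
Qed.

Lemma vpiece_Re (sg s : R) : Re (sg - s * Ci)%C = sg.
Proof. simpl. ring. Qed.
Lemma vpiece_Im (sg s : R) : Im (sg - s * Ci)%C = - s.
Proof. simpl. ring. Qed.

Definition vline (sg : R) (z : C) : Prop := Re z = sg.

Lemma psupp_vpiece sg a b z : psupp (vpiece sg a b) z -> vline sg z /\ - b <= Im z <= - a.
Proof. intros [s [Hs ->]]. simpl in *. unfold vline. simpl. split. ring. lra. Qed.

Definition vint (sg : R) (f : C -> C) (a b : R) : C := cint (fun s => f (sg - s * Ci) * - Ci)%C a b.

Lemma pint_vpiece sg a b f : pint (vpiece sg a b) f = vint sg f a b.
Proof. reflexivity. Qed.

Lemma vint_correct sg f a b : cont_on (vline sg) f -> a <= b -> cis_int (fun s => f (sg - s * Ci) * - Ci)%C a b (vint sg f a b).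
Proof.
  intros Hf Hab. apply cis_int_exists; trivial. intros s _. apply ccont_mult. 2: apply ccont_const.
  apply (ccont_comp_on (vline sg) f (fun s => sg - s * Ci)%C); trivial. intros r; apply vpiece_Re.
  eapply cder_ccont. apply (proj2 (good_vpiece sg (s - 1) (s + 1) ltac:(lra)) s). simpl; lra.
Qed.

Lemma cis_int_comp_lin (f : R -> C) u v a b l : cis_int f (u * a + v) (u * b + v) l -> cis_int (fun s => u * f (u * s + v)%R)%C a b l.
Proof.
  intros [H1 H2]. apply (is_RInt_comp_lin (V := R_NormedModule)) in H1. apply (is_RInt_comp_lin (V := R_NormedModule)) in H2.
  split; (eapply is_RInt_ext; [|eassumption]); intros s _; symmetry; [apply re_scal_l | apply im_scal_l].
Qed.

Lemma cis_int_swap (f : R -> C) a b l : cis_int f a b l -> cis_int f b a (- l)%C.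
Proof. intros [H1 H2]. split; [rewrite re_opp | rewrite im_opp]; apply (is_RInt_swap (V := R_NormedModule)); trivial. Qed.

Lemma seg_vert_gen (sg p q : R) f l : cis_int (fun s => f (sg - s * Ci) * - Ci)%C p q l ->
  pint (seg (sg - p * Ci) (sg - q * Ci)) f = l.
Proof.
  intros H. apply cis_int_cint.
  replace p with ((q - p) * 0 + p) in H at 1 by ring. replace q with ((q - p) * 1 + p) in H at 2 by ring.
  apply cis_int_comp_lin in H. eapply cis_int_ext. simpl; lra. 2: exact H.
  intros s _. simpl pg; simpl pd. cbv beta.
  replace (sg - p * Ci + s * (sg - q * Ci - (sg - p * Ci)))%C with (sg - ((q - p) * s + p)%R * Ci)%C.
  rewrite RtoC_minus. ring. rewrite RtoC_plus, RtoC_mult, RtoC_minus. ring.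
Qed.

Lemma seg_down (sg p q : R) f : p <= q -> cont_on (vline sg) f -> pint (seg (sg - p * Ci) (sg - q * Ci)) f = vint sg f p q.
Proof. intros H Hf. apply seg_vert_gen, vint_correct; trivial. Qed.

Lemma seg_up (sg p q : R) f : q <= p -> cont_on (vline sg) f -> pint (seg (sg - p * Ci) (sg - q * Ci)) f = (- vint sg f q p)%C.
Proof. intros H Hf. apply seg_vert_gen, cis_int_swap, vint_correct; trivial. Qed.

Lemma vint_Chasles sg f a b d : cont_on (vline sg) f -> a <= b -> b <= d -> vint sg f a d = (vint sg f a b + vint sg f b d)%C.
Proof. intros Hf H1 H2. apply cis_int_cint. eapply cis_int_Chasles; apply vint_correct; trivial. Qed.

Lemma is_RInt_inv_square (k a b : R) : (0 < a \/ b < 0) -> a <= b -> is_RInt (fun s => k / s ^ 2) a b (k / a - k / b).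
Proof.
  intros H Hab. replace (k / a - k / b) with ((fun s => - k / s) b - (fun s => - k / s) a) by (simpl; unfold Rdiv; ring).
  apply (is_RInt_derive (V := R_CompleteNormedModule) (fun s => - k / s)); rewrite Rmin_left, Rmax_right by lra; intros x Hx.
  - auto_derive. lra. field. lra.
  - apply (ex_derive_continuous (V := R_NormedModule)). auto_derive. apply Rmult_integral_contrapositive_currified; lra.
Qed.

Lemma vint_tail sg f k a b T : cont_on (vline sg) f -> 0 <= k -> 0 < T -> (T <= a \/ b <= - T) -> a <= b ->
  (forall z, vline sg z -> T <= Rabs (Im z) -> Cmod (f z) <= k / Im z ^ 2) -> Cmod (vint sg f a b) <= k / T.
Proof.
  intros Hf Hk HT Hab Hle HB.
  apply Rle_trans with (k / a - k / b).
  - eapply cis_int_bound_fun; [exact Hle | | apply vint_correct; trivial | apply is_RInt_inv_square; trivial; lra].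
    intros s Hs. cbv beta. rewrite Cmod_mult, Cmod_opp, Cmod_Ci, Rmult_1_r.
    replace (s ^ 2) with (Im (sg - s * Ci)%C ^ 2) by (rewrite vpiece_Im; ring). apply HB. apply vpiece_Re. rewrite vpiece_Im, Rabs_Ropp.
    unfold Rabs; destruct Rcase_abs; lra.
  - destruct Hab as [H|H].
    + assert (0 <= k / b) by (apply Rmult_le_pos; [lra | left; apply Rinv_0_lt_compat; lra]).
      assert (k / a <= k / T). { apply Rmult_le_compat_l; trivial. apply Rinv_le_contravar; trivial. } lra.
    + assert (0 <= k / (- a)) by (apply Rmult_le_pos; [lra | left; apply Rinv_0_lt_compat; lra]).
      assert (k / (- b) <= k / T). { apply Rmult_le_compat_l; trivial. apply Rinv_le_contravar; lra. }
      replace (k / a) with (- (k / (- a))) by (field; lra). replace (k / b) with (- (k / (- b))) by (field; lra). lra.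
Qed.

(** A quadratic decay makes the part of the line above height T an O(1/T). *)
Lemma vint_tails sg f k A B T : cont_on (vline sg) f -> 0 <= k -> 0 < T -> T <= A -> T <= B ->
  (forall z, vline sg z -> T <= Rabs (Im z) -> Cmod (f z) <= k / Im z ^ 2) ->
  Cmod (vint sg f (- A) B - vint sg f (- T) T) <= 2 * k / T.
Proof.
  intros Hf Hk HT HA HB H.
  rewrite (vint_Chasles sg f (- A) (- T) B), (vint_Chasles sg f (- T) T B); trivial; try lra.
  replace (vint sg f (- A) (- T) + (vint sg f (- T) T + vint sg f T B) - vint sg f (- T) T)%C with (vint sg f (- A) (- T) + vint sg f T B)%C by ring.
  eapply Rle_trans. apply Cmod_triangle.
  assert (Cmod (vint sg f (- A) (- T)) <= k / T) by (apply vint_tail; trivial; lra).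
  assert (Cmod (vint sg f T B) <= k / T) by (apply vint_tail; trivial; lra).
  replace (2 * k / T) with (k / T + k / T) by (field; lra). lra.
Qed.

Lemma cont_on_inv_id (X : C -> Prop) : (forall z, X z -> z <> 0%C) -> cont_on X (fun z => / z)%C.
Proof. intros H. apply cont_on_inv; cont. Qed.

Lemma cont_on_Cpowz (X : C -> Prop) n : (forall z, X z -> z <> 0%C) -> cont_on X (fun z => Cpowz z n).
Proof.
  intros H. destruct (Z_diff n) as [a [b ->]]. apply (cont_on_ext X (fun z => z ^ a * (/ z) ^ b)%C).
  - intros z Hz. rewrite Cpowz_sub, Cpow_inv; auto.
  - apply cont_on_mult; apply cont_on_pow. apply cont_on_id. apply cont_on_inv_id; trivial.
Qed.

Lemma cont_on_wt (X : C -> Prop) t e a b y : (forall z, X z -> z <> 0%C) -> cont_on X (wt t e a b y).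
Proof.
  intros H. assert (Hi := cont_on_inv_id X H). unfold wt, Cdiv. apply cont_on_mult; [apply cont_on_mult; [apply cont_on_mult|]|].
  - apply cont_on_exp. cont.
  - apply cont_on_pow. cont.
  - apply cont_on_pow. cont.
  - apply cont_on_Cpowz; trivial.
Qed.

Lemma cont_on_inv_wt (X : C -> Prop) t e a b y : (forall z, X z -> regular_pt e z) -> cont_on X (fun z => / wt t e a b y z)%C.
Proof.
  intros H. apply cont_on_inv. apply cont_on_wt. intros z Hz; apply (H z Hz). intros z Hz. apply wt_neq_0; auto.
Qed.

Lemma cont_on_lim_wt (X : C -> Prop) eps mu y : (forall z, X z -> z <> 0%C) -> cont_on X (lim_wt eps mu y).
Proof.
  intros H. assert (Hi := cont_on_inv_id X H). unfold lim_wt. apply cont_on_mult. apply cont_on_exp. cont. apply cont_on_Cpowz; trivial.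
Qed.

Lemma cont_on_inv_lim_wt (X : C -> Prop) eps mu y : (forall z, X z -> z <> 0%C) -> cont_on X (fun z => / lim_wt eps mu y z)%C.
Proof. intros H. apply cont_on_inv. apply cont_on_lim_wt; trivial. intros z Hz. apply lim_wt_neq_0; auto. Qed.

Lemma vline_neq_0 sg z : 0 < sg -> vline sg z -> z <> 0%C.
Proof. intros H Hz ->. unfold vline in Hz. simpl in Hz. lra. Qed.

Lemma halfplane_regular (e sg : R) (z : C) : 0 < e < 1 -> 1 <= sg -> (Re z = sg \/ Im z <> 0 \/ Re z > / e) -> sg < / e -> 0 < Re z -> regular_pt e z.
Proof.
  intros He Hsg Hz Hs Hr. apply regular_avoid. lra. assert (Hi : 1 < / e) by lra.
  intros [E|[E|[E|[]]]]; rewrite <- E in *; simpl in *; lra.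
Qed.

Lemma Cmod_Cpowz_bounds (z : C) y : 1 <= Cmod z -> / Cmod z ^ Z.abs_nat y <= Cmod (Cpowz z y) <= Cmod z ^ Z.abs_nat y.
Proof.
  intros Hz. assert (Nz : z <> 0%C) by (intros ->; rewrite Cmod_0 in Hz; lra).
  assert (P : forall n, 1 <= Cmod z ^ n) by (intros n; apply pow_R1_Rle; trivial).
  destruct y as [|p|p]; simpl.
  - rewrite Cmod_1. lra.
  - rewrite Cmod_pow. split; [|lra]. specialize (P (Pos.to_nat p)). apply Rle_trans with 1; trivial. rewrite <- Rinv_1. apply Rinv_le_contravar; lra.
  - rewrite Cmod_inv, Cmod_pow by (apply Cpow_nz; trivial). specialize (P (Pos.to_nat p)). split; [lra|]. apply Rle_trans with 1; trivial. rewrite <- Rinv_1. apply Rinv_le_contravar; lra.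
Qed.

Lemma factor_lower eps mu B n : 0 < eps -> 0 < B -> growth mu n ->
  exists k L0, 0 < k /\ 1 <= L0 /\ forall L, L0 <= L -> forall v, Cmod v <= B -> k <= Cmod (factor eps L (n L) v).
Proof.
  intros He HB [L1 Hn]. destruct (factor_asym eps mu B He HB) as [c [L0 [Hc [HL0 K]]]].
  destruct (approx_bounded nil (fun v => Cexp (eps * mu * v + eps ^ 2 / 2 * (v * v))) B 1 HB Rlt_0_1) as [M [HM KM]].
  { apply approx_exp. apply approx_plus; (apply approx_mult; [apply approx_const|]). apply approx_id. apply approx_mult; apply approx_id. }
  exists (/ (2 * M)), (Rmax (Rmax L0 L1) (2 * c)). split. apply Rinv_0_lt_compat; lra.
  split. eapply Rle_trans. 2: apply Rmax_l. eapply Rle_trans. 2: apply Rmax_l. trivial.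
  intros L HL v Hv.
  destruct (Rmax_le _ _ _ HL) as [Hm HLc]. destruct (Rmax_le _ _ _ Hm) as [HLa HLb]. clear Hm.
  specialize (K L (n L) v HLa (Hn L HLb) Hv).
  specialize (KM v (conj Hv (fun a (H : In a nil) => False_ind _ H))). cbv beta in KM.
  unfold factor_lim in K. rewrite Cexp_opp, Cinv_inv in K.
  set (H := factor eps L (n L) v) in *. set (E := Cexp (eps * mu * v + eps ^ 2 / 2 * (v * v))) in *.
  assert (c / L <= / 2). { apply Rle_div_l; lra. }
  assert (/ 2 <= Cmod H * Cmod E). { rewrite <- Cmod_mult. assert (T := Cmod_triangle_rev 1 (H * E)). rewrite Cmod_1, Cmod_minus_sym in T. lra. }
  assert (HH0 := Cmod_ge_0 H). rewrite Rinv_mult. apply Rmult_le_reg_r with M; trivial.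
  replace (/ 2 * / M * M) with (/ 2) by (field; lra). nra.
Qed.

(** By Bernoulli's inequality applied to k groups of q factors each. *)
Lemma pow_ge_poly x a k q : 0 <= x -> (k * q <= a)%nat -> (INR q * x) ^ k <= (1 + x) ^ a.
Proof.
  intros Hx Ha. apply Rle_trans with ((1 + x) ^ (k * q)). 2: apply Rle_pow; trivial; lra.
  rewrite Nat.mul_comm, pow_mult. apply pow_incr. split. apply Rmult_le_pos; trivial. apply pos_INR.
  destruct (Rle_lt_or_eq_dec 0 x Hx) as [H|<-].
  - assert (P := poly q x H). lra.
  - rewrite Rmult_0_r. apply pow_le; lra.
Qed.

Lemma Re_Cmod_square z : Cmod z ^ 2 = Re z ^ 2 + Im z ^ 2.
Proof. apply Cmod2_alt. Qed.

(** Uniform decay of the inverse weight on a vertical line: there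
|1 - e z|^2 >= (1 - e sg)^2 (1 + e^2 y^2), and (1 + e^2 y^2)^a exceeds any power of y
because a e^2 stays bounded below. *)
Lemma inv_wt_tail eps mu sg y a b : 0 < eps -> 1 <= sg ->
  growth mu a -> growth mu b ->
  exists k L0, 0 < k /\ 1 <= L0 /\ forall L, L0 <= L -> forall z, vline sg z -> 1 <= Rabs (Im z) ->
    Cmod (/ scaled_wt eps a b L y z) <= k / Im z ^ 2.
Proof.
  intros He Hsg Ha Hb.
  destruct (factor_lower eps mu sg a He ltac:(lra) Ha) as [c0 [L0 [Hc0 [HL0 K0]]]].
  destruct (factor_lower eps mu 1 b He Rlt_0_1 Hb) as [c1 [L1 [Hc1 [HL1 K1]]]].
  destruct Ha as [L2 Ha].
  (* k powers of (Im z)^2 are extracted from (1 + e^2 (Im z)^2)^a: n against the power of z, and two for the decay *)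
  set (n := Z.abs_nat y). set (k := (n + 2)%nat).
  set (Kr := INR k). assert (HK : 2 <= Kr). { unfold Kr, k. rewrite plus_INR. simpl. generalize (pos_INR n). lra. }
  set (k0 := (eps ^ 2 / (4 * Kr)) ^ k / (sg ^ 2 + 1) ^ n).
  assert (He2 : 0 < eps ^ 2) by (apply pow_lt; trivial).
  assert (Hk0 : 0 < k0). { apply Rdiv_lt_0_compat; apply pow_lt. apply Rdiv_lt_0_compat; lra. nra. }
  set (c := c0 * c1 * sqrt k0). assert (Hc : 0 < c). { apply Rmult_lt_0_compat. nra. apply sqrt_lt_R0; trivial. }
  exists (/ c), (Rmax (Rmax L0 L1) (Rmax L2 (Rmax (eps * sg) (4 + 4 * Rabs mu + 4 * Kr)))).
  split. apply Rinv_0_lt_compat; trivial. split. { eapply Rle_trans. exact HL0. eapply Rle_trans. 2: apply Rmax_l. apply Rmax_l. }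
  intros L HL z Hz Hy.
  destruct (Rmax_le _ _ _ HL) as [Hm HL']. destruct (Rmax_le _ _ _ Hm) as [HLa HLb]. clear Hm.
  assert (HLc := Rle_trans _ _ _ (Rmax_l _ _) HL').
  assert (HLd := Rle_trans _ _ _ (Rmax_l _ _) (Rle_trans _ _ _ (Rmax_r _ _) HL')).
  assert (HLe := Rle_trans _ _ _ (Rmax_r _ _) (Rle_trans _ _ _ (Rmax_r _ _) HL')).
  specialize (Ha L HLc). assert (Hm0 := Rabs_pos mu).
  assert (HLp : 4 <= L) by lra.
  assert (Nz : z <> 0%C) by (apply (vline_neq_0 sg); trivial; lra).
  unfold vline in Hz.
  assert (Hz1 : 1 <= Cmod z). { eapply Rle_trans. exact Hy. apply im_le_Cmod. }
  set (s := Im z) in *.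
  assert (Hs2 : 1 <= s ^ 2). { rewrite <- (pow2_abs s). nra. }
  assert (B1 := K1 L HLb (/ z)%C). rewrite Cmod_inv in B1; trivial. specialize (B1 ltac:(rewrite <- Rinv_1; apply Rinv_le_contravar; lra)).
  assert (B0 := K0 L HLa sg). rewrite Cmod_R, Rabs_pos_eq in B0 by lra. specialize (B0 (Rle_refl _)).
  set (e := eps / L). assert (Hep : 0 < e) by (apply Rdiv_lt_0_compat; lra).
  assert (Hes : 0 <= e * sg <= 1). { split. nra. unfold e. replace (eps / L * sg) with (eps * sg / L) by (field; lra). apply Rle_div_l; lra. }
  assert (Hq : (k * (a L / k) <= a L)%nat) by (apply Nat.Div0.mul_div_le).
  assert (Hqr : L ^ 2 / (4 * Kr) <= INR (a L / k)).
  { assert (Hlt : (a L < k * S (a L / k))%nat) by (apply Nat.mul_succ_div_gt; unfold k; lia).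
    apply lt_INR in Hlt. rewrite mult_INR, S_INR in Hlt. fold Kr in Hlt. unfold near_section in Ha. apply Rabs_le_between in Ha.
    assert (Hmu : - (Rabs mu * L) <= mu * L). { assert (T := Rle_abs (- mu)). rewrite Rabs_Ropp in T. nra. }
    apply Rle_div_l. lra. assert (L ^ 2 - Rabs mu * L - 2 < Kr * (INR (a L / k) + 1)) by lra. nra. }
  assert (H1 : Cmod (factor eps L (a L) sg) ^ 2 * (eps ^ 2 / (4 * Kr) * s ^ 2) ^ k <= Cmod (factor eps L (a L) z) ^ 2).
  { assert (Hh : forall v : C, Re v = sg -> Cmod (factor eps L (a L) v) ^ 2 = exp (eps * L * sg) ^ 2 * (Cmod (1 - e * v) ^ 2) ^ a L).
    { intros v Hv. unfold factor. fold e. rewrite <- RtoC_div by lra. fold e. rewrite Cmod_mult, Cmod_pow, Cmod_Cexp, Rpow_mult_distr. f_equal.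
      - f_equal. f_equal. rewrite <- RtoC_mult, re_scal_l, Hv. reflexivity.
      - rewrite <- !pow_mult. f_equal. lia. }
    rewrite !Hh by (trivial; reflexivity).
    rewrite Rmult_assoc. apply Rmult_le_compat_l. apply pow_le; left; apply exp_pos.
    rewrite !Re_Cmod_square.
    replace (Re (1 - e * sg)%C) with (1 - e * sg) by (simpl; ring). replace (Im (1 - e * sg)%C) with 0 by (simpl; ring).
    replace (Re (1 - e * z)%C) with (1 - e * sg) by (rewrite re_minus, re_scal_l, Hz; simpl; ring).
    replace (Im (1 - e * z)%C) with (- (e * s)) by (rewrite im_minus, im_scal_l; simpl; unfold s; ring).
    apply Rle_trans with (((1 - e * sg) ^ 2 + 0 ^ 2) ^ a L * (1 + (e * s) ^ 2) ^ a L).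
    - apply Rmult_le_compat_l. apply pow_le. nra. eapply Rle_trans. 2: apply (pow_ge_poly ((e * s) ^ 2) (a L) k (a L / k)); trivial.
      apply pow_incr. split. apply Rmult_le_pos; [|lra]. apply Rlt_le, Rdiv_lt_0_compat; lra.
      unfold e. replace (INR (a L / k) * (eps / L * s) ^ 2) with (INR (a L / k) / L ^ 2 * (eps ^ 2 * s ^ 2)) by (field; lra).
      replace (eps ^ 2 / (4 * Kr) * s ^ 2) with (/ (4 * Kr) * (eps ^ 2 * s ^ 2)) by (field; lra).
      apply Rmult_le_compat_r. nra. apply Rle_div_r. nra. replace (/ (4 * Kr) * L ^ 2) with (L ^ 2 / (4 * Kr)) by (field; lra). trivial.
      apply pow2_ge_0.
    - rewrite <- Rpow_mult_distr.
      assert (A1 : 0 <= (1 - e * sg) ^ 2 <= 1) by (split; nra). assert (A2 := pow2_ge_0 (e * s)).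
      replace ((- (e * s)) ^ 2) with ((e * s) ^ 2) by ring. replace (0 ^ 2) with 0 by ring.
      revert A1 A2. generalize ((1 - e * sg) ^ 2) ((e * s) ^ 2). intros p q A1 A2.
      apply pow_incr. split; nra. }
  assert (H2 : / ((sg ^ 2 + 1) ^ n * (s ^ 2) ^ n) <= Cmod (Cpowz z y) ^ 2).
  { destruct (Cmod_Cpowz_bounds z y Hz1) as [P1 _]. fold n in P1.
    apply Rle_trans with ((/ Cmod z ^ n) ^ 2).
    - rewrite pow_inv. rewrite <- Rpow_mult_distr. apply Rinv_le_contravar. apply pow_lt, pow_lt; lra.
      rewrite <- pow_mult, Nat.mul_comm, pow_mult. apply pow_incr. rewrite Re_Cmod_square, Hz. fold s. nra.
    - apply pow_incr. split; trivial. left. apply Rinv_0_lt_compat. apply pow_lt; lra. }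
  assert (Fin : c * s ^ 2 <= Cmod (scaled_wt eps a b L y z)).
  { apply Rsqr_incr_0_var. 2: apply Cmod_ge_0. rewrite !Rsqr_pow2. rewrite wt_factor, !Cmod_mult, !Rpow_mult_distr by (trivial; lra).
    apply Rle_trans with ((c0 ^ 2 * (eps ^ 2 / (4 * Kr) * s ^ 2) ^ k) * c1 ^ 2 * / ((sg ^ 2 + 1) ^ n * (s ^ 2) ^ n)).
    - unfold c. rewrite !Rpow_mult_distr, pow2_sqrt by lra. unfold k0. replace ((s ^ 2) ^ k) with ((s ^ 2) ^ n * (s ^ 2) ^ 2) by (unfold k; rewrite pow_add; reflexivity).
      assert ((sg ^ 2 + 1) ^ n <> 0) by (apply pow_nonzero; nra). assert ((s ^ 2) ^ n <> 0) by (apply pow_nonzero; nra).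
      right. field. auto.
    - assert (0 <= (eps ^ 2 / (4 * Kr) * s ^ 2) ^ k). { apply pow_le. apply Rmult_le_pos; [|lra]. apply Rlt_le, Rdiv_lt_0_compat; lra. }
      assert (0 < / ((sg ^ 2 + 1) ^ n * (s ^ 2) ^ n)). { apply Rinv_0_lt_compat. apply Rmult_lt_0_compat; apply pow_lt; nra. }
      assert (P0 : 0 <= c0 ^ 2 * (eps ^ 2 / (4 * Kr) * s ^ 2) ^ k) by (apply Rmult_le_pos; [apply pow2_ge_0 | trivial]).
      apply Rmult_le_compat; [apply Rmult_le_pos; [exact P0 | apply pow2_ge_0] | lra | | exact H2].
      apply Rmult_le_compat; [exact P0 | apply pow2_ge_0 | | apply pow_incr; lra].
      eapply Rle_trans. 2: exact H1. apply Rmult_le_compat_r; trivial. apply pow_incr. split; lra. }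
  assert (Hcs : 0 < c * s ^ 2) by (apply Rmult_lt_0_compat; lra).
  assert (Hs0 : s <> 0) by (intros E; rewrite E in Hs2; nra).
  fold e in Fin. rewrite Cmod_inv by (intros E; rewrite E, Cmod_0 in Fin; lra). replace (/ c / s ^ 2) with (/ (c * s ^ 2)) by (field; split; [lra | exact Hs0]).
  apply Rinv_le_contravar; trivial.
Qed.

(** Crude decay at infinity in the right half-plane, for fixed parameters: there |e^(t z)| >= 1, and |1 - e z|^a is of order |z|^a. *)
Lemma inv_wt_far t e a b y : 0 <= t -> 0 < e -> (Z.abs_nat y + 2 <= a)%nat -> exists k, 0 < k /\
  forall z, 0 < Re z -> 2 / e <= Cmod z -> 2 * e <= Cmod z -> 1 <= Cmod z -> Cmod (/ wt t e a b y z) <= k / Cmod z ^ 2.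
Proof.
  intros Ht He Ha. set (n := Z.abs_nat y) in *. set (c := (e / 2) ^ (n + 2) * (/ 2) ^ b).
  assert (Hc : 0 < c) by (apply Rmult_lt_0_compat; apply pow_lt; lra).
  exists (/ c). split. apply Rinv_0_lt_compat; trivial. intros z Hz H1 H2 H3.
  assert (Nz : z <> 0%C) by (intros ->; rewrite Cmod_0 in H3; lra).
  assert (Fin : c * Cmod z ^ 2 <= Cmod (wt t e a b y z)).
  { unfold wt. rewrite !Cmod_mult, !Cmod_pow.
    assert (E1 : 1 <= Cmod (Cexp (t * (z + / z)))).
    { rewrite Cmod_Cexp, <- exp_0. apply exp_le. rewrite re_scal_l. apply Rmult_le_pos; trivial. rewrite re_plus.
      assert (0 < Re (/ z)). { destruct z as [u v]. simpl in *. apply Rdiv_lt_0_compat; trivial. nra. } lra. }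
    assert (E2 : e / 2 * Cmod z <= Cmod (1 - e * z)).
    { assert (T := Cmod_triangle_rev (e * z) 1). rewrite Cmod_mult, Cmod_R, Rabs_pos_eq, Cmod_1, Cmod_minus_sym in T by lra.
      assert (1 <= e / 2 * Cmod z). { apply Rle_div_l in H1; lra. } lra. }
    assert (E2' : 1 <= e / 2 * Cmod z) by (apply Rle_div_l in H1; lra).
    assert (E3 : / 2 <= Cmod (1 - e / z)).
    { assert (T := Cmod_triangle_rev 1 (e / z)). rewrite Cmod_1, Cmod_div, Cmod_R, Rabs_pos_eq in T by (trivial; lra).
      assert (e / Cmod z <= / 2) by (apply Rle_div_l; lra). lra. }
    destruct (Cmod_Cpowz_bounds z y H3) as [E4 _]. fold n in E4.
    assert (F2 : (e / 2 * Cmod z) ^ (n + 2) <= Cmod (1 - e * z) ^ a).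
    { apply Rle_trans with (Cmod (1 - e * z) ^ (n + 2)). apply pow_incr; lra. apply Rle_pow; trivial; lra. }
    assert (F3 : (/ 2) ^ b <= Cmod (1 - e / z) ^ b) by (apply pow_incr; lra).
    assert (Zn : 0 < Cmod z ^ n) by (apply pow_lt; lra).
    replace (c * Cmod z ^ 2) with (1 * (e / 2 * Cmod z) ^ (n + 2) * (/ 2) ^ b * / Cmod z ^ n).
    2:{ unfold c. rewrite Rpow_mult_distr, (pow_add (Cmod z)). field. lra. }
    assert (P1 : 0 < (e / 2 * Cmod z) ^ (n + 2)) by (apply pow_lt; lra). assert (P2 : 0 < (/ 2) ^ b) by (apply pow_lt; lra).
    assert (P3 : 0 < / Cmod z ^ n) by (apply Rinv_0_lt_compat; trivial).
    assert (Q1 : 0 <= 1 * (e / 2 * Cmod z) ^ (n + 2)) by lra.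
    assert (Q2 : 0 <= 1 * (e / 2 * Cmod z) ^ (n + 2) * (/ 2) ^ b) by (apply Rmult_le_pos; lra).
    apply Rmult_le_compat; [exact Q2 | lra | | exact E4].
    apply Rmult_le_compat; [exact Q1 | lra | | exact F3].
    apply Rmult_le_compat; [lra | lra | exact E1 | exact F2]. }
  assert (Hcs : 0 < c * Cmod z ^ 2) by (apply Rmult_lt_0_compat; trivial; apply pow_lt; lra).
  rewrite Cmod_inv by (intros E; rewrite E, Cmod_0 in Fin; lra). replace (/ c / Cmod z ^ 2) with (/ (c * Cmod z ^ 2)) by (field; split; lra).
  apply Rinv_le_contravar; trivial.
Qed.

(** * Convergence of the double integral *)

Definition vchain (sg T : R) : chain := vpiece sg (- T) T :: nil.

Lemma good_vchain sg T : 0 < T -> good (vchain sg T).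
Proof. intros H. apply good_1, good_vpiece. lra. Qed.

Lemma supp_vchain sg T z : supp (vchain sg T) z -> vline sg z /\ Rabs (Im z) <= T.
Proof. intros H. apply supp_1, psupp_vpiece in H. destruct H as [H1 H2]. split; trivial. apply Rabs_le. lra. Qed.

Lemma chint_vchain sg T f : chint (vchain sg T) f = vint sg f (- T) T.
Proof. unfold vchain, chint, fold_right. rewrite pint_vpiece. ring. Qed.

Lemma dist_U_line w z : supp (square 0 1) w -> 2 <= Re z -> 1 <= Cmod (w - z).
Proof.
  intros Hw Hz. apply Cmod_U in Hw. destruct Hw as [H _]. apply Rabs_le_between in H.
  rewrite Cmod_minus_sym. eapply Rle_trans. 2: apply Re_le_Cmod. rewrite re_minus. lra.
Qed.

Lemma Cmod_pole_le f w z : 1 <= Cmod (w - z) -> Cmod (f * / (w - z)) <= Cmod f.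
Proof.
  intros H. rewrite Cmod_mult, Cmod_inv by (intros E; rewrite E, Cmod_0 in H; lra).
  assert (/ Cmod (w - z) <= 1). { rewrite <- Rinv_1. apply Rinv_le_contravar; lra. }
  generalize (Cmod_ge_0 f). nra.
Qed.

Lemma not_supp_dist k w : (forall z, supp k z -> 1 <= Cmod (w - z)) -> ~ supp k w.
Proof. intros H Hs. specialize (H w Hs). replace (w - w)%C with (RtoC 0) in H by ring. rewrite Cmod_0 in H. lra. Qed.

Lemma U_annulus w : supp (square 0 1) w -> annulus 2 1 w.
Proof.
  intros H. split. assert (T := Cmod_sq0 1 w Rlt_0_1 H). lra.
  intros a [<-|[]]. replace (w - 0)%C with w by ring. apply Cmod_U; trivial.
Qed.

Lemma U_neq_0 w : supp (square 0 1) w -> w <> 0%C.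
Proof. intros H ->. apply Cmod_U in H. rewrite Cmod_0 in H. lra. Qed.

Lemma large_near_section mu N : exists L0, forall L n, L0 <= L -> near_section mu L n -> (N <= n)%nat.
Proof.
  exists (1 + Rabs mu + INR N + 2). intros L n HL H. unfold near_section in H. apply Rabs_le_between in H.
  assert (Hm := Rabs_pos mu). assert (HN := pos_INR N). assert (T := Rle_abs (- mu)). rewrite Rabs_Ropp in T.
  apply INR_le. assert (INR N + 2 <= L ^ 2 + mu * L) by nra. lra.
Qed.

Lemma uconv_bounded D f g : bounded_on D g -> uconv D f g -> exists M L0, 0 < M /\ forall L, L0 <= L -> forall w, D w -> Cmod (f L w) <= M.
Proof.
  intros [M [HM K]] H. destruct (H 1 Rlt_0_1) as [L0 K0]. exists (M + 1), L0. split. lra. intros L HL w Hw.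
  specialize (K w Hw). specialize (K0 L HL w Hw). replace (f L w) with (g w + (f L w - g w))%C by ring. eapply Rle_trans. apply Cmod_triangle. lra.
Qed.

Lemma chint_close l : good l -> exists M, 0 < M /\ forall f g eta, 0 <= eta -> cont_on (supp l) f -> cont_on (supp l) g ->
  (forall z, supp l z -> Cmod (f z - g z) <= eta) -> Cmod (chint l f - chint l g) <= M * eta.
Proof.
  intros G. destruct (chint_bound l G) as [M [HM K]]. exists M. split; trivial. intros f g eta He Hf Hg H.
  rewrite <- chint_minus; trivial. apply K; trivial. apply cont_on_minus; trivial.
Qed.

(** The three sides of the square off the line have length O(h) and carry an integrand O(1/h^2), for fixed L; so
h depends on L, whereas the cut of the left side at height T costs O(1/T) uniformly in L. *)
Lemma double_int_square_line eps mu1 mu2 sg y1 y2 a1 b1 a2 b2 : 0 < eps -> 2 <= sg ->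
  growth mu1 a1 -> growth mu1 b1 ->
  growth mu2 a2 -> growth mu2 b2 ->
  exists k Lr, 0 < k /\ forall L, Lr <= L -> forall T, 1 <= T -> exists h0, forall h, h0 <= h ->
    let W := scaled_wt eps a1 b1 L y1 in
    let F := fun z => (/ scaled_wt eps a2 b2 L y2 z)%C in
    Cmod (double_int (right_square sg h) W F - double_int (vchain sg T) W F) <= k / T.
Proof.
  intros He Hsg Ha1 Hb1 Ha2 Hb2.
  destruct (inv_wt_tail eps mu2 sg y2 a2 b2 He ltac:(lra) Ha2 Hb2) as [kt [L0 [Hkt [HL0 KT]]]].
  destruct (uconv_bounded (annulus 2 1) _ _ (lim_wt_bounded eps mu1 y1 2 1 ltac:(lra) Rlt_0_1) (uconv_wt eps mu1 2 1 a1 b1 y1 He ltac:(lra) Rlt_0_1 Ha1 Hb1)) as [Mw [L1 [HMw KW]]].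
  destruct (large_near_section mu2 (Z.abs_nat y2 + 2)) as [L2 KL2]. destruct Ha2 as [L3 Ha2].
  assert (GU := good_square 0 1). destruct (chint_close (square 0 1) GU) as [MU [HMU KU]].
  exists (MU * (Mw * (2 * kt + 1))), (Rmax (Rmax L0 L1) (Rmax (Rmax L2 L3) (eps * sg + 1))).
  split. { repeat apply Rmult_lt_0_compat; lra. }
  intros L HL T HT.
  destruct (Rmax_le _ _ _ HL) as [Hm HL']. destruct (Rmax_le _ _ _ Hm) as [HLa HLb]. clear Hm.
  destruct (Rmax_le _ _ _ HL') as [Hm HLe]. destruct (Rmax_le _ _ _ Hm) as [HLc HLd]. clear Hm. clear HL HL'.
  assert (HLp : 0 < L) by nra. assert (Hes : eps < L) by nra.
  set (e := eps / L). assert (He0 : 0 < e) by (apply Rdiv_lt_0_compat; lra).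
  assert (He1 : e < 1) by (apply Rlt_div_l; lra).
  assert (Hie : / e = L / eps) by (unfold e; field; lra).
  assert (Hsi : sg < / e). { rewrite Hie. apply Rlt_div_r; lra. }
  destruct (inv_wt_far (eps * L) e (a2 L) (b2 L) y2 ltac:(nra) He0 (KL2 L (a2 L) HLc (Ha2 L HLd))) as [kf [Hkf KF]].
  (* the last term makes the three sides off the line contribute at most 1/T *)
  exists (Rmax (Rmax T 1) (Rmax (Rmax (2 / e) (2 * e)) (6 * kf * T))). intros h Hh W F.
  destruct (Rmax_le _ _ _ Hh) as [Hm Hh']. destruct (Rmax_le _ _ _ Hm) as [Hh1 Hh2]. clear Hm.
  destruct (Rmax_le _ _ _ Hh') as [Hm Hh5]. destruct (Rmax_le _ _ _ Hm) as [Hh3 Hh4]. clear Hm. clear Hh Hh'.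
  assert (Hi2 : / e < 2 / e). { assert (0 < / e) by (apply Rinv_0_lt_compat; lra). unfold Rdiv. lra. }
  assert (RegL : forall z, vline sg z -> regular_pt e z).
  { intros z Hz. unfold vline in Hz. apply (halfplane_regular e sg); try lra; auto. }
  assert (RegR : forall z, supp (right_square sg h) z -> regular_pt e z).
  { intros z Hz. assert (Hz' := supp_right_square sg h z ltac:(lra) Hz). apply supp_square in Hz; [|lra].
    apply (halfplane_regular e sg); try lra. destruct Hz as [Hz _]. simpl in Hz. rewrite Rminus_0_r in Hz.
    destruct Hz as [Hz|[Hz|[Hz|Hz]]]. right; right; lra. left; lra. right; left; lra. right; left; lra. }
  assert (CW : cont_on (supp (square 0 1)) W) by (apply cont_on_wt, U_neq_0).
  assert (CFl : cont_on (vline sg) F) by (apply cont_on_inv_wt; trivial).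
  assert (CFr : cont_on (supp (right_square sg h)) F) by (apply cont_on_inv_wt; trivial).
  assert (CFv : cont_on (supp (vchain sg T)) F) by (eapply cont_on_sub; [|exact CFl]; intros z Hz; apply (supp_vchain _ _ _ Hz)).
  assert (GR : good (right_square sg h)) by apply good_square. assert (GV : good (vchain sg T)) by (apply good_vchain; lra).
  assert (DR : forall w z, supp (square 0 1) w -> supp (right_square sg h) z -> 1 <= Cmod (w - z)).
  { intros w z Hw Hz. apply dist_U_line; trivial. apply supp_right_square in Hz; lra. }
  assert (DL : forall w z, supp (square 0 1) w -> vline sg z -> 1 <= Cmod (w - z)).
  { intros w z Hw Hz. apply dist_U_line; trivial. unfold vline in Hz; lra. }
  assert (NL : forall w, supp (square 0 1) w -> ~ vline sg w).
  { intros w Hw Hs. specialize (DL w w Hw Hs). replace (w - w)%C with (RtoC 0) in DL by ring. rewrite Cmod_0 in DL. lra. }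
  assert (Inner : forall w, supp (square 0 1) w ->
    Cmod (cauchy_int (right_square sg h) F w - cauchy_int (vchain sg T) F w)%C <= (2 * kt + 1) / T).
  { intros w Hw. set (g := fun z => (F z * / (w - z))%C).
    assert (Cgl : cont_on (vline sg) g).
    { unfold g. apply cont_on_mult; trivial. apply cont_on_inv; cont. intros z Hz E. apply Ceq_minus in E. subst. apply (NL z Hw Hz). }
    assert (Cgr : cont_on (supp (right_square sg h)) g).
    { unfold g. apply cont_on_kernel; trivial. apply not_supp_dist. intros z Hz. apply DR; trivial. }
    assert (Side : forall p q, In (seg p q) (right_square sg h) -> (forall z, psupp (seg p q) z -> h <= Cmod z) -> Cmod (q - p) = 2 * h ->
       Cmod (pint (seg p q) g) <= 2 * kf / h).
    { intros p q Hin Hz Hl. assert (Hsub : forall z, psupp (seg p q) z -> supp (right_square sg h) z) by (intros z Hz'; exists (seg p q); auto).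
      replace (2 * kf / h) with (kf / h ^ 2 * Cmod (q - p)) by (rewrite Hl; field; lra).
      apply pint_seg_bound. eapply cont_on_sub; [|exact Cgr]; trivial.
      intros z Hz'. specialize (Hz z Hz'). apply Hsub in Hz'. eapply Rle_trans. apply Cmod_pole_le. apply DR; trivial.
      assert (Rz := supp_right_square sg h z ltac:(lra) Hz').
      eapply Rle_trans. apply KF; lra. apply Rmult_le_compat_l. lra. apply Rinv_le_contravar. apply pow_lt; lra. apply pow_incr; lra. }
    unfold right_square, square in Side. unfold right_square, square, chint at 1, fold_right.
    set (c := RtoC (sg + h)) in *.
    set (S1 := seg (c + h * (1 - Ci)) (c + h * (1 + Ci))) in *.
    set (S2 := seg (c + h * (1 + Ci)) (c + h * (-1 + Ci))) in *.
    set (S3 := seg (c + h * (-1 + Ci)) (c + h * (-1 - Ci))) in *.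
    set (S4 := seg (c + h * (-1 - Ci)) (c + h * (1 - Ci))) in *.
    assert (B1 : Cmod (pint S1 g) <= 2 * kf / h).
    { apply Side. left; trivial.
      - intros z [s [Hs ->]]. eapply Rle_trans. 2: apply Re_le_Cmod. simpl in *. lra.
      - match goal with |- Cmod ?x = _ => replace x with (RtoC (2 * h) * Ci)%C by (rewrite RtoC_mult; ring) end.
        rewrite Cmod_mult, Cmod_R, Cmod_Ci, Rabs_pos_eq; lra. }
    assert (B2 : Cmod (pint S2 g) <= 2 * kf / h).
    { apply Side. right; left; trivial.
      - intros z [s [Hs ->]]. eapply Rle_trans. 2: apply im_le_Cmod. eapply Rle_trans. 2: apply Rle_abs. simpl in *. lra.
      - match goal with |- Cmod ?x = _ => replace x with (- RtoC (2 * h))%C by (rewrite RtoC_mult; ring) end.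
        rewrite Cmod_opp, Cmod_R, Rabs_pos_eq; lra. }
    assert (B4 : Cmod (pint S4 g) <= 2 * kf / h).
    { apply Side. right; right; right; left; trivial.
      - intros z [s [Hs ->]]. eapply Rle_trans. 2: apply im_le_Cmod. rewrite <- Rabs_Ropp. eapply Rle_trans. 2: apply Rle_abs. simpl in *. lra.
      - match goal with |- Cmod ?x = _ => replace x with (RtoC (2 * h))%C by (rewrite RtoC_mult; ring) end.
        rewrite Cmod_R, Rabs_pos_eq; lra. }
    assert (E3 : pint S3 g = vint sg g (- h) h).
    { rewrite <- (seg_down sg (- h) h g); trivial. 2: lra. unfold S3, c. f_equal. f_equal; rewrite RtoC_plus, ?RtoC_opp; ring. }
    rewrite E3, chint_vchain.
    assert (B3 : Cmod (vint sg g (- h) h - vint sg g (- T) T) <= 2 * kt / T).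
    { apply vint_tails; trivial; try lra. intros z Hz HzT. eapply Rle_trans. apply Cmod_pole_le. apply DL; trivial. apply KT; trivial. lra. }
    replace (pint S1 g + (pint S2 g + (vint sg g (- h) h + (pint S4 g + 0))) - vint sg g (- T) T)%C with
      ((vint sg g (- h) h - vint sg g (- T) T) + (pint S1 g + (pint S2 g + pint S4 g)))%C by ring.
    eapply Rle_trans. apply Cmod_triangle.
    assert (T1 := Cmod_triangle (pint S1 g) (pint S2 g + pint S4 g)). assert (T2 := Cmod_triangle (pint S2 g) (pint S4 g)).
    assert (6 * kf / h <= 1 / T).
    { apply Rle_div_l; [lra|]. replace (1 / T * h) with (h * / T) by (field; lra).
      apply Rmult_le_reg_r with T; [lra|]. replace (h * / T * T) with h by (field; lra). exact Hh5. }
    replace ((2 * kt + 1) / T) with (2 * kt / T + 1 / T) by (field; lra).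
    assert (6 * kf / h = 2 * kf / h + (2 * kf / h + 2 * kf / h)) by (field; lra). lra. }
  unfold double_int.
  replace (MU * (Mw * (2 * kt + 1)) / T) with (MU * (Mw * ((2 * kt + 1) / T))) by (field; lra).
  assert (0 < (2 * kt + 1) / T) by (apply Rdiv_lt_0_compat; lra).
  apply KU. apply Rmult_le_pos; lra.
  - apply cont_on_mult; trivial. apply kernel_int_cont; trivial. intros w Hw. apply not_supp_dist. intros z Hz. apply DR; trivial.
  - apply cont_on_mult; trivial. apply kernel_int_cont; trivial. intros w Hw. apply not_supp_dist. intros z Hz. apply DL; trivial. apply (supp_vchain _ _ _ Hz).
  - intros w Hw. replace (W w * cauchy_int (right_square sg h) F w - W w * cauchy_int (vchain sg T) F w)%C with
      (W w * (cauchy_int (right_square sg h) F w - cauchy_int (vchain sg T) F w))%C by ring.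
    rewrite Cmod_mult. apply Rmult_le_compat; try apply Cmod_ge_0. apply KW; trivial. apply U_annulus; trivial. apply Inner; trivial.
Qed.

Lemma double_int_line_conv eps mu1 mu2 sg T y1 y2 a1 b1 a2 b2 : 0 < eps -> 2 <= sg -> 0 < T ->
  growth mu1 a1 -> growth mu1 b1 ->
  growth mu2 a2 -> growth mu2 b2 ->
  forall eta, 0 < eta -> exists L0, forall L, L0 <= L ->
    Cmod (double_int (vchain sg T) (scaled_wt eps a1 b1 L y1) (fun z => / scaled_wt eps a2 b2 L y2 z)%C -
          double_int (vchain sg T) (lim_wt eps mu1 y1) (fun z => / lim_wt eps mu2 y2 z)%C) <= eta.
Proof.
  intros He Hsg HT Ha1 Hb1 Ha2 Hb2.
  assert (HsT : 0 < sg + T) by lra.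
  assert (UW := uconv_wt eps mu1 2 1 a1 b1 y1 He ltac:(lra) Rlt_0_1 Ha1 Hb1).
  assert (UF := uconv_inv_wt eps mu2 (sg + T) 1 a2 b2 y2 He HsT Rlt_0_1 Ha2 Hb2).
  assert (GU := good_square 0 1). destruct (chint_close (square 0 1) GU) as [MU [HMU KU]].
  assert (GV := good_vchain sg T HT). destruct (chint_close (vchain sg T) GV) as [MV [HMV KV]].
  assert (HV : forall z, supp (vchain sg T) z -> annulus (sg + T) 1 z).
  { intros z Hz. apply supp_vchain in Hz. destruct Hz as [H1 H2]. unfold vline in H1. split.
    - eapply Rle_trans. apply Cmod_le_sum. rewrite H1, Rabs_pos_eq; lra.
    - intros x [<-|[]]. replace (z - 0)%C with z by ring. eapply Rle_trans. 2: apply Re_le_Cmod. lra. }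
  assert (DL : forall w z, supp (square 0 1) w -> supp (vchain sg T) z -> 1 <= Cmod (w - z)).
  { intros w z Hw Hz. apply dist_U_line; trivial. apply supp_vchain in Hz. destruct Hz as [Hz _]. unfold vline in Hz. lra. }
  set (F0 := fun z => (/ lim_wt eps mu2 y2 z)%C).
  assert (CF0 : cont_on (supp (vchain sg T)) F0). { apply cont_on_inv_lim_wt. intros z Hz. apply supp_vchain in Hz. apply (vline_neq_0 sg). lra. apply Hz. }
  assert (Ck : forall F, cont_on (supp (vchain sg T)) F -> cont_on (supp (square 0 1)) (fun w => cauchy_int (vchain sg T) F w)%C).
  { intros F CF. apply kernel_int_cont; trivial. intros w Hw. apply not_supp_dist. intros z Hz. auto. }
  assert (UI : uconv (supp (square 0 1)) (fun L w => chint (vchain sg T) (fun z => / scaled_wt eps a2 b2 L y2 z * / (w - z))%C) (fun w => cauchy_int (vchain sg T) F0 w%C)).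
  { intros eta Heta. destruct (UF (eta / MV)) as [L0 K0]. apply Rdiv_lt_0_compat; lra.
    exists (Rmax L0 (eps * sg + 1)). intros L HL w Hw.
    destruct (Rmax_le _ _ _ HL) as [HLa HLb].
    assert (HLp : 0 < L) by nra.
    assert (CF : cont_on (supp (vchain sg T)) (fun z => / scaled_wt eps a2 b2 L y2 z)%C).
    { apply cont_on_inv_wt. intros z Hz. apply supp_vchain in Hz. destruct Hz as [Hz _]. unfold vline in Hz. apply (halfplane_regular _ sg); auto; try lra.
      split. apply Rdiv_lt_0_compat; lra. apply Rlt_div_l; nra. replace (/ (eps / L)) with (L / eps) by (field; lra). apply Rlt_div_r; lra. }
    assert (Nw : ~ supp (vchain sg T) w) by (apply not_supp_dist; intros z Hz; auto).
    replace eta with (MV * (eta / MV)) by (field; lra). apply KV; auto using cont_on_kernel. apply Rlt_le, Rdiv_lt_0_compat; lra.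
    intros z Hz. replace (/ scaled_wt eps a2 b2 L y2 z * / (w - z) - F0 z * / (w - z))%C with ((/ scaled_wt eps a2 b2 L y2 z - F0 z) * / (w - z))%C by ring.
    eapply Rle_trans. apply Cmod_pole_le. auto. apply K0; auto. }
  intros eta Heta.
  assert (UW' : uconv (supp (square 0 1)) (fun L => scaled_wt eps a1 b1 L y1) (lim_wt eps mu1 y1)).
  { intros e' He'. destruct (UW e' He') as [L0 K0]. exists L0. intros L HL w Hw. apply K0; trivial. apply U_annulus; trivial. }
  assert (Bl : bounded_on (supp (square 0 1)) (lim_wt eps mu1 y1)).
  { destruct (lim_wt_bounded eps mu1 y1 2 1 ltac:(lra) Rlt_0_1) as [M [HM K]]. exists M. split; trivial. intros w Hw. apply K. apply U_annulus; trivial. }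
  assert (Bi := cont_on_bounded (square 0 1) _ GU (Ck F0 CF0)).
  destruct (uconv_mult _ _ _ _ _ Bl Bi UW' UI (eta / MU)) as [L0 K0].
  apply Rdiv_lt_0_compat; lra.
  exists (Rmax L0 (eps * sg + 1)). intros L HL.
    destruct (Rmax_le _ _ _ HL) as [HLa HLb].
    assert (HLp : 0 < L) by nra.
    unfold double_int. replace eta with (MU * (eta / MU)) by (field; lra). apply KU.
    + apply Rlt_le, Rdiv_lt_0_compat; lra.
    + apply cont_on_mult. apply cont_on_wt, U_neq_0. apply Ck.
      apply cont_on_inv_wt. intros z Hz. apply supp_vchain in Hz. destruct Hz as [Hz _]. unfold vline in Hz. apply (halfplane_regular _ sg); auto; try lra.
      split. apply Rdiv_lt_0_compat; lra. apply Rlt_div_l; nra. replace (/ (eps / L)) with (L / eps) by (field; lra). apply Rlt_div_r; lra.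
    + apply cont_on_mult. apply cont_on_lim_wt, U_neq_0. apply Ck; trivial.
    + intros w Hw. apply K0; trivial.
Qed.

Lemma single_conv eps mu1 mu2 y1 y2 a1 b1 a2 b2 : 0 < eps ->
  growth mu1 a1 -> growth mu1 b1 ->
  growth mu2 a2 -> growth mu2 b2 ->
  forall eta, 0 < eta -> exists L0, forall L, L0 <= L ->
    Cmod (chint (square 0 1) (fun w => scaled_wt eps a1 b1 L y1 w * / scaled_wt eps a2 b2 L y2 w)%C -
          chint (square 0 1) (fun w => lim_wt eps mu1 y1 w * / lim_wt eps mu2 y2 w)%C) <= eta.
Proof.
  intros He Ha1 Hb1 Ha2 Hb2 eta Heta.
  assert (UW := uconv_wt eps mu1 2 1 a1 b1 y1 He ltac:(lra) Rlt_0_1 Ha1 Hb1).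
  assert (UF := uconv_inv_wt eps mu2 2 1 a2 b2 y2 He ltac:(lra) Rlt_0_1 Ha2 Hb2).
  assert (GU := good_square 0 1). destruct (chint_close (square 0 1) GU) as [MU [HMU KU]].
  destruct (uconv_mult _ _ _ _ _ (lim_wt_bounded eps mu1 y1 2 1 ltac:(lra) Rlt_0_1) (inv_lim_wt_bounded eps mu2 y2 2 1 ltac:(lra) Rlt_0_1) UW UF (eta / MU)) as [L0 K0].
  apply Rdiv_lt_0_compat; lra.
  exists (Rmax L0 (4 * eps + 1)). intros L HL.
  destruct (Rmax_le _ _ _ HL) as [HLa HLb].
  assert (HLp : 0 < L) by nra.
  replace eta with (MU * (eta / MU)) by (field; lra). apply KU.
  - apply Rlt_le, Rdiv_lt_0_compat; lra.
  - apply cont_on_mult. apply cont_on_wt, U_neq_0. apply cont_on_inv_wt. intros w Hw.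
    assert (He0 : 0 < eps / L) by (apply Rdiv_lt_0_compat; lra).
    apply regular_avoid; trivial. assert (Hi : / (eps / L) = L / eps) by (field; lra).
    assert (B1 : Cmod w <= 2) by (apply (U_annulus w Hw)). assert (B2 : 1 <= Cmod w) by (apply Cmod_U; trivial).
    intros [E|[E|[E|[]]]]; rewrite <- E in *.
    + rewrite Cmod_0 in B2; lra.
    + rewrite Cmod_R, Rabs_pos_eq in B2 by lra. apply Rle_div_r in B2; lra.
    + rewrite Hi in B1. rewrite Cmod_R, Rabs_pos_eq in B1 by (apply Rlt_le, Rdiv_lt_0_compat; lra). apply Rle_div_l in B1; lra.
  - apply cont_on_mult. apply cont_on_lim_wt, U_neq_0. apply cont_on_inv_lim_wt, U_neq_0.
  - intros w Hw. apply K0; trivial. apply U_annulus; trivial.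
Qed.

(** * The limit weight and the contour S near infinity *)

(** Half of the Gaussian absorbs the linear exponent by completing the square, the other half the power. *)
Lemma gauss al be m : 0 < al -> exists k, 0 < k /\ forall y, 1 <= y -> exp (be * y - al * y ^ 2) * y ^ m <= k.
Proof.
  intros Hal. set (N := INR (S m)). assert (HN : 1 <= N) by (unfold N; rewrite S_INR; generalize (pos_INR m); lra).
  set (c := al / (2 * N)). assert (Hc : 0 < c) by (apply Rdiv_lt_0_compat; lra).
  exists (exp (be ^ 2 / (2 * al)) / c ^ S m).
  assert (Hcm : 0 < c ^ S m) by (apply pow_lt; trivial).
  split. apply Rdiv_lt_0_compat; trivial. apply exp_pos.
  intros y Hy.
  assert (E1 : be * y - al * y ^ 2 <= be ^ 2 / (2 * al) - al * y ^ 2 / 2).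
  { apply Rmult_le_reg_r with (2 * al). lra.
    replace ((be ^ 2 / (2 * al) - al * y ^ 2 / 2) * (2 * al)) with (be ^ 2 - al * y ^ 2 * al) by (field; lra).
    assert (0 <= (be - al * y) ^ 2) by apply pow2_ge_0. nra. }
  assert (E2 : c ^ S m * y ^ m <= exp (al * y ^ 2 / 2)).
  { replace (al * y ^ 2 / 2) with (INR (S m) * (c * y ^ 2)) by (unfold c, N; field; unfold N in HN; lra). rewrite exp_INR.
    apply Rle_trans with ((c * y ^ 2) ^ S m).
    - rewrite Rpow_mult_distr. apply Rmult_le_compat_l. lra. rewrite <- pow_mult. apply Rle_pow; trivial. lia.
    - apply pow_incr. split. apply Rmult_le_pos. lra. apply pow2_ge_0. generalize (one_plus_le_exp (c * y ^ 2)). lra. }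
  assert (Hym : 0 < y ^ m) by (apply pow_lt; lra).
  eapply Rle_trans. apply Rmult_le_compat_r. lra. apply exp_le. exact E1.
  unfold Rminus. rewrite exp_plus, exp_Ropp. set (X := exp (al * y ^ 2 / 2)) in *. assert (HX : 0 < X) by apply exp_pos.
  unfold Rdiv at 2. rewrite Rmult_assoc. apply Rmult_le_compat_l. left; apply exp_pos.
  apply Rmult_le_reg_r with (X * c ^ S m). apply Rmult_lt_0_compat; trivial.
  replace (/ X * y ^ m * (X * c ^ S m)) with (c ^ S m * y ^ m) by (field; lra).
  replace (/ c ^ S m * (X * c ^ S m)) with X by (field; lra). trivial.
Qed.

(** In the sector Re z <= |Im z| / 2 the real part of z^2 is at most - 3/4 (Im z)^2. *)
Lemma inv_lim_wt_decay eps mu n : 0 < eps -> exists k, 0 < k /\ forall z, 0 < Re z -> Re z <= Rabs (Im z) / 2 -> 1 <= Rabs (Im z) ->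
  Cmod (/ lim_wt eps mu n z) <= k / Im z ^ 2.
Proof.
  intros He. set (N := Z.abs_nat n). set (al := 3 * eps ^ 2 / 8). set (be := 2 * eps * Rabs mu). set (ga := eps * Rabs mu + eps ^ 2 / 2).
  assert (He2 : 0 < eps ^ 2) by (apply pow_lt; trivial).
  destruct (gauss al be (N + 2)) as [k [Hk K]]. unfold al; lra.
  assert (H2N : 0 < 2 ^ N) by (apply pow_lt; lra).
  exists (exp ga * 2 ^ N * k). split. repeat apply Rmult_lt_0_compat; trivial. apply exp_pos.
  intros z Hx Hxy Hy. set (y := Rabs (Im z)) in *.
  assert (Hzy : Cmod z <= 2 * y). { eapply Rle_trans. apply Cmod_le_sum. fold y. rewrite Rabs_pos_eq; lra. }
  assert (Hz1 : 1 <= Cmod z) by (eapply Rle_trans; [exact Hy | apply im_le_Cmod]).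
  assert (Nz : z <> 0%C) by (intros ->; rewrite Cmod_0 in Hz1; lra).
  assert (Hy2 : Im z ^ 2 = y ^ 2) by (unfold y; rewrite pow2_abs; trivial).
  destruct (Cmod_Cpowz_bounds z n Hz1) as [P1 _]. fold N in P1.
  assert (Hmu := Rabs_pos mu).
  assert (Hiz : Cmod (/ z) <= 1). { rewrite Cmod_inv, <- Rinv_1; trivial. apply Rinv_le_contravar; lra. }
  unfold lim_wt. rewrite Cinv_mult, Cmod_mult, <- Cexp_opp, Cmod_Cexp; [| apply Cexp_neq_0 | apply Cpowz_neq_0; trivial].
  assert (Ere : Re (- - (eps * mu * (z + / z) + eps ^ 2 / 2 * (z * z + / z * / z))) <= ga + (be * y - al * y ^ 2)).
  { replace (- - (eps * mu * (z + / z) + eps ^ 2 / 2 * (z * z + / z * / z)))%C with ((eps * mu)%R * (z + / z) + (eps ^ 2 / 2)%R * (z * z + / z * / z))%C.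
    2:{ rewrite RtoC_mult, RtoC_div, RtoC_pow by lra. ring. }
    rewrite re_plus, !re_scal_l.
    assert (A1 : eps * mu * Re (z + / z) <= eps * Rabs mu * (2 * y + 1)).
    { eapply Rle_trans. apply Rle_abs. rewrite !Rabs_mult, (Rabs_pos_eq eps) by lra. apply Rmult_le_compat_l. nra.
      eapply Rle_trans. apply re_le_Cmod. eapply Rle_trans. apply Cmod_triangle. lra. }
    assert (A2 : Re (z * z + / z * / z) <= 1 - 3 / 4 * y ^ 2).
    { rewrite re_plus. assert (Re (/ z * / z) <= 1). { eapply Rle_trans. apply Re_le_Cmod. rewrite Cmod_mult. generalize (Cmod_ge_0 (/ z)). nra. }
      rewrite re_mult. assert (Im z * Im z = y * y) by (replace (Im z * Im z) with (Im z ^ 2) by ring; rewrite Hy2; ring). nra. }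
    assert (eps ^ 2 / 2 * Re (z * z + / z * / z) <= eps ^ 2 / 2 * (1 - 3 / 4 * y ^ 2)) by (apply Rmult_le_compat_l; lra).
    unfold ga, be, al. lra. }
  assert (Hq : Cmod (/ Cpowz z n) <= 2 ^ N * y ^ N).
  { rewrite Cmod_inv by (apply Cpowz_neq_0; trivial). apply Rle_trans with (Cmod z ^ N).
    - rewrite <- (Rinv_inv (Cmod z ^ N)). apply Rinv_le_contravar; trivial. apply Rinv_0_lt_compat, pow_lt; lra.
    - rewrite <- Rpow_mult_distr. apply pow_incr. split; trivial. apply Cmod_ge_0. }
  specialize (K y Hy). rewrite pow_add in K.
  apply Rmult_le_reg_r with (y ^ 2). apply pow_lt; lra. rewrite Hy2.
  replace (exp ga * 2 ^ N * k / y ^ 2 * y ^ 2) with (exp ga * 2 ^ N * k) by (field; lra).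
  apply Rle_trans with (exp (ga + (be * y - al * y ^ 2)) * (2 ^ N * y ^ N) * y ^ 2).
  - apply Rmult_le_compat_r. apply pow2_ge_0. apply Rmult_le_compat; trivial. left; apply exp_pos. apply Cmod_ge_0. apply exp_le; trivial.
  - rewrite exp_plus. replace (exp ga * exp (be * y - al * y ^ 2) * (2 ^ N * y ^ N) * y ^ 2) with
      (exp ga * 2 ^ N * (exp (be * y - al * y ^ 2) * (y ^ N * y ^ 2))) by ring.
    apply Rmult_le_compat_l; trivial. apply Rmult_le_pos. left; apply exp_pos. lra.
Qed.

Lemma chain_attains_min l q : good l -> l <> nil -> exists z0, supp l z0 /\ forall z, supp l z -> Cmod (z0 - q) <= Cmod (z - q).
Proof.
  induction l as [|p l IH]; intros Gl Hn. congruence. clear Hn.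
  assert (Hp := good_hd _ _ Gl). assert (Hlt : pa p < pb p) by apply Hp.
  destruct (ccont_attains_min (pg p) q (pa p) (pb p)) as [s0 [Hs0 K0]]. lra. intros s Hs. apply good_piece_ccont; trivial.
  assert (S0 : psupp p (pg p s0)) by (exists s0; auto).
  destruct l as [|p' l'].
  - exists (pg p s0). split. apply supp_1; trivial. intros z Hz. apply supp_1 in Hz. destruct Hz as [s [Hs ->]]. auto.
  - destruct (IH (good_tl _ _ Gl)) as [z1 [[p1 [Hp1 S1]] K1]]. congruence.
    destruct (Rle_dec (Cmod (pg p s0 - q)) (Cmod (z1 - q))) as [H|H].
    + exists (pg p s0). split. exists p. split; [left|]; trivial. intros z [p2 [[<-|Hp2] S2]].
      * destruct S2 as [s [Hs ->]]. auto.
      * eapply Rle_trans. exact H. apply K1. exists p2; auto.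
    + exists z1. split. exists p1. split; [right|]; trivial. intros z [p2 [[<-|Hp2] S2]].
      * destruct S2 as [s [Hs ->]]. specialize (K0 s Hs). lra.
      * apply K1. exists p2; auto.
Qed.

(** The convergence of an improper integral and an estimate of its value both follow from approximations v T with
an error K / T that holds for all far enough end points: such v T form a Cauchy family. *)
Lemma improper_int (f : R -> C) (v : R -> C) (K T1 : R) : 0 <= K -> 1 <= T1 ->
  (forall T, T1 <= T -> filter_prod (Rbar_locally m_infty) (Rbar_locally p_infty)
     (fun ab => exists I, cis_int f (fst ab) (snd ab) I /\ Cmod (I - v T) <= K / T)) ->
  exists l, RInt_gen (V := C_R_CompleteNormedModule) f (Rbar_locally m_infty) (Rbar_locally p_infty) = l /\
    forall T, T1 <= T -> Cmod (l - v T) <= K / T.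
Proof.
  intros HK HT1 H.
  assert (Cau : forall T T', T1 <= T -> T1 <= T' -> Cmod (v T - v T') <= K / T + K / T').
  { intros T T' HT HT'. assert (HP := filter_and _ _ (H T HT) (H T' HT')).
    destruct (filter_ex _ HP) as [[a b] [[I [I1 I2]] [I' [I1' I2']]]].
    assert (I = I') by (rewrite <- (cis_int_cint _ _ _ _ I1); apply cis_int_cint; trivial). subst I'.
    eapply Rle_trans. apply (Cmod_dist_triangle _ I). rewrite Cmod_minus_sym. lra. }
  assert (Small : forall e, 0 < e -> exists T0, T1 <= T0 /\ forall T, T0 <= T -> K / T <= e).
  { intros e He. exists (Rmax T1 (K / e)). split. apply Rmax_l. intros T HT.
    destruct (Rmax_le _ _ _ HT) as [HTa HTb].
    apply Rle_div_l. lra. apply Rle_div_l in HTb; trivial. lra. }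
  assert (Lim : forall g : C -> R, (forall x y, Rabs (g x - g y) <= Cmod (x - y)) -> exists L : R, filterlim (fun T => g (v T)) (Rbar_locally p_infty) (locally L)).
  { intros g Hg. apply (filterlim_locally_cauchy (U := R_CompleteSpace) (F := Rbar_locally p_infty) (fun T => g (v T))).
    intros e. destruct (Small (e / 3)) as [T0 [HT0 S0]]. generalize (cond_pos e); lra.
    exists (fun T => T0 < T). split. exists T0; auto. intros T T' HT HT'.
    change (Rabs (g (v T') - g (v T)) < e). eapply Rle_lt_trans. apply Hg. eapply Rle_lt_trans. apply Cau; lra.
    assert (S1 := S0 T ltac:(lra)). assert (S2 := S0 T' ltac:(lra)). generalize (cond_pos e); lra. }
  destruct (Lim Re) as [L1 HL1]. { intros x y. rewrite <- re_minus. apply re_le_Cmod. }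
  destruct (Lim Im) as [L2 HL2]. { intros x y. rewrite <- im_minus. apply im_le_Cmod. }
  set (l := (L1, L2) : C).
  assert (Conv : forall e, 0 < e -> exists T0, forall T, T0 < T -> Cmod (l - v T) < e).
  { intros e He. assert (He2 : 0 < e / 2) by lra.
    assert (X1 := proj1 (filterlim_locally _ _) HL1 (mkposreal _ He2)). assert (X2 := proj1 (filterlim_locally _ _) HL2 (mkposreal _ He2)).
    destruct X1 as [M1 X1]. destruct X2 as [M2 X2]. exists (Rmax M1 M2). intros T HT.
    specialize (X1 T (Rle_lt_trans _ _ _ (Rmax_l _ _) HT)). specialize (X2 T (Rle_lt_trans _ _ _ (Rmax_r _ _) HT)).
    change (Rabs (Re (v T) - L1) < e / 2) in X1. change (Rabs (Im (v T) - L2) < e / 2) in X2.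
    rewrite Cmod_minus_sym. eapply Rle_lt_trans. apply Cmod_le_sum. rewrite re_minus, im_minus. simpl (Re l). simpl (Im l). lra. }
  assert (Bd : forall T, T1 <= T -> Cmod (l - v T) <= K / T).
  { intros T HT. apply le_epsilon. intros e He. destruct (Conv (e / 2)) as [T0 C0]; [lra|]. destruct (Small (e / 2)) as [T2 [HT2 S2]]; [lra|].
    set (T' := Rmax (T0 + 1) T2). assert (A1 := Rmax_l (T0 + 1) T2). assert (A2 := Rmax_r (T0 + 1) T2). fold T' in A1, A2.
    specialize (C0 T' ltac:(lra)). specialize (S2 T' A2). assert (C1 := Cau T' T ltac:(lra) HT).
    eapply Rle_trans. apply (Cmod_dist_triangle _ (v T')). lra. }
  exists l. split; trivial.
  apply is_RInt_gen_unique. unfold is_RInt_gen. intros P [d HP].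
  assert (Hd := cond_pos d). destruct (Small (d / 3)) as [T0 [HT0 S0]]. lra. specialize (S0 T0 (Rle_refl _)).
  unfold filtermapi. eapply filter_imp. 2: exact (H T0 HT0). intros [a b] [I [I1 I2]]. exists I. split. apply cis_int_is_RInt; trivial.
  apply HP. assert (Cmod (I - l) < d). { eapply Rle_lt_trans. apply (Cmod_dist_triangle _ (v T0)). specialize (Bd T0 HT0). rewrite (Cmod_minus_sym (v T0)). lra. }
  split.
  - change (Rabs (Re I - Re l) < d). rewrite <- re_minus. eapply Rle_lt_trans. apply re_le_Cmod. trivial.
  - change (Rabs (Im I - Im l) < d). rewrite <- im_minus. eapply Rle_lt_trans. apply im_le_Cmod. trivial.
Qed.

(** Closes an arc of S from u to v: horizontally to the line Re z = sg, along it, and horizontally back. *)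
Definition closing (sg : R) (u v : C) : chain :=
  seg v (sg - (- Im v)%R * Ci) :: seg (sg - (- Im v)%R * Ci) (sg - (- Im u)%R * Ci) :: seg (sg - (- Im u)%R * Ci) u :: nil.

Lemma good_closing sg u v : good (closing sg u v).
Proof. intros p [<-|[<-|[<-|[]]]]; apply good_seg. Qed.

Lemma boundary_closing sg u v G : boundary (closing sg u v) G = (G u - G v)%C.
Proof. unfold closing, boundary, fold_right. rewrite !seg_start, !seg_end. ring. Qed.

(** Points far up or down in the sector where the inverse limit weight decays; the ends of S get there. *)
Definition far_pt (T : R) (z : C) : Prop := 0 < Re z /\ Re z <= Rabs (Im z) / 2 /\ T <= Rabs (Im z).

Lemma supp_hseg (sg y : R) (v z : C) : Im v = y -> psupp (seg v (sg - (- y)%R * Ci)) z \/ psupp (seg (sg - (- y)%R * Ci) v) z ->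
  Im z = y /\ (Re v <= Re z <= sg \/ sg <= Re z <= Re v).
Proof.
  intros E [[s [Hs ->]]|[s [Hs ->]]]; destruct v as [a b]; simpl in *; subst b; (split; [ring|]);
  destruct (Rle_dec a sg); [left|right|left|right]; nra.
Qed.

Lemma supp_closing sg T u v z : 0 < sg -> 2 * sg <= T -> far_pt T u -> far_pt T v ->
  supp (closing sg u v) z -> 0 < Re z /\ sg <= Cmod z.
Proof.
  intros Hsg HT [U1 [U2 U3]] [V1 [V2 V3]] [p [[<-|[<-|[<-|[]]]] Hz]].
  - destruct (supp_hseg sg (Im v) v z eq_refl (or_introl Hz)) as [E H]. split. lra. eapply Rle_trans. 2: apply im_le_Cmod. rewrite E. lra.
  - destruct Hz as [s [Hs ->]]. simpl. split. lra. eapply Rle_trans. 2: apply Re_le_Cmod. simpl. lra.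
  - destruct (supp_hseg sg (Im u) u z eq_refl (or_intror Hz)) as [E H]. split. lra. eapply Rle_trans. 2: apply im_le_Cmod. rewrite E. lra.
Qed.

(** The horizontal segments from u and v to the line have length O(|Im|) and carry an
integrand O(1 / |Im|^2); the vertical one differs from the cut line in its tails only. *)
Lemma closing_estimate eps mu n sg k : 2 <= sg -> 0 < k ->
  (forall z, 0 < Re z -> Re z <= Rabs (Im z) / 2 -> 1 <= Rabs (Im z) -> Cmod (/ lim_wt eps mu n z) <= k / Im z ^ 2) ->
  forall T u v w, 2 * sg <= T -> far_pt T u -> far_pt T v -> 0 < Im u -> Im v < 0 -> Cmod w <= sg - 1 ->
  let g := fun z => (/ lim_wt eps mu n z * / (w - z))%C in
  Cmod (chint (closing sg u v) g + vint sg g (- T) T)%C <= 4 * k / T.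
Proof.
  intros Hsg Hk HB T u v w HT Hu Hv Iu Iv Hw g.
  assert (Hu' := Hu). assert (Hv' := Hv). destruct Hu' as [U1 [U2 U3]]. destruct Hv' as [V1 [V2 V3]].
  rewrite (Rabs_pos_eq (Im u)) in * by lra. rewrite (Rabs_left (Im v)) in * by lra.
  assert (D1 : forall z, sg <= Cmod z -> 1 <= Cmod (w - z)).
  { intros z Hz. rewrite Cmod_minus_sym. assert (X := Cmod_triangle_rev z w). lra. }
  assert (Cg : forall X : C -> Prop, (forall z, X z -> sg <= Cmod z) -> cont_on X g).
  { intros X HX. unfold g. apply cont_on_mult. apply cont_on_inv_lim_wt. intros z Hz ->. specialize (HX _ Hz). rewrite Cmod_0 in HX. lra.
    apply cont_on_inv; cont. intros z Hz E. specialize (D1 z (HX z Hz)). rewrite E, Cmod_0 in D1. lra. }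
  assert (Cl : cont_on (vline sg) g). { apply Cg. intros z Hz. eapply Rle_trans. 2: apply Re_le_Cmod. unfold vline in Hz. lra. }
  assert (Bg : forall z, far_pt T z -> sg <= Cmod z -> Cmod (g z) <= k / Im z ^ 2).
  { intros z [Z1 [Z2 Z3]] Hz. eapply Rle_trans. apply Cmod_pole_le. auto. apply HB; lra. }
  unfold closing, chint, fold_right. rewrite seg_up; trivial; try lra.
  assert (Hor : forall p, (forall z, psupp p z -> exists x, far_pt T x /\ Im z = Im x /\ T <= Rabs (Im x) /\ (Re x <= Re z <= sg \/ sg <= Re z <= Re x)) -> forall z, psupp p z -> far_pt T z /\ sg <= Cmod z).
  { intros p Hp z Hz. destruct (Hp z Hz) as [x [[X1 [X2 X3]] [X4 [X5 X6]]]]. split. split; [|split]; rewrite ?X4; lra.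
    eapply Rle_trans. 2: apply im_le_Cmod. rewrite X4. lra. }
  assert (B1 : Cmod (pint (seg v (sg - (- Im v)%R * Ci)) g) <= k / T).
  { assert (Hs := Hor (seg v (sg - (- Im v)%R * Ci))).
    assert (Hs' : forall z, psupp (seg v (sg - (- Im v)%R * Ci)) z -> far_pt T z /\ sg <= Cmod z /\ Im z = Im v).
    { intros z Hz. destruct (supp_hseg sg (Im v) v z eq_refl (or_introl Hz)) as [E H]. destruct (Hs) with (z := z) as [Q1 Q2]; trivial; [|tauto].
      intros z' Hz'. exists v. destruct (supp_hseg sg (Im v) v z' eq_refl (or_introl Hz')) as [E' H']. split; trivial. split; trivial. split; trivial. rewrite Rabs_left; lra. }
    eapply Rle_trans. apply pint_seg_bound with (B := k / Im v ^ 2). apply Cg. intros z Hz; apply (Hs' z Hz).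
    - intros z Hz. destruct (Hs' z Hz) as [Q1 [Q2 Q3]]. rewrite <- Q3. apply Bg; trivial.
    - replace (sg - (- Im v)%R * Ci - v)%C with (RtoC (sg - Re v)). 2: { apply C_ext; rewrite ?re_minus, ?im_minus, ?re_RtoC, ?im_RtoC, ?re_scal_l, ?im_scal_l; simpl; ring. }
      rewrite Cmod_R. assert (Rabs (sg - Re v) <= - Im v). { apply Rabs_le; lra. }
      assert (Hi : 0 < k / Im v ^ 2). { apply Rdiv_lt_0_compat; nra. }
      apply Rle_trans with (k / Im v ^ 2 * (- Im v)). apply Rmult_le_compat_l; lra.
      replace (k / Im v ^ 2 * - Im v) with (k * / (- Im v)) by (field; lra). apply Rmult_le_compat_l. lra. apply Rinv_le_contravar; lra. }
  assert (B2 : Cmod (pint (seg (sg - (- Im u)%R * Ci) u) g) <= k / T).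
  { assert (Hs := Hor (seg (sg - (- Im u)%R * Ci) u)).
    assert (Hs' : forall z, psupp (seg (sg - (- Im u)%R * Ci) u) z -> far_pt T z /\ sg <= Cmod z /\ Im z = Im u).
    { intros z Hz. destruct (supp_hseg sg (Im u) u z eq_refl (or_intror Hz)) as [E H]. destruct (Hs) with (z := z) as [Q1 Q2]; trivial; [|tauto].
      intros z' Hz'. exists u. destruct (supp_hseg sg (Im u) u z' eq_refl (or_intror Hz')) as [E' H']. split; trivial. split; trivial. split; trivial. rewrite Rabs_pos_eq; lra. }
    eapply Rle_trans. apply pint_seg_bound with (B := k / Im u ^ 2). apply Cg. intros z Hz; apply (Hs' z Hz).
    - intros z Hz. destruct (Hs' z Hz) as [Q1 [Q2 Q3]]. rewrite <- Q3. apply Bg; trivial.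
    - replace (u - (sg - (- Im u)%R * Ci))%C with (RtoC (Re u - sg)). 2: { apply C_ext; rewrite ?re_minus, ?im_minus, ?re_RtoC, ?im_RtoC, ?re_scal_l, ?im_scal_l; simpl; ring. }
      rewrite Cmod_R. assert (Rabs (Re u - sg) <= Im u). { apply Rabs_le; lra. }
      assert (Hi : 0 < k / Im u ^ 2). { apply Rdiv_lt_0_compat; nra. }
      apply Rle_trans with (k / Im u ^ 2 * Im u). apply Rmult_le_compat_l; lra.
      replace (k / Im u ^ 2 * Im u) with (k * / Im u) by (field; lra). apply Rmult_le_compat_l. lra. apply Rinv_le_contravar; lra. }
  assert (B3 : Cmod (vint sg g (- Im u) (- Im v) - vint sg g (- T) T) <= 2 * k / T).
  { apply vint_tails; trivial; try lra. intros z Hz HzT. unfold vline in Hz. apply Bg. split; lra. eapply Rle_trans. 2: apply Re_le_Cmod. lra. }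
  match goal with |- Cmod ?x <= _ => replace x with (pint (seg v (sg - (- Im v)%R * Ci)) g + (pint (seg (sg - (- Im u)%R * Ci) u) g - (vint sg g (- Im u) (- Im v) - vint sg g (- T) T)))%C by ring end.
  eapply Rle_trans. apply Cmod_triangle. eapply Rle_trans. apply Rplus_le_compat_l. apply Cmod_triangle_minus.
  replace (4 * k / T) with (k / T + (k / T + 2 * k / T)) by (field; lra). lra.
Qed.

(** * Cutting the contour S *)

(** The limit kernel with S replaced by the line Re z = sg cut at height T, in the form that [K_reduced] gives to K. *)
Definition limit_trunc (eps sg T : R) (x1 : Z) (mu1 : R) (x2 : Z) (mu2 : R) : C :=
  (- ((if Rlt_dec mu1 mu2 then 1 else 0) / two_pi_i)
     * chint (square 0 1) (fun w => lim_wt eps mu1 x1 w * / lim_wt eps mu2 (x2 + 1) w)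
   + / (two_pi_i * two_pi_i) *
     (double_int (vchain sg T) (lim_wt eps mu1 x1) (fun z => / lim_wt eps mu2 (x2 + 1) z) +
      double_int (vchain sg T) (lim_wt eps mu1 (- x1 - 1)) (fun z => / lim_wt eps mu2 (- x2) z)))%C.

(** A closed chain Z in the right half-plane that stays off G0 and off the disc inside G0
has index 0 about every point of G0: G0 is connected, its point p0 nearest to 0 can be
joined to 0, and the index about 0 vanishes.  The same holds for the inverse of Z, joining the
farthest point P0 of G0 to infinity. *)
Lemma index_zero G0 l0 Z p0 P0 : piecewise_C1 G0 0 1 ->
  (forall z, supp l0 z <-> exists s, 0 <= s <= 1 /\ z = G0 s) -> ~ supp l0 0%C ->
  good Z -> closed_chain Z -> supp l0 p0 -> supp l0 P0 ->
  (forall z, supp Z z -> 0 < Re z /\ Cmod p0 <= Cmod z /\ ~ supp l0 z /\ Cmod (/ z) <= Cmod P0 /\ ~ supp l0 (/ z)%C) ->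
  ~ supp Z 0%C /\ index Z 0 = 0%C /\ forall w, supp l0 w -> ~ supp Z w /\ index Z w = 0%C /\ ~ supp Z (/ w)%C /\ index Z (/ w) = 0%C.
Proof.
  intros Hpw Sl N0 GZ CZ Hp0 HP0 HZ.
  assert (NZ0 : ~ supp Z 0%C). { intros Hs. apply HZ in Hs. destruct Hs as [Hs _]. simpl in Hs. lra. }
  assert (WZ0 : index Z 0 = 0%C).
  { apply (index_halfplane _ _ 1%C); trivial. apply C1_nz. intros z Hz. destruct (HZ z Hz) as [H _].
    replace (1 * (z - 0))%C with z by ring. trivial. }
  assert (NZ : forall w, supp l0 w -> ~ supp Z w). { intros w Hw Hs. destruct (HZ w Hs) as [_ [_ [H _]]]. auto. }
  assert (Hne : forall w, supp l0 w -> w <> 0%C) by (intros w Hw ->; auto).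
  assert (NiZ : forall w, supp l0 w -> ~ supp Z (/ w)%C).
  { intros w Hw Hs. destruct (HZ _ Hs) as [_ [_ [_ [_ H]]]]. apply H. rewrite Cinv_inv. trivial. }
  split; trivial. split; trivial.
  assert (Const : forall Y, good Y -> closed_chain Y -> (forall w, supp l0 w -> ~ supp Y w) ->
    forall w w', supp l0 w -> supp l0 w' -> index Y w = index Y w').
  { intros Y GY CY NY w w' Hw Hw'. apply Sl in Hw. apply Sl in Hw'. destruct Hw as [s [Hs ->]]. destruct Hw' as [s' [Hs' ->]].
    assert (Fl : forall r, 0 <= r <= 1 -> flat (index Y) (G0 r)).
    { intros r Hr. apply flat_index; trivial. apply NY. apply Sl. exists r; auto. }
    rewrite (flat_piecewise _ _ _ _ Hpw Fl s Hs), (flat_piecewise _ _ _ _ Hpw Fl s' Hs'). reflexivity. }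
  assert (W1 : index Z p0 = 0%C).
  { rewrite <- WZ0. apply index_seg; trivial. intros z [s [Hs ->]] Hz. simpl in Hs.
    destruct (Rle_lt_or_eq_dec s 1) as [Hlt| ->]; [lra| |].
    - destruct (HZ _ Hz) as [_ [H _]]. simpl in H. replace (0 + s * (p0 - 0))%C with (s * p0)%C in H by ring.
      rewrite Cmod_mult, Cmod_R, Rabs_pos_eq in H by lra. assert (0 < Cmod p0) by (apply Cmod_gt_0, Hne; trivial). nra.
    - apply (NZ p0 Hp0). simpl in Hz. replace (0 + 1 * (p0 - 0))%C with p0 in Hz by ring. trivial. }
  set (iZ := inv_chain Z). assert (GiZ : good iZ) by (apply good_inv; trivial). assert (CiZ : closed_chain iZ) by (apply closed_inv; trivial).
  assert (NiZ' : forall w, supp l0 w -> ~ supp iZ w). { intros w Hw Hs. apply supp_inv in Hs. apply (NiZ w Hw Hs). }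
  assert (W2 : index iZ P0 = 0%C).
  { apply (index_ray _ _ P0); trivial. apply Hne; trivial. intros t Ht Hs.
    destruct (Req_dec t 0) as [->|Hn].
    - apply (NiZ' P0 HP0). replace (P0 + 0 * P0)%C with P0 in Hs by ring. trivial.
    - apply supp_inv in Hs. destruct (HZ _ Hs) as [_ [_ [_ [H _]]]]. rewrite Cinv_inv in H.
      replace (P0 + t * P0)%C with (RtoC (1 + t) * P0)%C in H by (rewrite RtoC_plus; ring). rewrite Cmod_mult, Cmod_R, Rabs_pos_eq in H by lra.
      assert (0 < Cmod P0) by (apply Cmod_gt_0, Hne; trivial). nra. }
  intros w Hw. split; auto. split. rewrite <- W1. apply Const; auto. split; auto.
  assert (E : index iZ w = 0%C) by (rewrite <- W2; apply Const; auto).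
  unfold iZ in E. rewrite index_inv, WZ0 in E; auto. replace (index Z (/ w)) with (index Z (/ w) - 0)%C by ring. trivial.
Qed.

Lemma limit_integrand eps mu1 mu2 x1 x2 (w z : C) : w <> 0%C -> z <> 0%C -> w <> z ->
  (limit_weight eps mu2 z * Cpowz w x1 / (limit_weight eps mu1 w * Cpowz z x2) * / (z * (w - z)))%C =
  (lim_wt eps mu1 x1 w * (/ lim_wt eps mu2 (x2 + 1) z * / (w - z)))%C.
Proof.
  intros Hw Hz Hwz. assert (Hd : (w - z <> 0)%C) by (intros E; apply Hwz, Ceq_minus; trivial).
  rewrite lim_wt_shift; trivial. unfold lim_wt, limit_weight. rewrite !Cexp_opp.
  assert (E : forall (mu : R) (v : C), v <> 0%C -> Cexp (eps * mu * (v + / v) + eps ^ 2 / 2 * (v + / v) ^ 2) = (Cexp (eps * mu * (v + / v) + eps ^ 2 / 2 * (v * v + / v * / v)) * Cexp (eps ^ 2))%C).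
  { intros mu v Hv. rewrite <- Cexp_plus. f_equal. field; trivial. }
  rewrite !E; trivial.
  assert (N1 := Cexp_neq_0 (eps * mu1 * (w + / w) + eps ^ 2 / 2 * (w * w + / w * / w))%C).
  assert (N2 := Cexp_neq_0 (eps * mu2 * (z + / z) + eps ^ 2 / 2 * (z * z + / z * / z))%C).
  assert (N3 := Cexp_neq_0 (eps ^ 2)%C). assert (N4 := Cpowz_neq_0 z x2 Hz).
  revert N1 N2 N3. generalize (Cexp (eps * mu1 * (w + / w) + eps ^ 2 / 2 * (w * w + / w * / w))%C) (Cexp (eps * mu2 * (z + / z) + eps ^ 2 / 2 * (z * z + / z * / z))%C) (Cexp (eps ^ 2)%C).
  intros a b c N1 N2 N3. field. repeat split; trivial.
Qed.

Lemma limit_single_integrand (eps mu1 mu2 : R) x1 x2 (w : C) : w <> 0%C ->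
  (Cexp (eps * (mu2 - mu1) * (w + / w)) * Cpowz w (x1 - x2 - 1))%C = (lim_wt eps mu1 x1 w * / lim_wt eps mu2 (x2 + 1) w)%C.
Proof.
  intros Hw. unfold lim_wt. rewrite !Cexp_opp.
  replace (x1 - x2 - 1)%Z with (x1 + - (x2 + 1))%Z by ring. rewrite (Cpowz_add w x1), Cpowz_opp; trivial.
  assert (N1 := Cexp_neq_0 (eps * mu1 * (w + / w) + eps ^ 2 / 2 * (w * w + / w * / w))%C).
  assert (N2 := Cexp_neq_0 (eps * mu2 * (w + / w) + eps ^ 2 / 2 * (w * w + / w * / w))%C).
  assert (N4 := Cpowz_neq_0 w (x2 + 1) Hw).
  replace (Cexp (eps * mu2 * (w + / w) + eps ^ 2 / 2 * (w * w + / w * / w))) with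
    (Cexp (eps * (mu2 - mu1) * (w + / w)) * Cexp (eps * mu1 * (w + / w) + eps ^ 2 / 2 * (w * w + / w * / w)))%C in *.
  2:{ rewrite <- Cexp_plus. f_equal. ring. }
  assert (N5 := Cexp_neq_0 (eps * (mu2 - mu1) * (w + / w))%C).
  revert N1 N5. generalize (Cexp (eps * mu1 * (w + / w) + eps ^ 2 / 2 * (w * w + / w * / w))%C) (Cexp (eps * (mu2 - mu1) * (w + / w))%C).
  intros a b N1 N5. field. repeat split; trivial.
Qed.

Lemma ends_far G0 S T : limit_contours G0 S ->
  filter_prod (Rbar_locally m_infty) (Rbar_locally p_infty)
   (fun ab => fst ab < snd ab /\ far_pt T (S (fst ab)) /\ far_pt T (S (snd ab)) /\ 0 < Im (S (fst ab)) /\ Im (S (snd ab)) < 0).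
Proof.
  intros [_ [_ [_ [HRe [L1 [L2 [L3 [L4 _]]]]]]]].
  assert (Hh : 0 < / 2) by lra.
  set (M := Rmax T 1). assert (HM1 : T <= M) by apply Rmax_l. assert (HM2 : 1 <= M) by apply Rmax_r.
  assert (E1 : Rbar_locally m_infty (fun a => a < 0 /\ M < Im (S a) /\ Rabs (Re (S a) / Im (S a) - 0) < / 2)).
  { apply filter_and. exists 0. intros; trivial. apply filter_and. apply (L1 (fun y => M < y)). exists M. trivial.
    apply (L2 (fun y => Rabs (y - 0) < / 2)). exists (mkposreal _ Hh). intros y Hy. exact Hy. }
  assert (E2 : Rbar_locally p_infty (fun a => 0 < a /\ Im (S a) < - M /\ Rabs (Re (S a) / Im (S a) - 0) < / 2)).
  { apply filter_and. exists 0. intros; trivial. apply filter_and. apply (L3 (fun y => y < - M)). exists (- M). trivial.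
    apply (L4 (fun y => Rabs (y - 0) < / 2)). exists (mkposreal _ Hh). intros y Hy. exact Hy. }
  apply (Filter_prod _ _ _ _ _ E1 E2). intros a b [A1 [A2 A3]] [B1 [B2 B3]]. simpl.
  assert (Ra := HRe a). assert (Rb := HRe b).
  rewrite Rminus_0_r in A3, B3. unfold Rdiv in A3, B3. rewrite Rabs_mult, Rabs_inv in A3, B3.
  assert (HA : 0 < Rabs (Im (S a))) by (rewrite Rabs_pos_eq; lra). assert (HB : 0 < Rabs (Im (S b))) by (rewrite Rabs_left; lra).
  assert (FA : Re (S a) <= Rabs (Im (S a)) / 2).
  { rewrite (Rabs_pos_eq (Re (S a))) in A3 by lra. apply (Rmult_lt_compat_r _ _ _ HA) in A3. rewrite Rmult_assoc, Rinv_l in A3; lra. }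
  assert (FB : Re (S b) <= Rabs (Im (S b)) / 2).
  { rewrite (Rabs_pos_eq (Re (S b))) in B3 by lra. apply (Rmult_lt_compat_r _ _ _ HB) in B3. rewrite Rmult_assoc, Rinv_l in B3; lra. }
  unfold far_pt. rewrite (Rabs_pos_eq (Im (S a))) in * by lra. rewrite (Rabs_left (Im (S b))) in * by lra. repeat split; lra.
Qed.

(** Replacing an arc of S by the cut line in a Cauchy integral at a point w of index 0: the closed chain that they form
with [closing] integrates to 0. *)
Lemma arc_estimate eps mu n sg k : 2 <= sg -> 0 < k ->
  (forall z, 0 < Re z -> Re z <= Rabs (Im z) / 2 -> 1 <= Rabs (Im z) -> Cmod (/ lim_wt eps mu n z) <= k / Im z ^ 2) ->
  forall T s u v w, 2 * sg <= T -> far_pt T u -> far_pt T v -> 0 < Im u -> Im v < 0 -> Cmod w <= sg - 1 -> w <> 0%C ->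
  good s -> closed_chain (s ++ closing sg u v) -> ~ supp (s ++ closing sg u v) 0%C -> index (s ++ closing sg u v) 0 = 0%C ->
  ~ supp (s ++ closing sg u v) w -> index (s ++ closing sg u v) w = 0%C ->
  Cmod (chint s (fun z => / lim_wt eps mu n z * / (w - z)) - vint sg (fun z => / lim_wt eps mu n z * / (w - z)) (- T) T)%C <= 4 * k / T.
Proof.
  intros Hsg Hk HB T s u v w HT Hu Hv Iu Iv Hw Nw Gs CZ NZ0 WZ0 NZw WZw.
  assert (Est := closing_estimate eps mu n sg k Hsg Hk HB T u v w HT Hu Hv Iu Iv Hw).
  set (F := fun z => (/ lim_wt eps mu n z)%C). set (g := fun z => (/ lim_wt eps mu n z * / (w - z))%C) in *.
  set (Z := s ++ closing sg u v) in *. assert (GZ : good Z) by (apply good_app; [trivial | apply good_closing]).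
  assert (CF : cont_on (supp Z) F) by (apply cont_on_inv_lim_wt; intros z Hz ->; auto).
  assert (E : chint Z g = 0%C).
  { unfold g. change (fun z => / lim_wt eps mu n z * / (w - z))%C with (fun z => F z * / (w - z))%C. rewrite kernel_sign; trivial.
    assert (D := cauchy_diff Z nil (RtoC 0 :: nil) F w GZ good_nil CZ closed_nil).
    assert (D' : (chint Z (fun z => F z * / (z - w)) - chint nil (fun z => F z * / (z - w)) = F w * (index Z w - index nil w))%C).
    { apply D; trivial. apply avoids_1; trivial. apply avoids_1. intros [p [[] _]]. intros a [<-|[]]. rewrite WZ0. reflexivity.
      apply approx_inv_lim_wt; left; trivial. intros [H|[]]; auto. intros [p [[] _]]. }
    rewrite WZw, index_nil in D'. change (chint nil _) with (RtoC 0) in D'.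
    replace (chint Z (fun z => F z * / (z - w)))%C with (chint Z (fun z => F z * / (z - w)) - 0)%C by ring. rewrite D'. ring. }
  unfold Z in E. rewrite chint_app in E.
  replace (chint s g - vint sg g (- T) T)%C with ((chint s g + chint (closing sg u v) g) - (chint (closing sg u v) g + vint sg g (- T) T))%C by ring.
  rewrite E. replace (0 - (chint (closing sg u v) g + vint sg g (- T) T))%C with (- (chint (closing sg u v) g + vint sg g (- T) T))%C by ring. rewrite Cmod_opp. exact Est.
Qed.

(** * The limit kernel on fixed contours *)

Lemma lim_wt_hat eps mu2 x2 (u : C) : u <> 0%C -> (/ lim_wt eps mu2 (x2 + 1) (/ u) * / u)%C = (/ lim_wt eps mu2 (- x2) u)%C.
Proof.
  intros Hu. rewrite lim_wt_inv; trivial. replace (- x2)%Z with (- (x2 + 1) + 1)%Z by ring.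
  rewrite lim_wt_shift; trivial. rewrite Cinv_mult; trivial. apply lim_wt_neq_0; trivial.
Qed.

Lemma chain_extremes l : good l -> l <> nil -> ~ supp l 0%C -> exists p P, supp l p /\ supp l P /\
  0 < Cmod p /\ forall z, supp l z -> Cmod p <= Cmod z <= Cmod P.
Proof.
  intros Gl Ln N0. assert (S0 : forall z : C, (z - 0)%C = z) by (intros; ring).
  assert (Hne : forall w, supp l w -> w <> 0%C) by (intros w Hw ->; auto).
  destruct (chain_attains_min l 0%C Gl Ln) as [p [Hp Kp]].
  destruct (chain_attains_min (inv_chain l) 0%C (good_inv l Gl N0)) as [q [Hq Kq]]. { destruct l; simpl; congruence. }
  apply supp_inv in Hq. assert (Nq : q <> 0%C). { intros ->. apply (Hne _ Hq), Cinv_0. }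
  exists p, (/ q)%C. split; trivial. split; trivial. split. apply Cmod_gt_0; auto.
  intros z Hz. rewrite S0 in Kp, Kq. split. specialize (Kp z Hz). rewrite S0 in Kp. trivial.
  specialize (Kq (/ z)%C). rewrite supp_inv, Cinv_inv, S0, Cmod_inv in Kq by auto. specialize (Kq Hz).
  rewrite Cmod_inv, <- (Rinv_inv (Cmod z)) by trivial. apply Rinv_le_contravar; trivial. apply Cmod_gt_0; trivial.
Qed.

Lemma index_far l M z : good l -> closed_chain l -> (forall z, supp l z -> Cmod z <= M) -> M < Cmod z -> 0 < Cmod z ->
  ~ supp l z /\ index l z = 0%C.
Proof.
  intros Gl Cl K Hz Hp. split. intros Hs. specialize (K z Hs). lra.
  apply (index_ray l z z); trivial. intros ->. rewrite Cmod_0 in Hp. lra.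
  intros t Ht Hs. specialize (K _ Hs). replace (z + t * z)%C with (RtoC (1 + t) * z)%C in K by (rewrite RtoC_plus; ring).
  rewrite Cmod_mult, Cmod_R, Rabs_pos_eq in K by lra. nra.
Qed.

(** The same moves as in [kernel_reduce], with the loop G0 in place of the w-contour: the line and its inverse lie on
opposite sides of it, so that no residue appears. *)
Lemma trunc_double_int eps mu1 mu2 x1 x2 l sg T : good l -> closed_chain l -> ~ supp l 0%C -> index l 0 = two_pi_i -> 2 <= sg -> 0 < T ->
  (forall z, sg <= Cmod z -> ~ supp l z /\ index l z = 0%C /\ ~ supp l (/ z)%C /\ index l (/ z) = two_pi_i) ->
  let W := lim_wt eps mu1 x1 in let F := fun z => (/ lim_wt eps mu2 (x2 + 1) z)%C in
  let H := fun w => (W w * cauchy_int (vchain sg T) F w + W w * cauchy_int (inv_chain (vchain sg T)) F w)%C in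
  cont_on (supp l) H /\
  chint l H = (double_int (vchain sg T) W F + double_int (vchain sg T) (lim_wt eps mu1 (- x1 - 1)) (fun z => / lim_wt eps mu2 (- x2) z))%C.
Proof.
  intros Gl Cl N0 W0 Hsg HTp Far W F H. set (Fh := fun z => (/ lim_wt eps mu2 (- x2) z)%C).
  assert (VN : forall z, supp (vchain sg T) z -> sg <= Cmod z /\ Re z = sg).
  { intros z Hz. apply supp_vchain in Hz. destruct Hz as [Hz _]. unfold vline in Hz. split; trivial. rewrite <- Hz. apply Re_le_Cmod. }
  assert (V0 : ~ supp (vchain sg T) 0%C). { intros Hs. apply VN in Hs. rewrite Cmod_0 in Hs. lra. }
  assert (GV := good_vchain sg T HTp). assert (Hh : forall z, supp (vchain sg T) z -> (F (/ z) * / z)%C = Fh z) by (intros z Hz; apply lim_wt_hat; intros ->; auto).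
  assert (CFV : cont_on (supp (vchain sg T)) F) by (apply cont_on_inv_lim_wt; intros z Hz ->; auto).
  assert (CFhV : cont_on (supp (vchain sg T)) (fun u => F (/ u) * / u)%C).
  { apply (cont_on_ext _ Fh). intros z Hz. symmetry. auto. apply cont_on_inv_lim_wt; intros z Hz ->; auto. }
  assert (CFiV : cont_on (supp (inv_chain (vchain sg T))) F) by (apply cont_on_inv_lim_wt; intros z Hz ->; apply (not_supp_inv_0 _ V0 Hz)).
  assert (lV : forall w, supp l w -> ~ supp (vchain sg T) w). { intros w Hw Hs. apply VN in Hs. destruct (Far w) as [A _]; tauto. }
  assert (liV : forall w, supp l w -> ~ supp (inv_chain (vchain sg T)) w).
  { intros w Hw Hs. apply supp_inv, VN in Hs. destruct (Far (/ w)%C) as [_ [_ [A _]]]; [tauto|]. rewrite Cinv_inv in A. auto. }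
  assert (CW : cont_on (supp l) W) by (apply cont_on_lim_wt; intros z Hz ->; auto).
  assert (Ca : cont_on (supp l) (fun w => W w * cauchy_int (vchain sg T) F w)%C) by (apply cont_on_mult; trivial; apply kernel_int_cont; auto).
  assert (Cb : cont_on (supp l) (fun w => W w * cauchy_int (inv_chain (vchain sg T)) F w)%C) by (apply cont_on_mult; trivial; apply kernel_int_cont; auto using good_inv).
  split. { apply cont_on_plus; trivial. }
  destruct (index_U_in 0%C) as [NU0 WU0]. rewrite Cmod_0; lra.
  unfold H. rewrite chint_plus; trivial.
  rewrite (double_cauchy l (square 0 1) (vchain sg T) (RtoC 0 :: nil) W F 0); trivial; auto using good_square, closed_square, avoids_1.
  - rewrite (inv_side l (vchain sg T) W F); trivial.
    + unfold double_int. rewrite (chint_ext (square 0 1) (fun w => W (/ w) * / w * _)%C (fun w => lim_wt eps mu1 (- x1 - 1) w * cauchy_int (vchain sg T) Fh w)%C); auto using good_square. ring.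
      intros w Hw. unfold W. rewrite lim_wt_inv_shift by (apply U_neq_0; trivial). f_equal. apply chint_ext; trivial.
      intros z Hz. f_equal. auto.
    + apply (approx_ext _ (lim_wt eps mu1 (- x1 - 1))). intros w Hw'. symmetry. apply lim_wt_inv_shift. intros E; apply Hw'; left; auto. apply approx_lim_wt; left; trivial.
    + intros z Hz. destruct (VN z Hz) as [Z1 Z2]. split. lra. apply Far; trivial.
  - intros a [<-|[]]. congruence.
  - apply approx_lim_wt; left; trivial.
  - intros z Hz. destruct (VN z Hz) as [Z1 Z2]. destruct (Far z Z1) as [A1 [A2 _]]. destruct (index_U_out z) as [B1 B2]. lra. rewrite A2, B2. repeat split; trivial. ring.
Qed.

(** For each w on G0, the improper integrals over S and over 1/S are compared with the cut line by [arc_estimate], at w and,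
after inversion, at 1/w; the estimates are uniform in w. *)
Lemma limit_reduced eps x1 x2 mu1 mu2 G0 S : 0 < eps -> limit_contours G0 S ->
  exists sg k T1, 2 <= sg /\ 0 <= k /\ 1 <= T1 /\ forall T, T1 <= T ->
    Cmod (limit_K eps G0 S x1 mu1 x2 mu2 - limit_trunc eps sg T x1 mu1 x2 mu2) <= k / T.
Proof.
  intros He hG. assert (Far := fun T => ends_far G0 S T hG).
  destruct hG as [HG [E0 [HS [HRe [_ [_ [_ [_ [HO HE]]]]]]]]].
  destruct (cycle_chain (G0 :: nil)) as [l0 [Gl [Cl [Sl' Il]]]]. { intros c [<-|[]]; trivial. }
  destruct (encircles_index _ _ _ Sl' Il E0) as [N0 W0].
  assert (Sl : forall z, supp l0 z <-> exists s, 0 <= s <= 1 /\ z = G0 s).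
  { intros z. rewrite Sl'. split. intros [c [s [[<-|[]] Hs]]]. exists s; trivial. intros [s Hs]. exists G0, s. split; [left|]; trivial. }
  assert (Int0 : forall f, contour_int G0 f = cycle_int (G0 :: nil) f) by (intros f; unfold cycle_int; simpl; ring).
  assert (HOl : forall r, ~ supp l0 (S r) /\ index l0 (S r) = 0%C) by (intros r; apply (outside_index _ _ _ Sl' Il), HO).
  assert (HEl : forall r, ~ supp l0 (/ S r)%C /\ index l0 (/ S r)%C = two_pi_i) by (intros r; apply (encircles_index _ _ _ Sl' Il), HE).
  assert (Hne : forall w, supp l0 w -> w <> 0%C) by (intros w Hw ->; auto).
  assert (HSn : forall r, S r <> 0%C). { intros r E. specialize (HRe r). rewrite E in HRe. simpl in HRe. lra. }
  assert (Lne : l0 <> nil). { intros ->. apply two_pi_i_neq_0. rewrite <- W0. reflexivity. }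
  destruct (chain_extremes l0 Gl Lne N0) as [p0 [P0 [Hp0 [HP0 [Gmin Ext]]]]].
  assert (Hpm := proj2 (Ext p0 Hp0)). assert (Gmax : 0 < Cmod P0) by lra.
  assert (Kmin : forall z, supp l0 z -> Cmod p0 <= Cmod z) by apply Ext. assert (Kmax : forall z, supp l0 z -> Cmod z <= Cmod P0) by apply Ext.
  (* the line lies to the right of G0, and its inverse inside G0 *)
  set (sg := 2 + Cmod P0 + / Cmod p0). assert (Hip : 0 < / Cmod p0) by (apply Rinv_0_lt_compat; trivial).
  assert (Hsg : 2 <= sg) by (unfold sg; lra).
  assert (HsP : Cmod P0 <= sg - 1) by (unfold sg; lra). assert (Hsp : / Cmod p0 <= sg - 1) by (unfold sg; lra).
  assert (WFar : forall z, Cmod P0 < Cmod z -> ~ supp l0 z /\ index l0 z = 0%C).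
  { intros z Hz. apply (index_far l0 (Cmod P0)); trivial. lra. }
  assert (WNear : forall z, Cmod z < Cmod p0 -> ~ supp l0 z /\ index l0 z = two_pi_i).
  { intros z Hz. rewrite <- W0. apply (index_near l0 (Cmod p0)); trivial. intros z' Hz'. replace (z' - 0)%C with z' by ring. auto. }
  assert (InvSmall : forall z, sg <= Cmod z -> Cmod (/ z) < Cmod p0).
  { intros z Hz. rewrite Cmod_inv by (intros ->; rewrite Cmod_0 in Hz; lra). rewrite <- (Rinv_inv (Cmod p0)). apply Rinv_lt_contravar; [|lra].
    apply Rmult_lt_0_compat; lra. }
  (* S cannot enter the disc inside G0, as the index of G0 is 1 there and 0 on S; likewise for 1/S and the exterior of G0 *)
  assert (SNear : forall r, Cmod p0 <= Cmod (S r)).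
  { intros r. apply Rnot_lt_le. intros H. destruct (WNear _ H) as [_ X]. destruct (HOl r) as [_ Y]. apply two_pi_i_neq_0. congruence. }
  assert (SInv : forall r, Cmod (/ S r) <= Cmod P0).
  { intros r. apply Rnot_lt_le. intros H. destruct (WFar _ H) as [_ X]. destruct (HEl r) as [_ Y]. apply two_pi_i_neq_0. congruence. }
  set (n1 := (x2 + 1)%Z). set (n2 := (- x2)%Z).
  destruct (inv_lim_wt_decay eps mu2 n1 He) as [k1 [Hk1 D1]]. destruct (inv_lim_wt_decay eps mu2 n2 He) as [k2 [Hk2 D2]].
  set (W := lim_wt eps mu1 x1). set (F := fun z => (/ lim_wt eps mu2 n1 z)%C). set (Fh := fun z => (/ lim_wt eps mu2 n2 z)%C).
  assert (CW : cont_on (supp l0) W) by (apply cont_on_lim_wt; trivial).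
  destruct (cont_on_bounded l0 W Gl CW) as [Mw [HMw KMw]].
  set (K := Mw * (4 * k1) + Mw * (/ Cmod p0 * (4 * k2))).
  assert (HK1 : 0 < Mw * (4 * k1)) by (apply Rmult_lt_0_compat; lra).
  assert (HK2 : 0 < Mw * (/ Cmod p0 * (4 * k2))) by (repeat apply Rmult_lt_0_compat; lra).
  set (integrand := fun w z => (limit_weight eps mu2 z * Cpowz w x1 / (limit_weight eps mu1 w * Cpowz z x2) * / (z * (w - z)))%C).
  assert (IntE : forall w z : C, w <> 0%C -> z <> 0%C -> w <> z -> integrand w z = (W w * (F z * / (w - z)))%C).
  { intros w z H1 H2 H3. apply limit_integrand; trivial. }
  assert (Arc : forall T, 2 * sg <= T -> filter_prod (Rbar_locally m_infty) (Rbar_locally p_infty)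
    (fun ab => forall w, supp l0 w ->
      (exists I, cis_int (fun s => integrand w (S s) * velocity S s)%C (fst ab) (snd ab) I /\
         Cmod (I - W w * vint sg (fun z => F z * / (w - z)) (- T) T)%C <= Mw * (4 * k1) / T) /\
      (exists I, cis_int (fun s => integrand w (/ S s) * velocity (fun s => / S s)%C s)%C (fst ab) (snd ab) I /\
         Cmod (I - W w * (/ w * vint sg (fun z => Fh z * / (/ w - z)) (- T) T))%C <= Mw * (/ Cmod p0 * (4 * k2)) / T))).
  { intros T HT. eapply filter_imp. 2: exact (Far T). intros [a b] [Hab [FA [FB [IA IB]]]] w Hw. simpl fst in *; simpl snd in *.
    destruct (piecewise_chain S a b (HS a b Hab)) as [s [_ [Gs [Ss [Bs [Is1 Is2]]]]]].
    set (Z := s ++ closing sg (S a) (S b)).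
    assert (GZ : good Z) by (apply good_app; [trivial | apply good_closing]).
    assert (CZ : closed_chain Z). { intros G. unfold Z. rewrite boundary_app, Bs, boundary_closing. ring. }
    assert (HZ : forall z, supp Z z -> 0 < Re z /\ Cmod p0 <= Cmod z /\ ~ supp l0 z /\ Cmod (/ z) <= Cmod P0 /\ ~ supp l0 (/ z)%C).
    { intros z Hz. apply supp_app in Hz. destruct Hz as [Hz|Hz].
      - apply Ss in Hz. destruct Hz as [r [_ ->]]. split; auto. split; auto. split. apply HOl. split; auto. apply HEl.
      - destruct (supp_closing sg T (S a) (S b) z) as [Hz1 Hz2]; trivial. lra. assert (Hz3 := InvSmall z Hz2). split; trivial. split. lra. split. apply WFar; lra. split. lra. apply WNear; trivial. }
    destruct (index_zero G0 l0 Z p0 P0 (proj1 HG) Sl N0 GZ CZ Hp0 HP0 HZ) as [NZ0 [WZ0 Idx]].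
    destruct (Idx w Hw) as [I1 [I2 [I3 I4]]]. assert (Nw := Hne w Hw).
    assert (Nws : ~ supp s w). { intros H. apply I1. unfold Z. rewrite supp_app. auto. }
    assert (Nws' : ~ supp s (/ w)%C). { intros H. apply I3. unfold Z. rewrite supp_app. auto. }
    assert (Ns0 : ~ supp s 0%C). { intros H. apply NZ0. unfold Z. rewrite supp_app. auto. }
    assert (HTp : 0 < T) by lra.
    assert (Cinvw : Cmod (/ w) <= / Cmod p0). { rewrite Cmod_inv; trivial. apply Rinv_le_contravar; auto. }
    assert (KMw' := KMw w Hw).
    split.
    - exists (W w * cauchy_int s F w)%C. split.
      + assert (CFs : cont_on (supp s) F) by (apply cont_on_inv_lim_wt; intros z Hz ->; auto).
        assert (Es : forall z, supp s z -> (W w * (F z * / (w - z)))%C = integrand w z).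
        { intros z Hz. symmetry. apply IntE; trivial. intros ->; auto. intros <-; auto. }
        assert (Ci : cont_on (supp s) (integrand w)).
        { eapply cont_on_ext. exact Es. apply cont_on_mult. apply cont_on_const. apply cont_on_kernel; trivial. }
        rewrite <- chint_scal, (chint_ext s _ (integrand w)); trivial. apply Is1; trivial. apply cont_on_kernel; trivial.
      + assert (Est := arc_estimate eps mu2 n1 sg k1 Hsg Hk1 D1 T s (S a) (S b) w HT FA FB IA IB).
        replace (W w * cauchy_int s F w - W w * vint sg (fun z => F z * / (w - z)) (- T) T)%C with
          (W w * (cauchy_int s F w - vint sg (fun z => F z * / (w - z)) (- T) T))%C by ring.
        rewrite Cmod_mult. replace (Mw * (4 * k1) / T) with (Mw * (4 * k1 / T)) by (field; lra).
        apply Rmult_le_compat; trivial; try apply Cmod_ge_0. apply Est; trivial. specialize (Kmax w Hw). lra.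
    - exists (W w * (/ w * cauchy_int s Fh (/ w)))%C. split.
      + assert (CFs : cont_on (supp (inv_chain s)) F). { apply cont_on_inv_lim_wt. intros z Hz ->. apply (not_supp_inv_0 s Ns0 Hz). }
        assert (Gis : good (inv_chain s)) by (apply good_inv; trivial).
        assert (Nwi : ~ supp (inv_chain s) w). { intros H. apply supp_inv in H. auto. }
        assert (Es : forall z, supp (inv_chain s) z -> (W w * (F z * / (w - z)))%C = integrand w z).
        { intros z Hz. symmetry. apply IntE; trivial. intros ->. apply (not_supp_inv_0 s Ns0 Hz). intros <-; auto. }
        assert (Ci : cont_on (supp (inv_chain s)) (integrand w)).
        { eapply cont_on_ext. exact Es. apply cont_on_mult. apply cont_on_const. apply cont_on_kernel; trivial. }
        assert (Hh : forall z, supp s z -> (F (/ z) * / z)%C = Fh z). { intros z Hz. apply lim_wt_hat. intros ->; auto. }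
        assert (In := inner_inv s F w Gs Ns0). rewrite (chint_ext s (fun z => Fh z * / (/ w - z))%C (fun u => (F (/ u) * / u) * / (/ w - u))%C), <- In; trivial.
        * rewrite <- chint_scal, (chint_ext (inv_chain s) _ (integrand w)); trivial. apply Is2; trivial. apply cont_on_kernel; trivial.
        * eapply cont_on_ext. intros z Hz. symmetry; apply Hh; trivial. apply cont_on_inv_lim_wt. intros z Hz ->; auto.
        * intros z Hz. rewrite Hh; trivial.
      + assert (Est := arc_estimate eps mu2 n2 sg k2 Hsg Hk2 D2 T s (S a) (S b) (/ w)%C HT FA FB IA IB).
        replace (W w * (/ w * cauchy_int s Fh (/ w)) - W w * (/ w * vint sg (fun z => Fh z * / (/ w - z)) (- T) T))%C with
          (W w * (/ w * (cauchy_int s Fh (/ w) - vint sg (fun z => Fh z * / (/ w - z)) (- T) T)))%C by ring.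
        rewrite !Cmod_mult. replace (Mw * (/ Cmod p0 * (4 * k2)) / T) with (Mw * (/ Cmod p0 * (4 * k2 / T))) by (field; lra).
        apply Rmult_le_compat; trivial; try apply Cmod_ge_0. apply Rmult_le_pos; apply Cmod_ge_0.
        apply Rmult_le_compat; trivial; try apply Cmod_ge_0. apply Est; trivial. lra. apply Cinv_neq_0; trivial. }
  set (H := fun w => (line_int S (integrand w) + line_int (fun s => / S s) (integrand w))%C).
  set (HT := fun T w => (W w * cauchy_int (vchain sg T) F w + W w * cauchy_int (inv_chain (vchain sg T)) F w)%C).
  assert (VN : forall T z, supp (vchain sg T) z -> sg <= Cmod z /\ Re z = sg).
  { intros T z Hz. apply supp_vchain in Hz. destruct Hz as [Hz _]. unfold vline in Hz. split; trivial. rewrite <- Hz. apply Re_le_Cmod. }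
  assert (V0 : forall T, ~ supp (vchain sg T) 0%C). { intros T Hs. apply VN in Hs. rewrite Cmod_0 in Hs. lra. }
  assert (Trunc : forall T, 0 < T -> cont_on (supp l0) (HT T) /\ chint l0 (HT T) = (double_int (vchain sg T) W F + double_int (vchain sg T) (lim_wt eps mu1 (- x1 - 1)) Fh)%C).
  { intros T HTp. apply trunc_double_int; trivial. intros z Hz. destruct (WFar z) as [A1 A2]. lra. destruct (WNear (/ z)%C) as [B1 B2]; auto. }
  assert (Close : forall T, 2 * sg <= T -> forall w, supp l0 w -> Cmod (H w - HT T w) <= K / T).
  { intros T HTs w Hw. assert (Nw := Hne w Hw).
    destruct (improper_int (fun s => integrand w (S s) * velocity S s)%C (fun T => W w * vint sg (fun z => F z * / (w - z)) (- T) T)%C (Mw * (4 * k1)) (2 * sg)) as [i1 [E1 B1]]; try lra.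
    { intros T' HT'. eapply filter_imp. 2: exact (Arc T' HT'). intros [a b] X. apply (X w Hw). }
    destruct (improper_int (fun s => integrand w (/ S s) * velocity (fun s => / S s)%C s)%C (fun T => W w * (/ w * vint sg (fun z => Fh z * / (/ w - z)) (- T) T))%C (Mw * (/ Cmod p0 * (4 * k2))) (2 * sg)) as [i2 [E2 B2]]; try lra.
    { intros T' HT'. eapply filter_imp. 2: exact (Arc T' HT'). intros [a b] X. apply (X w Hw). }
    unfold H, line_int. rewrite E1, E2. specialize (B1 T HTs). specialize (B2 T HTs). unfold HT.
    assert (HTp : 0 < T) by lra.
    assert (Hh : forall u, supp (vchain sg T) u -> (F (/ u) * / u)%C = Fh u) by (intros u Hu; apply lim_wt_hat; intros ->; apply (V0 T Hu)).
    rewrite (inner_inv (vchain sg T) F w); auto using good_vchain.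
    2:{ apply (cont_on_ext _ Fh). intros u Hu. symmetry. auto. apply cont_on_inv_lim_wt; intros u Hu ->; apply (V0 T Hu). }
    2:{ intros Hs. apply VN in Hs. destruct Hs as [Hs _]. assert (X := InvSmall _ Hs). rewrite Cinv_inv in X. specialize (Kmin w Hw). lra. }
    rewrite (chint_ext (vchain sg T) (fun u => F (/ u) * / u * / (/ w - u))%C (fun z => Fh z * / (/ w - z))%C); auto using good_vchain.
    2:{ intros z Hz. rewrite Hh; trivial. }
    rewrite !chint_vchain.
    match goal with |- Cmod (?a + ?b - (?c + ?d)) <= _ => replace (a + b - (c + d))%C with ((a - c) + (b - d))%C by ring end.
    eapply Rle_trans. apply Cmod_triangle. unfold K. replace ((Mw * (4 * k1) + Mw * (/ Cmod p0 * (4 * k2))) / T) with (Mw * (4 * k1) / T + Mw * (/ Cmod p0 * (4 * k2)) / T) by (field; lra). lra. }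
  assert (CH : cont_on (supp l0) H).
  { apply cont_on_limit. intros eta Heta. set (T := Rmax (2 * sg) (K / eta)). assert (T1 := Rmax_l (2 * sg) (K / eta)). assert (T2 := Rmax_r (2 * sg) (K / eta)). fold T in T1, T2.
    exists (HT T). split. apply Trunc; lra. intros z Hz. eapply Rle_trans. apply Close; trivial. apply Rle_div_l. lra. apply Rle_div_l in T2; trivial. lra. }
  destruct (chint_close l0 Gl) as [Ml [HMl KMl]].
  set (kk := Cmod (/ (two_pi_i * two_pi_i))). assert (Hkk := Cmod_ge_0 (/ (two_pi_i * two_pi_i))). fold kk in Hkk.
  assert (HK : 0 < K) by (unfold K; lra).
  exists sg, (kk * (Ml * K)), (2 * sg). split; trivial. split. { apply Rmult_le_pos; trivial. apply Rmult_le_pos; lra. } split. lra.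
  intros T HTs. assert (HTp : 0 < T) by lra.
  assert (GU := good_square 0 1). assert (CU := closed_square 0 1). destruct (index_U_in 0%C) as [NU0 WU0]. rewrite Cmod_0; lra.
  assert (AvL : avoids_list (supp l0) (RtoC 0 :: nil)) by (apply avoids_1; trivial).
  assert (AvU : avoids_list (supp (square 0 1)) (RtoC 0 :: nil)) by (apply avoids_1; trivial).
  destruct (Trunc T HTp) as [CHT Dbl].
  assert (Single : contour_int G0 (fun w => Cexp (eps * (mu2 - mu1) * (w + / w)) * Cpowz w (x1 - x2 - 1))%C = chint (square 0 1) (fun w => W w * F w)%C).
  { rewrite (contour_int_ext G0 _ (fun w => W w * F w)%C).
    - rewrite Int0, Il.
      + apply (cauchy_eq l0 (square 0 1) (RtoC 0 :: nil)); trivial. intros a [<-|[]]. congruence.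
        apply approx_mult. apply approx_lim_wt; left; trivial. apply approx_inv_lim_wt; left; trivial.
      + apply cont_on_mult; trivial. apply cont_on_inv_lim_wt; trivial.
    - intros s Hs. apply limit_single_integrand. apply Hne. apply Sl. exists s; auto. }
  change (limit_K eps G0 S x1 mu1 x2 mu2) with (- ((if Rlt_dec mu1 mu2 then 1 else 0) / two_pi_i) *
    contour_int G0 (fun w => Cexp (eps * (mu2 - mu1) * (w + / w)) * Cpowz w (x1 - x2 - 1)) +
    / (two_pi_i * two_pi_i) * contour_int G0 H)%C.
  rewrite Single, (Int0 H), Il by trivial.
  unfold limit_trunc. fold W. change (fun z => / lim_wt eps mu2 (x2 + 1) z)%C with F. change (fun z => / lim_wt eps mu2 (- x2) z)%C with Fh.
  change (fun w => W w * / lim_wt eps mu2 (x2 + 1) w)%C with (fun w => W w * F w)%C.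
  rewrite <- Dbl.
  match goal with |- Cmod (?a + ?b * ?c - (?a + ?b * ?d)) <= _ => replace (a + b * c - (a + b * d))%C with (b * (c - d))%C by ring end.
  rewrite Cmod_mult. fold kk. replace (kk * (Ml * K) / T) with (kk * (Ml * (K / T))) by (field; lra). apply Rmult_le_compat_l; trivial.
  apply KMl; auto. apply Rlt_le, Rdiv_lt_0_compat; lra.
Qed.

(** * The scaling limit *)

(** The exponents [m/2], for d = 0, and [(m+1)/2], for d = 1. *)
Definition half_section (d : Z) (mu L : R) : nat := Z.to_nat ((section_index L mu + d) / 2).

Lemma half_section_spec d mu L : (0 <= d <= 1)%Z -> 1 + Rabs mu <= L ->
  ((section_index L mu + d) / 2 = Z.of_nat (half_section d mu L))%Z /\ near_section mu L (half_section d mu L).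
Proof.
  intros Hd HL. unfold half_section, near_section. set (m := section_index L mu).
  assert (Hmu := proj1 (Rabs_le_between mu (Rabs mu)) (Rle_refl _)).
  assert (HLp : 0 < L) by (generalize (Rabs_pos mu); lra).
  assert (B : IZR m <= 2 * (L ^ 2 + mu * L) < IZR m + 1).
  { replace (2 * (L ^ 2 + mu * L)) with (2 * (L ^ 2 * (1 + mu / L))) by (field; lra). apply Zfloor_bound. }
  assert (Hm : (0 <= m)%Z). { apply le_IZR. assert (-1 < IZR m) by nra. apply lt_IZR in H. apply IZR_le. lia. }
  assert (Q := Z.div_pos (m + d) 2 ltac:(lia) ltac:(lia)).
  assert (D := Z.div_mod (m + d) 2 ltac:(lia)). assert (D' := Z.mod_pos_bound (m + d) 2 ltac:(lia)).
  rewrite Z2Nat.id by trivial. split; trivial.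
  rewrite INR_IZR_INZ, Z2Nat.id by trivial. set (q := ((m + d) / 2)%Z) in *.
  assert (E1 : (2 * q <= m + 1)%Z) by lia. assert (E2 : (m <= 2 * q + 1)%Z) by lia.
  apply IZR_le in E1, E2. rewrite !plus_IZR, ?mult_IZR in *. apply Rabs_le. lra.
Qed.

(** The distance of the two section indices grows like 2 L (mu2 - mu1). *)
Lemma section_index_lt mu1 mu2 : exists L0, forall L, L0 <= L -> forall (a b : C),
  (if Z_lt_dec (section_index L mu1) (section_index L mu2) then a else b) = (if Rlt_dec mu1 mu2 then a else b).
Proof.
  exists (Rmax 1 (/ Rabs (mu2 - mu1))). intros L HL a b.
  destruct (Rmax_le _ _ _ HL) as [HLa HLb].
  assert (E : forall mu, 2 * (L ^ 2 * (1 + mu / L)) = 2 * L ^ 2 + 2 * mu * L) by (intros; field; lra).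
  unfold section_index. rewrite !E.
  destruct (Rlt_dec mu1 mu2) as [H|H]; destruct (Z_lt_dec _ _) as [H'|H']; trivial; exfalso.
  - apply H'. apply lt_IZR.
    assert (B1 := Zfloor_bound (2 * L ^ 2 + 2 * mu1 * L)). assert (B2 := Zfloor_bound (2 * L ^ 2 + 2 * mu2 * L)).
    rewrite Rabs_pos_eq in HLb by lra. assert (1 <= (mu2 - mu1) * L). { rewrite <- (Rinv_r (mu2 - mu1)) by lra. apply Rmult_le_compat_l; lra. }
    lra.
  - apply (Zlt_not_le _ _ H'). apply Zfloor_le. nra.
Qed.

Theorem theorem2p3
    (eps : R) (heps : 0 < eps)
    (x1 x2 : Z) (mu1 mu2 : R)
    (g0 : R -> R -> C) (gs : R -> list (R -> C))
    (hg : forall L : R, 0 < L -> kernel_contours (eps / L) (g0 L) (gs L))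
    (G0 S : R -> C) (hG : limit_contours G0 S) :
  filterlim
    (fun L : R =>
       K (eps * L) (eps / L) (g0 L) (gs L)
         (IZR x1) (section_index L mu1) (IZR x2) (section_index L mu2))
    (Rbar_locally p_infty)
    (locally (limit_K eps G0 S x1 mu1 x2 mu2)).
Proof.
  destruct (limit_reduced eps x1 x2 mu1 mu2 G0 S heps hG) as [sg [k [T1 [Hsg [Hk [HT1 KT]]]]]].
  set (a1 := half_section 0 mu1). set (b1 := half_section 1 mu1). set (a2 := half_section 0 mu2). set (b2 := half_section 1 mu2).
  assert (Ex : forall d mu, (0 <= d <= 1)%Z -> exists L1, forall L, L1 <= L -> near_section mu L (half_section d mu L)).
  { intros d mu Hd. exists (1 + Rabs mu). intros L HL. apply half_section_spec; trivial. }
  assert (Ha1 := Ex 0%Z mu1 ltac:(lia)). assert (Hb1 := Ex 1%Z mu1 ltac:(lia)).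
  assert (Ha2 := Ex 0%Z mu2 ltac:(lia)). assert (Hb2 := Ex 1%Z mu2 ltac:(lia)).
  fold a1 in Ha1. fold b1 in Hb1. fold a2 in Ha2. fold b2 in Hb2.
  destruct (double_int_square_line eps mu1 mu2 sg x1 (x2 + 1) a1 b1 a2 b2 heps Hsg Ha1 Hb1 Ha2 Hb2) as [kA [LA [HkA KA]]].
  destruct (double_int_square_line eps mu1 mu2 sg (- x1 - 1) (- x2) b1 a1 b2 a2 heps Hsg Hb1 Ha1 Hb2 Ha2) as [kB [LB [HkB KB]]].
  destruct (section_index_lt mu1 mu2) as [LC KC].
  set (c := Cmod (/ (two_pi_i * two_pi_i))). set (c1 := Cmod (- ((if Rlt_dec mu1 mu2 then 1 else 0) / two_pi_i))%C).
  assert (Hc : 0 <= c) by apply Cmod_ge_0. assert (Hc1 : 0 <= c1) by apply Cmod_ge_0.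
  apply filterlim_locally. intros [d Hd].
  (* the truncation height makes the tails small, uniformly in L; then L is taken large *)
  set (M := k + c * (kA + kB)). assert (HM : 0 <= M) by (unfold M; nra).
  set (T := Rmax T1 (3 * M / d)).
  assert (HT : T1 <= T) by apply Rmax_l. assert (HTp : 0 < T) by lra.
  assert (HMT : M / T <= d / 3).
  { assert (X : 3 * M / d <= T) by apply Rmax_r. apply Rle_div_l; trivial. apply Rle_div_l in X; trivial. lra. }
  set (eta := d / (3 * (c1 + 2 * c + 1))).
  assert (Heta : 0 < eta) by (apply Rdiv_lt_0_compat; lra).
  destruct (double_int_line_conv eps mu1 mu2 sg T x1 (x2 + 1) a1 b1 a2 b2 heps Hsg HTp Ha1 Hb1 Ha2 Hb2 eta Heta) as [LD KD].
  destruct (double_int_line_conv eps mu1 mu2 sg T (- x1 - 1) (- x2) b1 a1 b2 a2 heps Hsg HTp Hb1 Ha1 Hb2 Ha2 eta Heta) as [LE KE].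
  destruct (single_conv eps mu1 mu2 x1 (x2 + 1) a1 b1 a2 b2 heps Ha1 Hb1 Ha2 Hb2 eta Heta) as [LF KF].
  set (L0 := Rmax (Rmax (Rmax LA LB) (Rmax LC LD)) (Rmax (Rmax LE LF) (Rmax (Rmax (1 + Rabs mu1) (1 + Rabs mu2)) (eps * sg + 1)))).
  exists L0. intros L HL. assert (HL' : L0 <= L) by lra. unfold L0 in HL'. clear HL.
  repeat match goal with H : Rmax ?a ?b <= _ |- _ =>
    assert (a <= L) by (eapply Rle_trans; [apply Rmax_l | exact H]);
    assert (b <= L) by (eapply Rle_trans; [apply Rmax_r | exact H]); clear H end.
  assert (HLp : 0 < L) by nra.
  specialize (KA L ltac:(trivial) T ltac:(lra)). specialize (KB L ltac:(trivial) T ltac:(lra)).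
  destruct KA as [hA KA]. destruct KB as [hB KB].
  set (h := Rmax (Rmax hA hB) (L / eps)).
  assert (Hh1 : hA <= h) by (eapply Rle_trans; [apply Rmax_l | apply Rmax_l]).
  assert (Hh2 : hB <= h) by (eapply Rle_trans; [apply Rmax_r | apply Rmax_l]).
  assert (Hh3 : L / eps <= h) by apply Rmax_r.
  assert (Hh : 0 < L / eps) by (apply Rdiv_lt_0_compat; trivial).
  specialize (KA h Hh1). specialize (KB h Hh2). cbv zeta in KA, KB.
  specialize (KC L ltac:(trivial)). specialize (KD L ltac:(trivial)). specialize (KE L ltac:(trivial)). specialize (KF L ltac:(trivial)).
  assert (Inv : / (eps / L) = L / eps) by (field; lra).
  assert (He1 : 0 < eps / L < 1). { split. apply Rdiv_lt_0_compat; trivial. apply Rlt_div_l; nra. }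
  assert (Hs : sg < L / eps). { apply Rlt_div_r; lra. }
  assert (S1 := half_section_spec 0 mu1 L ltac:(lia) ltac:(trivial)). assert (S2 := half_section_spec 1 mu1 L ltac:(lia) ltac:(trivial)).
  assert (S3 := half_section_spec 0 mu2 L ltac:(lia) ltac:(trivial)). assert (S4 := half_section_spec 1 mu2 L ltac:(lia) ltac:(trivial)).
  rewrite Z.add_0_r in S1, S3.
  assert (Red := K_reduced (eps * L) (eps / L) sg h (g0 L) (gs L) x1 _ x2 _ (a1 L) (b1 L) (a2 L) (b2 L)
    He1 Hsg ltac:(lra) ltac:(lra) ltac:(lra) (hg L HLp) (proj1 S1) (proj1 S2) (proj1 S3) (proj1 S4)).
  rewrite KC in Red. rewrite Red. clear Red.
  specialize (KT T HT). unfold limit_trunc in KT.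
  revert KA KB KD KE KF KT.
  generalize (double_int (right_square sg h) (scaled_wt eps a1 b1 L x1) (fun z => / scaled_wt eps a2 b2 L (x2 + 1) z)%C)
    (double_int (right_square sg h) (scaled_wt eps b1 a1 L (- x1 - 1)) (fun z => / scaled_wt eps b2 a2 L (- x2) z)%C)
    (double_int (vchain sg T) (scaled_wt eps a1 b1 L x1) (fun z => / scaled_wt eps a2 b2 L (x2 + 1) z)%C)
    (double_int (vchain sg T) (scaled_wt eps b1 a1 L (- x1 - 1)) (fun z => / scaled_wt eps b2 a2 L (- x2) z)%C)
    (double_int (vchain sg T) (lim_wt eps mu1 x1) (fun z => / lim_wt eps mu2 (x2 + 1) z)%C)
    (double_int (vchain sg T) (lim_wt eps mu1 (- x1 - 1)) (fun z => / lim_wt eps mu2 (- x2) z)%C)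
    (chint (square 0 1) (fun w => scaled_wt eps a1 b1 L x1 w * / scaled_wt eps a2 b2 L (x2 + 1) w)%C)
    (chint (square 0 1) (fun w => lim_wt eps mu1 x1 w * / lim_wt eps mu2 (x2 + 1) w)%C) (limit_K eps G0 S x1 mu1 x2 mu2).
  intros rA rB vA vB lA lB s s' lim KA KB KD KE KF KT.
  set (p := (- ((if Rlt_dec mu1 mu2 then 1 else 0) / two_pi_i))%C) in *. set (q := (/ (two_pi_i * two_pi_i))%C) in *.
  assert (Bd : Cmod (p * s + q * (rA + rB) - lim)%C < d).
  { replace (p * s + q * (rA + rB) - lim)%C with
      (p * (s - s') + (q * ((rA - vA) + (rB - vB)) + (q * ((vA - lA) + (vB - lB)) - (lim - (p * s' + q * (lA + lB))))))%C by ring.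
    eapply Rle_lt_trans. apply Cmod_triangle.
    eapply Rle_lt_trans. apply Rplus_le_compat_l, Cmod_triangle.
    eapply Rle_lt_trans. apply Rplus_le_compat_l, Rplus_le_compat_l, Cmod_triangle_minus.
    rewrite !Cmod_mult. fold c c1.
    assert (X1 : c1 * Cmod (s - s') <= c1 * eta) by (apply Rmult_le_compat_l; trivial).
    assert (X2 : c * Cmod (rA - vA + (rB - vB)) <= c * (kA / T + kB / T)).
    { apply Rmult_le_compat_l; trivial. eapply Rle_trans. apply Cmod_triangle. lra. }
    assert (X3 : c * Cmod (vA - lA + (vB - lB)) <= c * (eta + eta)).
    { apply Rmult_le_compat_l; trivial. eapply Rle_trans. apply Cmod_triangle. lra. }
    assert (X4 : M / T = k / T + c * (kA / T + kB / T)) by (unfold M; field; lra).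
    assert (X5 : eta * (c1 + 2 * c + 1) = d / 3) by (unfold eta; field; lra).
    nra. }
  split.
  - change (Rabs (Re (p * s + q * (rA + rB))%C - Re lim) < d). rewrite <- re_minus. eapply Rle_lt_trans. apply re_le_Cmod. trivial.
  - change (Rabs (Im (p * s + q * (rA + rB))%C - Im lim) < d). rewrite <- im_minus. eapply Rle_lt_trans. apply im_le_Cmod. trivial.
Qed.
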